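(* Let $G$ be an infinite connected simple vertex-transitive graph with bounded degrees, let $o$ be a vertex of $G$, and let $0\le p<p_T(G)$. Put $$c_p := E^{\mathbb{P}_p}\big[\,|C_o|\,P^o(T_{C_o}=+\infty)\,\big].$$ Then for every $1\le q<+\infty$, $$\lim_{n\to\infty}\frac{U_n}{n}=c_p,\qquad \widetilde P^{o,p}\text{-a.s. and in } L^q(\widetilde P^{o,p}).$$
   Context: $(S_n)_{n\ge0}$ is the simple random walk on $G$, and $P^x$ is its law started at the vertex $x$. For a set $A$ of vertices, $T_A:=\inf\{n\ge1: S_n\in A\}$ (with $\inf\emptyset=+\infty$). $\mathbb{P}_p$ is the law of Bernoulli bond percolation on $G$ in which each edge is open independently with probability $p$; $C_x$ is the open cluster containing the vertex $x$. $p_T(G):=\inf\{p\in[0,1]:E^{\mathbb{P}_p}[|C_o|]=+\infty\}$ (independent of the choice of vertex $o$). $E^\mu$ is expectation with respect to $\mu$. $\widetilde P^{o,p}:=P^o\otimes\mathbb{P}_p$ (walk and percolation independent). $U_n:=\big|\bigcup_{x\in\{S_0,\dots,S_n\}}C_x\big|$. A graph is vertex-transitive if its automorphism group acts transitively on its vertices. *)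

(* Defs.v *)
From mathcomp Require Import all_boot all_order all_algebra finmap.
From mathcomp Require Import all_classical all_reals all_analysis.
From mathcomp Require Import measurable_realfun.
Set Implicit Arguments.
Unset Strict Implicit.
Unset Printing Implicit Defensive.
Import Order.TTheory GRing.Theory Num.Theory.
Import numFieldNormedType.Exports.
Local Open Scope classical_set_scope.
Local Open Scope ring_scope.

Section Graph.
Variable V : choiceType.
Implicit Types (r adj : rel V).

Definition reachable r (x y : V) : Prop :=
  exists2 s : seq V, path r x s & last x s = y.

Definition simple_graph adj : Prop := symmetric adj /\ irreflexive adj.

Definition connected_graph adj : Prop := forall x y, reachable adj x y.

Definition nbhd adj (x : V) : set V := [set y | adj x y].

Definition bounded_degrees adj : Prop :=
  exists D : nat, forall x, (nbhd adj x #<= `I_D)%card.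

Definition degree adj (x : V) : nat := #|` fset_set (nbhd adj x)|.

Definition automorphism adj (f : V -> V) : Prop :=
  bijective f /\ forall x y, adj (f x) (f y) = adj x y.

Definition vertex_transitive adj : Prop :=
  forall x y, exists2 f, automorphism adj f & f x = y.

Definition edges adj : set (set V) :=
  [set e | exists x y, adj x y /\ e = [set x; y]].

End Graph.

(* As V is countable for every graph considered, this is the product of the
   discrete sigma-algebras. *)
Definition path_cylinders (V : pointedType) : set (set (nat -> V)) :=
  [set A | exists n v, A = [set w | w n = v]].

Definition walk_space (V : pointedType) := g_sigma_algebraType (@path_cylinders V).

Definition open_edge_events (V : choiceType) (adj : rel V) :
    set (set (edges adj -> bool)) :=
  [set A | exists e, A = [set omega | omega e = true]].

Definition config (V : choiceType) (adj : rel V) :=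
  g_sigma_algebraType (@open_edge_events V adj).

Section Walk.
Variables (R : realType) (V : pointedType) (adj : rel V).

Definition srw_step (x y : V) : R :=
  if adj x y then (degree adj x)%:R^-1 else 0.

(* The cylinders form a pi-system generating the sigma-algebra of walk_space,
   so at most one probability satisfies this. *)
Definition is_srw_law (o : V) (P : probability (walk_space V) R) : Prop :=
  forall (n : nat) (x : nat -> V),
    P [set w | forall i, (i <= n)%N -> w i = x i] =
    ((x 0%N == o)%:R * \prod_(i < n) srw_step (x i) (x i.+1))%:E.

Definition hitting_time (A : set V) (w : walk_space V) : \bar R :=
  ereal_inf [set n%:R%:E | n in [set n : nat | (1 <= n)%N /\ A (w n)]].

End Walk.

Section Percolation.
Variables (R : realType) (V : choiceType) (adj : rel V).

(* P is the product over the edges of the Bernoulli(p) law on bool. *)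
Definition is_bernoulli_percolation (p : R)
    (P : probability (config adj) R) : Prop :=
  forall (F : {fset edges adj}) (b : edges adj -> bool),
    P [set omega | forall e, e \in F -> omega e = b e] =
    (\prod_(e <- F) (if b e then p else 1 - p))%:E.

Definition open_adj (omega : config adj) : rel V :=
  fun x y => `[< exists e : edges adj, val e = [set x; y] /\ omega e >].

Definition cluster (omega : config adj) (x : V) : set V :=
  [set y | reachable (open_adj omega) x y].

(* For an infinite connected graph the set below contains 1, so the real-valued
   inf is the true infimum. *)
Definition p_T (o : V) : R :=
  inf [set p : R | 0 <= p <= 1 /\
    exists2 P : probability (config adj) R,
      is_bernoulli_percolation p P &
      (\int[P]_omega counting (cluster omega o))%E = +oo%E].

End Percolation.

Section Exploration.
Variables (R : realType) (V : pointedType) (adj : rel V).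

(* The first component is the walk (S_n), the second the configuration. *)
Definition U (n : nat) (z : walk_space V * config adj) : \bar R :=
  counting (\bigcup_(x in z.1 @` `I_n.+1) cluster z.2 x).

Definition c_p (o : V) (Po : probability (walk_space V) R)
    (Pp : probability (config adj) R) : \bar R :=
  (\int[Pp]_omega (counting (cluster omega o) *
     Po [set w | hitting_time R (cluster omega o) w = +oo]))%E.

End Exploration.

Definition cvg_in_L d (T : measurableType d) (R : realType)
    (mu : {measure set T -> \bar R}) (q : R)
    (X : nat -> T -> \bar R) (Y : T -> \bar R) : Prop :=
  [/\ forall n, measurable_fun setT (X n) /\ ('N[mu]_(q%:E)[X n] < +oo)%E,
      measurable_fun setT Y /\ ('N[mu]_(q%:E)[Y] < +oo)%E &
      'N[mu]_(q%:E)[X n \- Y]%E @[n --> \oo] --> 0%E].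

(* Main.v *)
(* Counting each cluster at its last visit before time n, U_n is the sum over i <= n of |C_{S_i}| on
   the event that the walk does not return to C_{S_i} during (i, n].  Hence, up to m boundary terms,
   U_n lies between the sums along the walk of Y_oo = |C_{S_0}| 1{no return ever} and of
   Y_m = |C_{S_0}| 1{no return before time m}.  These functionals of (walk, configuration) are
   invariant under the diagonal action of the automorphisms, so by vertex-transitivity they form
   stationary sequences along the walk, and E Y_m decreases to E Y_oo = c_p: it is enough to prove an
   ergodic theorem for them.

   Cutting clusters at radius r approximates Y in L^1 by bounded functionals.  By the Markov property
   and the independence of disjoint sets of edges, the values of such a functional at times 0 and
   k >= r are uncorrelated unless S_k is within distance 2r of S_0, which has probability tending to
   0: along p_k(., y) the l^2 norm decreases, and the decrement controls the difference between two
   vertices with a common neighbour, so that p_k(., y) flattens out on an infinite set.  Averages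
   therefore converge in L^1, and a maximal inequality turns this into almost sure convergence.

   For L^q, reveal the cluster of o one edge at a time.  The conditional expectation of |C_o| is a
   martingale with increments bounded by chi = E|C_o| < oo, stopped after at most deg * |C_o| steps,
   so E exp (s |C_o| - K deg |C_o|) <= exp (s chi) with K = O(s^2), and |C_o| has an exponential
   moment.  By convexity U_n / n has uniformly bounded exponential moments, whence the convergence of
   all moments. *)
Require Import Defs.
From mathcomp Require Import all_boot all_order all_algebra finmap.
From mathcomp Require Import all_classical all_reals all_analysis.
From mathcomp Require Import measurable_realfun.
From mathcomp Require Import zify ring lra.
Set Implicit Arguments.
Unset Strict Implicit.
Unset Printing Implicit Defensive.
Import Order.TTheory GRing.Theory Num.Theory.
Import numFieldNormedType.Exports.
Local Open Scope classical_set_scope.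
Local Open Scope ring_scope.

(* mathcomp-analysis also has a [cluster], about filters. *)
Local Notation cluster := Defs.cluster.


(** * Bernoulli percolation *)

(** Only the law of the walk from [o] is given, so the Markov property is phrased with it alone:
    after a first step to [x] the walk is the image of a walk from [o] under an automorphism sending
    [o] to [x]. For functionals invariant under automorphisms the chosen automorphism disappears
    from the formulas, so stationarity and the Markov property hold for exactly these.

    Two kinds of dependence have to be broken between times 0 and k. The condition k >= r separates
    the two pieces of walk that are read, and disjointness of the two balls of radius r separates
    the two sets of edges.

    The walk may be periodic: on a bipartite graph p_k(., y) vanishes on one of the two classes at
    each time, and the decrement of the l^2 norm gives no direct control of the difference across an
    edge. This is why vertices with a common neighbour are compared; the classes they generate are
    still infinite.

    The hypothesis p < p_T acts through the finiteness of chi: otherwise p would belong to the set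
    whose infimum is p_T. *)

Section ImageMeasure.
Context d d' (T1 : measurableType d) (T2 : measurableType d') (R : realType).
Variables (m : {measure set T1 -> \bar R}) (f : T1 -> T2) (mf : measurable_fun setT f).

Definition image_measure : {measure set T2 -> \bar R}.
Proof. by refine (pushforward m f : {measure set T2 -> \bar R}); exact: mf. Defined.

Lemma image_measureE A : image_measure A = m (f @^-1` A).
Proof. by []. Qed.

Lemma integral_image_measure (g : T2 -> \bar R) :
  measurable_fun setT g -> (forall y, 0 <= g y)%E ->
  (\int[image_measure]_y g y = \int[m]_x g (f x))%E.
Proof. by move=> mg g0; rewrite ge0_integral_pushforward ?preimage_setT//. Qed.

End ImageMeasure.

Section Config.
Variables (R : realType) (V : choiceType) (adj : rel V).
Implicit Types (e : edges adj) (F : {fset edges adj}).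

Lemma measurable_edge_open e : measurable [set omega : config adj | omega e].
Proof.
apply: sub_sigma_algebra; exists e; apply/seteqP; split=> omega /=; first by move=> ->.
by move=> ->.
Qed.

Definition all_open F : set (config adj) := [set omega | forall e, e \in F -> omega e].

Lemma measurable_all_open F : measurable (all_open F).
Proof.
have -> : all_open F = \bigcap_(e in [set` F]) [set omega : config adj | omega e].
  by apply/seteqP; split=> omega /= h e; exact: h.
apply: fin_bigcap_measurable => [|e _]; first exact: finite_fset.
exact: measurable_edge_open.
Qed.

Lemma all_open_fset0 : all_open fset0 = setT.
Proof. by apply/seteqP; split=> // omega _ e; rewrite inE. Qed.

(* Events prescribing only open edges already form a pi-system generating the sigma-algebra. *)
Lemma config_measure_unique (m1 m2 : {measure set (config adj) -> \bar R}) :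
  (m1 setT < +oo)%E ->
  (forall F, m1 (all_open F) = m2 (all_open F)) ->
  forall A, measurable A -> m1 A = m2 A.
Proof.
move=> m1oo m12.
pose G := [set A | exists F, A = all_open F].
apply: (@measure_unique _ _ _ G (fun=> setT)).
- apply/seteqP; split.
    apply: smallest_sub; first exact: smallest_sigma_algebra.
    move=> A [e ->]; apply: sub_sigma_algebra; exists [fset e]%fset.
    apply/seteqP; split=> omega /=.
      by move=> h e'; rewrite inE => /eqP ->; rewrite h.
    by move=> h; apply: h; rewrite inE.
  apply: smallest_sub; first exact: sigma_algebra_measurable.
  by move=> A [F ->]; exact: measurable_all_open.
- move=> A B [F ->] [F' ->]; exists (F `|` F')%fset.
  apply/seteqP; split=> omega /=.
    by move=> [h h'] e; rewrite inE => /orP[/h|/h'].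
  by move=> h; split=> e eF; apply: h; rewrite inE eF ?orbT.
- by move=> _; exists fset0; rewrite all_open_fset0.
- by rewrite bigcup_const.
- by move=> A [F ->]; exact: m12.
- by [].
Qed.

Definition set_edge e (b : bool) (omega : config adj) : config adj :=
  fun e' => if e' == e then b else omega e'.

Lemma measurable_config (d : measure_display) (T : measurableType d) (f : T -> config adj) :
  (forall e, measurable [set x | f x e]) -> measurable_fun setT f.
Proof.
move=> mf; apply: (@measurability _ _ T (config adj) setT f (@open_edge_events V adj)) => //.
move=> _ [_ [e ->] <-]; rewrite setTI.
have -> : f @^-1` [set omega | omega e = true] = [set x | f x e] by [].
exact: mf.
Qed.

Lemma measurable_set_edge e b : measurable_fun setT (set_edge e b).
Proof.
apply: measurable_config => e'; rewrite /set_edge; case: eqP => _.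
  by case: b; [rewrite (_ : mkset _ = setT)|rewrite (_ : mkset _ = set0)] => //;
     apply/seteqP; split.
exact: measurable_edge_open.
Qed.

Definition reindex_edges (f : edges adj -> edges adj) (omega : config adj) : config adj :=
  fun e => omega (f e).

Lemma measurable_reindex_edges f : measurable_fun setT (reindex_edges f).
Proof. by apply: measurable_config => e; exact: measurable_edge_open. Qed.

Variables (p : R) (P : probability (config adj) R).
Hypotheses (p01 : 0 <= p <= 1) (bernP : is_bernoulli_percolation p P).

Lemma prob_all_open F : P (all_open F) = (p ^+ #|` F|)%:E.
Proof.
have := bernP F (fun=> true).
rewrite big_const_seq count_predT iter_mulr_1 /=.
by move=> <-; congr (P _).
Qed.

Local Open Scope ereal_scope.

(** [P] is the mixture, with weights p and 1 - p, of its images under forcing [e] open and forcing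
    it closed. On [all_open F] with [e] in [F] the closed image has no mass, and the open one only
    has to open the other edges of [F]. Independence and the exploration martingale both rest on
    this identity. *)
Lemma resample_edge e (f : config adj -> \bar R) :
  measurable_fun setT f -> (forall omega, 0 <= f omega) ->
  \int[P]_omega f omega =
    p%:E * \int[P]_omega f (set_edge e true omega) +
    (1 - p)%:E * \int[P]_omega f (set_edge e false omega).
Proof.
move=> mf f0; case/andP: (p01) => p0 p1.
have q0 : (0 <= 1 - p)%R by rewrite subr_ge0.
pose mu b := image_measure P (measurable_set_edge e b).
pose nu : {measure set (config adj) -> \bar R} :=
  measure_add (mscale (NngNum p0) (mu true)) (mscale (NngNum q0) (mu false)).
have PE A : measurable A -> P A = nu A.
  apply: config_measure_unique; first by rewrite (le_lt_trans (probability_le1 _ _))// ltry.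
  move=> F; rewrite [RHS]measure_addE /= /mscale/= /pushforward.
  have [eF|eF] := boolP (e \in F).
    have -> : set_edge e true @^-1` all_open F = all_open (F `\ e)%fset.
      apply/seteqP; split=> omega /= h e'.
        by rewrite !inE => /andP[/negbTE ne /h]; rewrite /set_edge ne.
      rewrite /set_edge; case: eqVneq => // ne e'F; apply: h.
      by rewrite !inE ne.
    have -> : set_edge e false @^-1` all_open F = set0.
      apply/seteqP; split=> omega //= /(_ e eF).
      by rewrite /set_edge eqxx.
    rewrite measure0 mule0 adde0 !prob_all_open -EFinM.
    by rewrite (cardfsD1 e F) eF add1n exprS.
  have E b : set_edge e b @^-1` all_open F = all_open F.
    apply/seteqP; split=> omega /= h e' e'F; have := h e' e'F;
    by rewrite /set_edge; case: eqP => // ee'; rewrite -ee' e'F in eF.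
  rewrite !E -ge0_muleDl ?lee_fin// -EFinD.
  by rewrite addrC subrK mul1e.
rewrite (eq_measure_integral nu); last by move=> A mA _; exact: PE.
rewrite ge0_integral_measure_add//.
by rewrite !ge0_integral_mscale// !integral_image_measure.
Qed.

(** Pulling [all_open F] back along an injection prescribes the same number of distinct edges, hence
    an event of the same probability. This gives the invariance of percolation under
    automorphisms. *)
Lemma integral_reindex_edges (g : edges adj -> edges adj) (f : config adj -> \bar R) :
  injective g -> measurable_fun setT f -> (forall omega, 0 <= f omega) ->
  \int[P]_omega f (reindex_edges g omega) = \int[P]_omega f omega.
Proof.
move=> g_inj mf f0; have mg := measurable_reindex_edges g.
pose nu := image_measure P mg.
have PE A : measurable A -> P A = nu A.
  apply: config_measure_unique; first by rewrite (le_lt_trans (probability_le1 _ _))// ltry.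
  move=> F; rewrite /nu image_measureE.
  have -> : reindex_edges g @^-1` all_open F = all_open (g @` F)%fset.
    apply/seteqP; split=> omega /= h e.
      by move=> /imfsetP[e' /= /h ? ->].
    by move=> eF; apply: h; exact: in_imfset.
  by rewrite [LHS]prob_all_open [RHS]prob_all_open card_imfset.
rewrite [RHS](eq_measure_integral nu); last by move=> A mA _; exact: PE.
by rewrite integral_image_measure.
Qed.

(** Induction on the finite set [H]: resampling one of its edges splits the integral of [f] and
    leaves [g] unchanged. Once [H] is exhausted, [f] is constant. *)
Lemma integral_indep (H : {fset edges adj}) (f g : config adj -> \bar R) :
  measurable_fun setT f -> (forall omega, 0 <= f omega) ->
  measurable_fun setT g -> (forall omega, 0 <= g omega) ->
  (forall omega omega', (forall e, e \in H -> omega e = omega' e) -> f omega = f omega') ->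
  (forall omega omega', (forall e, e \notin H -> omega e = omega' e) -> g omega = g omega') ->
  \int[P]_omega (f omega * g omega) = \int[P]_omega f omega * \int[P]_omega g omega.
Proof.
case/andP: (p01) => p0 p1.
have q0 : (0 <= 1 - p)%R by rewrite subr_ge0.
elim/finSet_rect: H f g => H IH f g mf f0 mg g0 fH gH.
have [H0|[e eH]] := fset_0Vmem H.
  have fc omega : f omega = f point by apply: fH => e; rewrite H0 inE.
  under eq_integral do rewrite fc.
  rewrite ge0_integralZl//.
  under [X in _ = X * _]eq_integral do rewrite fc.
  by rewrite integral_cst//= [X in _ * X * _](probability_setT P) mule1.
have mse b := measurable_set_edge e b.
rewrite (resample_edge e (emeasurable_funM mf mg)); last by move=> ?; exact: mule_ge0.
rewrite (resample_edge e mf f0).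
have gE b omega : g (set_edge e b omega) = g omega.
  apply: gH => e' e'H; rewrite /set_edge; case: eqP => // ee'.
  by rewrite ee' eH in e'H.
have main b : \int[P]_omega (f (set_edge e b omega) * g (set_edge e b omega)) =
    \int[P]_omega f (set_edge e b omega) * \int[P]_omega g omega.
  under eq_integral do rewrite gE.
  apply: (IH (H `\ e)%fset _ (f \o set_edge e b)) => //.
  - exact: fproperD1.
  - exact: measurableT_comp.
  - by move=> omega; exact: f0.
  - move=> omega omega' h; apply: fH => e' e'H /=; rewrite /set_edge.
    by have [//|ne] := eqVneq e' e; apply: h; rewrite !inE ne.
  - move=> omega omega' h; rewrite -(gE true omega) -(gE true omega'); apply: gH => e' e'H.
    rewrite /set_edge; have [//|ne] := eqVneq e' e; apply: h.
    by rewrite !inE ne (negbTE e'H).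
have If b : 0 <= \int[P]_omega f (set_edge e b omega).
  by apply: integral_ge0 => omega _; exact: f0.
by rewrite !main !muleA -ge0_muleDl// mule_ge0// lee_fin.
Qed.

End Config.


(** * Reachability and balls *)

Section Reach.
Variable V : choiceType.
Implicit Types (q : rel V) (x y z : V).

Lemma reachable_refl q x : reachable q x x.
Proof. by exists [::]. Qed.

Lemma reachable_step q x y z : reachable q x y -> q y z -> reachable q x z.
Proof.
move=> [s sp sl] qyz; exists (rcons s z); last by rewrite last_rcons.
by rewrite rcons_path sp sl.
Qed.

Lemma reachable_ind q x (A : set V) :
  A x -> (forall y z, A y -> q y z -> A z) -> forall y, reachable q x y -> A y.
Proof.
move=> Ax qA y [s]; elim: s x Ax => [|z s IH] x Ax /=; first by move=> _ <-.
by move=> /andP[qxz sp] sl; apply: (IH z) => //; exact: qA qxz.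
Qed.

Lemma reachable_trans q x y z : reachable q x y -> reachable q y z -> reachable q x z.
Proof.
move=> xy; apply: reachable_ind => // u v; exact: reachable_step.
Qed.

Lemma reachable_sym q x y : symmetric q -> reachable q x y -> reachable q y x.
Proof.
move=> sq; apply: (@reachable_ind q x (fun y => reachable q y x)).
  exact: reachable_refl.
move=> u v ux quv; apply: reachable_trans ux.
by apply: (reachable_step (reachable_refl _ _)); rewrite sq.
Qed.

Lemma sub_reachable q q' x y : subrel q q' -> reachable q x y -> reachable q' x y.
Proof.
move=> qq'; apply: reachable_ind; first exact: reachable_refl.
by move=> u v xu /qq' uv; exact: reachable_step uv.
Qed.

Lemma reachable_image q q' (f : V -> V) x y :
  (forall u v, q u v -> q' (f u) (f v)) -> reachable q x y -> reachable q' (f x) (f y).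
Proof.
move=> qq'; apply: (@reachable_ind q x (fun y => reachable q' (f x) (f y))).
  exact: reachable_refl.
by move=> u v xu /qq' uv; exact: reachable_step uv.
Qed.

End Reach.

Section Balls.
Variables (V : choiceType) (adj : rel V).
Hypothesis bounded : bounded_degrees adj.
Implicit Types (q : rel V) (x y z : V).

Definition nb x : {fset V} := fset_set (nbhd adj x).

Lemma finite_nbhd x : finite_set (nbhd adj x).
Proof. by have [D /(_ x)/card_le_finite] := bounded; apply; exact: finite_II. Qed.

Lemma in_nb x y : (y \in nb x) = adj x y.
Proof. by rewrite in_fset_set ?inE//; [rewrite /nbhd; apply/idP/idP; rewrite inE|exact: finite_nbhd]. Qed.

(* The ball of radius [r] around [x] in the subgraph [q]: [gball adj adj x r] is a ball of the graph,
   and [gball adj (open_adj omega) x r] exhausts the cluster of [x] as [r] grows. *)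
Fixpoint gball q x r : {fset V} :=
  if r is r'.+1 then
    (gball q x r' `|` \bigcup_(z <- gball q x r') [fset y in nb z | q z y])%fset
  else [fset x]%fset.

Lemma mem_gballS q x r y : reflect
  (y \in gball q x r \/ exists2 z, z \in gball q x r & adj z y && q z y)
  (y \in gball q x r.+1).
Proof.
rewrite /= in_fsetU; apply: (iffP orP).
  case; [by left|move=> /bigfcupP[z]].
  by rewrite andbT => zB; rewrite !inE/= in_nb => ?; right; exists z.
case; [by left|move=> [z zB zy]; right; apply/bigfcupP; exists z; first by rewrite zB].
by rewrite !inE/= in_nb.
Qed.

Lemma gball_refl q x r : x \in gball q x r.
Proof. by elim: r => [|r IH]; [rewrite inE|apply/mem_gballS; left]. Qed.

Lemma gball_sub_leq q x r r' : (r <= r')%N -> (gball q x r `<=` gball q x r')%fset.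
Proof.
move=> /subnK <-; elim: (r' - r)%N => [//|k IH]; rewrite addSn.
by apply: fsubset_trans IH _; apply/fsubsetP => y yB; apply/mem_gballS; left.
Qed.

Lemma gball_reachable q x r y : y \in gball q x r -> reachable q x y.
Proof.
elim: r y => [|r IH] y; first by rewrite inE => /eqP ->; exact: reachable_refl.
case/mem_gballS => [/IH//|[z /IH xz /andP[_ zy]]].
exact: reachable_step zy.
Qed.

Lemma reachable_gball q x y : subrel q adj -> reachable q x y -> exists r, y \in gball q x r.
Proof.
move=> qadj; apply: (@reachable_ind _ q x (fun y => exists r, y \in gball q x r)).
  by exists 0%N; exact: gball_refl.
move=> u v [r ur] uv; exists r.+1; apply/mem_gballS; right; exists u => //.
by rewrite uv qadj.
Qed.

Lemma gball_sub_ball q x r : (gball q x r `<=` gball adj x r)%fset.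
Proof.
elim: r => [|r /fsubsetP IH]; first by rewrite fsubset_refl.
apply/fsubsetP => y /mem_gballS[/IH yB|[z /IH zB /andP[zy _]]].
  by apply/mem_gballS; left.
by apply/mem_gballS; right; exists z => //; rewrite zy.
Qed.

(** Every step of the exploration joins two points of the full ball, so only edges inside that ball
    are read. *)
Lemma eq_gball q q' x r :
  (forall y z, y \in gball adj x r -> z \in gball adj x r -> adj y z -> q y z = q' y z) ->
  gball q x r = gball q' x r.
Proof.
elim: r => [//|r IH] qq'.
have IHr : gball q x r = gball q' x r.
  by apply: IH => y z yB zB; apply: qq'; apply/mem_gballS; left.
have sub y : y \in gball q' x r -> y \in gball adj x r := fsubsetP (gball_sub_ball _ _ _) y.
have eqq z y : z \in gball q' x r -> adj z y -> q z y = q' z y.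
  move=> /sub zB zy; apply: qq' => //; apply/mem_gballS; first by left.
  by right; exists z => //; rewrite zy.
apply/fsetP => y; apply/mem_gballS/mem_gballS; rewrite IHr.
  move=> [yB|[z zB /andP[zy qzy]]]; [by left|right; exists z => //].
  by rewrite zy -eqq.
move=> [yB|[z zB /andP[zy qzy]]]; [by left|right; exists z => //].
by rewrite zy eqq.
Qed.

Lemma gball_automorphism q q' f x r y :
  automorphism adj f -> (forall u v, q u v = q' (f u) (f v)) ->
  (y \in gball q x r) = (f y \in gball q' (f x) r).
Proof.
move=> [[g fg gf] fadj] qq'; elim: r y => [|r IH] y.
  by rewrite !inE (inj_eq (can_inj fg)).
apply/mem_gballS/mem_gballS; rewrite IH.
  move=> [|[z zB zy]]; [by left|right; exists (f z); first by rewrite -IH].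
  by rewrite fadj -qq'.
move=> [|[z zB zy]]; [by left|right; exists (g z); first by rewrite IH gf].
by rewrite -fadj qq' gf.
Qed.

Lemma card_gball_automorphism q q' f x r :
  automorphism adj f -> (forall u v, q u v = q' (f u) (f v)) ->
  #|` gball q x r| = #|` gball q' (f x) r|.
Proof.
move=> fA qq'; have [[g fg gf] _] := fA.
suff -> : gball q' (f x) r = (f @` gball q x r)%fset.
  by rewrite card_imfset//; exact: can_inj fg.
apply/fsetP => y; apply/idP/imfsetP => [yB|[z /= zB ->]].
  by exists (g y); rewrite ?gf//= (gball_automorphism _ _ _ fA qq') gf.
by rewrite -(gball_automorphism _ _ _ fA qq').
Qed.

(** A ball that gains nothing in one step is closed under [q], hence is the whole component. *)
Lemma gball_stable q x r : subrel q adj -> gball q x r.+1 = gball q x r ->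
  [set y | reachable q x y] = [set` gball q x r].
Proof.
move=> qadj e; apply/seteqP; split=> y /=; last exact: gball_reachable.
apply: (@reachable_ind _ q x [set` gball q x r]) => [|u v /= uB uv]; first exact: gball_refl.
by rewrite -e; apply/mem_gballS; right; exists u => //; rewrite uv qadj.
Qed.

Lemma finite_reachable_gball q x : subrel q adj -> finite_set [set y | reachable q x y] ->
  exists r0, forall r, (r0 <= r)%N -> [set` gball q x r] = [set y | reachable q x y].
Proof.
move=> qadj fin.
have [r0 e] : exists r, gball q x r.+1 = gball q x r.
  apply: contrapT => /forallNP h.
  pose C := fset_set [set y | reachable q x y].
  have sub r : (gball q x r `<=` C)%fset.
    by apply/fsubsetP => y /gball_reachable yr; rewrite in_fset_set// inE.
  (* Every radius would add at least one vertex, against the finite cardinal of the component. *)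
  have big r : (r < #|` gball q x r|)%N.
    elim: r => [|r IH]; first by rewrite cardfs1.
    apply: leq_ltn_trans IH _; apply: fproper_ltn_card; rewrite fproperEneq.
    by rewrite gball_sub_leq// andbT; apply/eqP => e; exact: (h r).
  by have := leq_trans (big #|` C|) (fsubset_leq_card (sub #|` C|)); rewrite ltnn.
exists r0 => r /subnK <-; rewrite (gball_stable qadj e).
suff -> : gball q x (r - r0 + r0) = gball q x r0 by [].
elim: (r - r0)%N => [//|k IH]; rewrite addSn; apply/fsetP => y.
apply/idP/idP; last by move=> yB; apply/mem_gballS; left; rewrite IH.
move=> /mem_gballS; rewrite IH => -[//|[z zB zy]].
by rewrite -e; apply/mem_gballS; right; exists z.
Qed.

(** Since balls read finitely many edges, this limit carries measurability and monotone limits over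
    to the cluster size. Infinite components are included: there the balls grow strictly at every
    radius. *)
Lemma counting_gball_cvg (R : realType) q x : subrel q adj ->
  (#|` gball q x r|%:R%:E @[r --> \oo] --> (counting [set y | reachable q x y] : \bar R))%E.
Proof.
move=> qadj; rewrite /counting; case: ifPn => /asboolP fin.
  have [r0 h] := finite_reachable_gball qadj fin.
  apply: cvg_near_cst; exists r0 => // r /= /h <-.
  by rewrite set_fsetK.
apply/cvgeryP/cvgrnyP; apply/cvgnyPge => n.
exists n => // r /= nr; apply: leq_trans nr _; apply: ltnW.
elim: r => [|r IH]; first by rewrite cardfs1.
apply: leq_ltn_trans IH _; apply: fproper_ltn_card; rewrite fproperEneq.
rewrite gball_sub_leq// andbT; apply/eqP => e; apply: fin.
by rewrite (@gball_stable q x r)//; exact: finite_fset.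
Qed.

Lemma card_gball_le_counting (R : realType) q x r : subrel q adj ->
  (#|` gball q x r|%:R%:E <= (counting [set y | reachable q x y] : \bar R))%E.
Proof.
move=> qadj; rewrite /counting; case: ifPn => /asboolP fin; last by rewrite leey.
rewrite lee_fin ler_nat; apply: fsubset_leq_card; apply/fsubsetP => y /gball_reachable yr.
by rewrite in_fset_set// inE.
Qed.

End Balls.


(** * Open edges, the action of automorphisms, and events depending on finitely many edges *)

Section OpenEdges.
Variables (V : choiceType) (adj : rel V).
Hypotheses (adj_sym : symmetric adj) (bounded : bounded_degrees adj).
Implicit Types (e : edges adj) (omega : config adj) (x y z : V).

Lemma eq_set2 x y x' y' : [set x; y] = [set x'; y'] :> set V ->
  (x = x' /\ y = y') \/ (x = y' /\ y = x').
Proof.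
move=> /seteqP[h h'].
have := h x (or_introl erefl); have := h y (or_intror erefl).
have := h' x' (or_introl erefl); have := h' y' (or_intror erefl).
by move=> /= [?|?] [?|?] [?|?] [?|?]; subst; (left + right).
Qed.

Lemma in_edges x y : ([set x; y] \in edges adj) = adj x y.
Proof.
apply/idP/idP; rewrite inE.
  by move=> [u [v [uv /eq_set2[[-> ->]|[-> ->]]]]]; rewrite // adj_sym.
by move=> xy; exists x, y.
Qed.

Lemma edgeP e : exists x y, adj x y /\ val e = [set x; y].
Proof. by case: e => A /= /set_mem. Qed.

Definition edge_at x y : option (edges adj) := insub [set x; y].

Lemma edge_atP x y e : edge_at x y = Some e <-> val e = [set x; y].
Proof.
rewrite /edge_at; case: insubP => [u _ <-|].
  by split=> [[->]|/val_inj ->].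
rewrite in_edges => /negP xy; split=> // ee; exfalso; apply: xy.
by rewrite -in_edges -ee; exact: valP.
Qed.

Lemma edge_at_adj x y : adj x y -> exists e, edge_at x y = Some e.
Proof. by rewrite -in_edges /edge_at => h; rewrite insubT; eexists. Qed.

Lemma open_adjE omega x y : open_adj omega x y = oapp omega false (edge_at x y).
Proof.
apply/asboolP/idP => [[e [/edge_atP -> //]]|].
by case E: (edge_at x y) => [e|] //= oe; exists e; split=> //; exact/edge_atP.
Qed.

Lemma open_adj_sub omega : subrel (open_adj omega) adj.
Proof.
move=> x y; rewrite open_adjE; case E: (edge_at x y) => [e|] // _.
by move/edge_atP : E; rewrite -in_edges => <-; exact: valP.
Qed.

Lemma open_adj_sym omega : symmetric (open_adj omega).
Proof. by move=> x y; rewrite !open_adjE /edge_at setUC. Qed.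

Definition edges_at x : {fset edges adj} :=
  [fset e in pmap (edge_at x) (nb adj x)]%fset.

Lemma edges_atP x e : reflect (val e x) (e \in edges_at x).
Proof.
rewrite inE mem_pmap; apply: (iffP mapP) => [[y _ /esym/edge_atP ->]|ex]; first by left.
have [u [v [uv euv]]] := edgeP e; move: ex; rewrite euv => -[/= xu|/= xv]; subst.
  by exists v; [rewrite in_nb|apply/esym/edge_atP].
by exists u; [rewrite in_nb// adj_sym|apply/esym/edge_atP; rewrite setUC].
Qed.

Lemma card_edges_at x : (#|` edges_at x| <= #|` nb adj x|)%N.
Proof.
apply: leq_trans (_ : (size (pmap (edge_at x) (nb adj x)) <= _)%N); last first.
  by rewrite size_pmap count_size.
by rewrite card_fseq size_undup.
Qed.

Definition edges_meeting (B : {fset V}) : {fset edges adj} := (\bigcup_(x <- B) edges_at x)%fset.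

Lemma edges_meetingP (B : {fset V}) e :
  reflect (exists2 x, x \in B & val e x) (e \in edges_meeting B).
Proof.
apply: (iffP idP) => [/bigfcupP[x]|[x xB ex]]; first by rewrite andbT => xB /edges_atP; exists x.
by apply/bigfcupP; exists x; [rewrite xB|exact/edges_atP].
Qed.

Section Automorphism.
Variable f : V -> V.
Hypothesis f_aut : automorphism adj f.

Lemma edge_image_subproof e : f @` val e \in edges adj.
Proof.
have [x [y [xy ->]]] := edgeP e; rewrite image_setU !image_set1 in_edges.
by case: f_aut => _ ->.
Qed.

Definition edge_image e : edges adj := Sub (f @` val e) (edge_image_subproof e).

Lemma edge_image_inj : injective edge_image.
Proof.
case: f_aut => [[g fg _] _] e e' /(congr1 val); rewrite !SubK => ee'; apply: val_inj.
by rewrite -[val e](image_id) -[val e'](image_id) -(eq_imagel (fun x _ => fg x)) -image_comp ee'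
  image_comp (eq_imagel (fun x _ => fg x)).
Qed.

(* The action is by pull-back, so that [open_adj (act omega) x y = open_adj omega (f x) (f y)]. *)
Definition act : config adj -> config adj := reindex_edges edge_image.

Lemma open_adj_act omega x y : open_adj (act omega) x y = open_adj omega (f x) (f y).
Proof.
rewrite !open_adjE; have [xy|xy] := boolP (adj x y).
  have [e E] := edge_at_adj xy; rewrite E.
  suff -> : edge_at (f x) (f y) = Some (edge_image e) by [].
  by apply/edge_atP; rewrite SubK; move/edge_atP : E => ->; rewrite image_setU !image_set1.
have no u v : ~~ adj u v -> edge_at u v = None by move=> uv; rewrite /edge_at insubF// in_edges; exact/negbTE.
by rewrite !no//; case: f_aut => _ ->.
Qed.

Lemma cluster_act omega x y : cluster (act omega) x y <-> cluster omega (f x) (f y).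
Proof.
case: (f_aut) => [[g fg gf] _]; rewrite /cluster/=; split.
  by apply: reachable_image => u v; rewrite open_adj_act.
move=> xy; rewrite -(fg x) -(fg y); apply: reachable_image xy => u v.
by rewrite open_adj_act !gf.
Qed.

Lemma card_gball_act omega x r :
  #|` gball adj (open_adj (act omega)) x r| = #|` gball adj (open_adj omega) (f x) r|.
Proof. by apply: card_gball_automorphism => // u v; rewrite open_adj_act. Qed.

(** Ball sizes agree at every radius, and both sides are the limits of these sizes; finite and
    infinite clusters are thus treated at once. *)
Lemma counting_cluster_act (R : realType) omega x :
  counting (cluster (act omega) x) = counting (cluster omega (f x)) :> \bar R.
Proof.
have h1 := @counting_gball_cvg _ _ bounded R _ x (@open_adj_sub (act omega)).
have h2 := @counting_gball_cvg _ _ bounded R _ (f x) (@open_adj_sub omega).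
have E : (fun r => #|` gball adj (open_adj (act omega)) x r|%:R%:E : \bar R) =
         (fun r => #|` gball adj (open_adj omega) (f x) r|%:R%:E).
  by apply/funext => r; rewrite card_gball_act.
by rewrite E in h1; exact: (cvg_unique (@ereal_hausdorff R) h1 h2).
Qed.

End Automorphism.

Definition agree (H : {fset edges adj}) omega omega' := forall e, e \in H -> omega e = omega' e.

(** Induction on [H], splitting [f] according to the state of one edge. *)
Lemma measurable_local d (T : measurableType d) (H : {fset edges adj}) (f : config adj -> T) :
  (forall omega omega', agree H omega omega' -> f omega = f omega') -> measurable_fun setT f.
Proof.
elim/finSet_rect: H f => H IH f fH.
have [H0|[e eH]] := fset_0Vmem H.
  have -> : f = cst (f point) by apply/funext => omega; apply: fH => e; rewrite H0 inE.
  exact: measurable_cst.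
have -> : f = (fun omega => if omega e then f (set_edge e true omega) else f (set_edge e false omega)).
  apply/funext => omega; case E: (omega e); apply: fH => e' _; rewrite /set_edge;
  by have [->|] := eqVneq e' e.
have h b : measurable_fun setT (fun omega => f (set_edge e b omega)).
  apply: (IH (H `\ e)%fset); first exact: fproperD1.
  move=> omega omega' oo; apply: fH => e' e'H; rewrite /set_edge.
  by have [//|ne] := eqVneq e' e; apply: oo; rewrite !inE ne.
apply: measurable_fun_ifT => //.
apply: (@measurable_fun_bool _ _ _ _ true); rewrite setTI.
rewrite (_ : _ @^-1` _ = [set omega : config adj | omega e]); first exact: measurable_edge_open.
by apply/seteqP; split.
Qed.

Lemma open_adj_agree (B : {fset V}) omega omega' x y :
  agree (edges_meeting B) omega omega' -> x \in B -> open_adj omega x y = open_adj omega' x y.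
Proof.
move=> oo xB; rewrite !open_adjE; case E: (edge_at x y) => [e|] //=; apply: oo.
by apply/edges_meetingP; exists x => //; move/edge_atP : E => ->; left.
Qed.

Lemma gball_agree omega omega' x r :
  agree (edges_meeting (gball adj adj x r)) omega omega' ->
  gball adj (open_adj omega) x r = gball adj (open_adj omega') x r.
Proof. by move=> oo; apply: eq_gball => // y z yB _ _; exact: open_adj_agree yB. Qed.

(** An edge inside a ball disjoint from [B] has no endpoint in [B]. Together with [gball_agree] this
    makes explorations in disjoint balls depend on disjoint sets of edges. *)
Lemma gball_agreeC (B : {fset V}) omega omega' x r :
  [disjoint gball adj adj x r & B]%fset ->
  (forall e, e \notin edges_meeting B -> omega e = omega' e) ->
  gball adj (open_adj omega) x r = gball adj (open_adj omega') x r.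
Proof.
move=> /fdisjointP xB oo; apply: eq_gball => // y z yB zB _.
rewrite !open_adjE; case E: (edge_at y z) => [e|] //=; apply: oo.
apply/negP => /edges_meetingP[u uB]; move/edge_atP : E => -> /= [] /= uu; subst u.
  by move: (xB _ yB); rewrite uB.
by move: (xB _ zB); rewrite uB.
Qed.

Lemma measurable_counting_cluster (R : realType) x :
  measurable_fun setT (fun omega : config adj => counting (cluster omega x) : \bar R).
Proof.
apply: (emeasurable_fun_cvg (fun r omega => #|` gball adj (open_adj omega) x r|%:R%:E)) => [r|omega _].
  apply: (measurable_local (H := edges_meeting (gball adj adj x r))) => omega omega' oo.
  by rewrite (gball_agree oo).
exact: counting_gball_cvg (@open_adj_sub _).
Qed.

Lemma clusterP omega x y : cluster omega x y <-> exists r, y \in gball adj (open_adj omega) x r.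
Proof.
split=> [|[r /gball_reachable]//]; first exact: reachable_gball (@open_adj_sub _).
exact.
Qed.

Lemma measurable_cluster x y : measurable [set omega : config adj | cluster omega x y].
Proof.
rewrite (_ : mkset _ = \bigcup_r [set omega : config adj | y \in gball adj (open_adj omega) x r]).
  apply: bigcupT_measurable => r.
  have mb : measurable_fun setT (fun omega : config adj => y \in gball adj (open_adj omega) x r).
    apply: (measurable_local (H := edges_meeting (gball adj adj x r))) => omega omega' oo.
    by rewrite (gball_agree oo).
  by have := mb measurableT [set true] I; rewrite setTI; congr measurable; apply/seteqP; split.
by apply/seteqP; split=> omega /= => [/clusterP[r]|[r _] yr]; [exists r|apply/clusterP; exists r].
Qed.

End OpenEdges.


(** * Exponential moments of subcritical clusters *)

Section Exploration.
Variables (V : choiceType) (adj : rel V).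
Hypotheses (adj_sym : symmetric adj) (bounded : bounded_degrees adj).
Implicit Types (e : edges adj) (omega : config adj) (x y z : V).
Implicit Types (H : {fset edges adj}) (S : {fset V}).

Definition restrict_edges H omega : config adj := fun e => omega e && (e \in H).

(* The union of the clusters of the vertices of [S] when only the edges of [H] may be open. *)
Definition explored omega H S : set V :=
  [set y | exists2 x, x \in S & reachable (open_adj (restrict_edges H omega)) x y].

Lemma explored_ind omega H S (A : set V) :
  (forall x, x \in S -> A x) ->
  (forall y z e, A y -> omega e -> e \in H -> val e = [set y; z] -> A z) ->
  explored omega H S `<=` A.
Proof.
move=> SA qA y [x xS]; apply: reachable_ind; first exact: SA.
by move=> u v Au /asboolP[e [ee /andP[oe eH]]]; exact: qA ee.
Qed.

Lemma sub_explored omega H S x : x \in S -> explored omega H S x.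
Proof. by move=> xS; exists x => //; exact: reachable_refl. Qed.

Lemma explored_step omega H S y z e :
  explored omega H S y -> omega e -> e \in H -> val e = [set y; z] -> explored omega H S z.
Proof.
move=> [x xS xy] oe eH ee; exists x => //; apply: reachable_step xy _.
by apply/asboolP; exists e; split=> //; rewrite /restrict_edges oe.
Qed.

Lemma explored_sub omega H H' S S' : (H `<=` H')%fset -> (S `<=` S')%fset ->
  explored omega H S `<=` explored omega H' S'.
Proof.
move=> /fsubsetP HH /fsubsetP SS; apply: explored_ind => [x /SS|y z e Cy oe /HH eH ee].
  exact: sub_explored.
exact: explored_step ee.
Qed.

Lemma explored_fsetU1 omega H S y :
  explored omega H (y |` S)%fset `<=` explored omega H [fset y]%fset `|` explored omega H S.
Proof.
apply: explored_ind => [x|u v e].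
  by rewrite !inE => /orP[/eqP ->|xS]; [left|right]; apply: sub_explored; rewrite ?inE.
by move=> [Cu|Cu] oe eH ee; [left|right]; exact: explored_step ee.
Qed.

Lemma explored_cluster omega H x : explored omega H [fset x]%fset `<=` cluster omega x.
Proof.
move=> y [z]; rewrite inE => /eqP ->; apply: sub_reachable => u v.
by move=> /asboolP[e [ee /andP[oe _]]]; apply/asboolP; exists e.
Qed.

Lemma explored_agree omega omega' H S :
  agree H omega omega' -> explored omega H S = explored omega' H S.
Proof.
move=> oo; suff E : restrict_edges H omega = restrict_edges H omega' by rewrite /explored E.
apply/funext => e; rewrite /restrict_edges; have [eH|] := boolP (e \in H); last by rewrite !andbF.
by rewrite oo.
Qed.

(** An edge known to be open acts only by turning its other endpoint into a seed; it can then be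
    discarded. This is the recursion that reveals one edge at a time. *)
Lemma explored_open omega H S e x y : e \in H -> val e = [set x; y] -> x \in S ->
  explored (set_edge e true omega) H S = explored omega (H `\ e)%fset (y |` S)%fset.
Proof.
move=> eH ee xS; apply/seteqP; split; apply: explored_ind.
- by move=> z zS; apply: sub_explored; rewrite !inE zS orbT.
- move=> u v e' Cu; rewrite /set_edge; have [->|ne] := eqVneq e' e.
    rewrite ee => _ _ /eq_set2[[_ <-]|[<- _]]; apply: sub_explored; rewrite !inE ?eqxx//.
    by rewrite xS orbT.
  by move=> oe' e'H; apply: explored_step Cu oe' _; rewrite !inE ne.
- move=> z; rewrite !inE => /orP[/eqP ->|]; last exact: sub_explored.
  by apply: (explored_step (sub_explored _ _ xS) _ eH ee); rewrite /set_edge eqxx.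
- move=> u v e' Cu oe'; rewrite !inE => /andP[ne e'H] ee'.
  by apply: (explored_step Cu _ e'H ee'); rewrite /set_edge (negbTE ne).
Qed.

Lemma explored_closed omega H S e :
  explored (set_edge e false omega) H S = explored omega (H `\ e)%fset S.
Proof.
apply/seteqP; split; apply: explored_ind => [x|u v e' Cu]; try exact: sub_explored.
  rewrite /set_edge; have [//|ne] := eqVneq e' e => oe' e'H.
  by apply: explored_step Cu oe' _; rewrite !inE ne.
move=> oe'; rewrite !inE => /andP[ne e'H] ee'.
by apply: (explored_step Cu _ e'H ee'); rewrite /set_edge (negbTE ne).
Qed.

Lemma explored_dead omega H S : (forall e x, e \in H -> x \in S -> ~ val e x) ->
  explored omega H S = [set` S].
Proof.
move=> dead; apply/seteqP; split; last by move=> x; exact: sub_explored.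
apply: explored_ind => // y z e yS _ eH ee.
by exfalso; apply: (dead e y eH yS); rewrite ee; left.
Qed.

Lemma finite_edge e : finite_set (val e).
Proof. by have [x [y [_ ->]]] := edgeP e; exact: finite_set2. Qed.

Definition explorable H S : {fset V} := (S `|` \bigcup_(e <- H) fset_set (val e))%fset.

Lemma explored_explorable omega H S : explored omega H S `<=` [set` explorable H S].
Proof.
apply: explored_ind => [x|y z e _ _ eH ee]; rewrite /= in_fsetU; first by move=> ->.
apply/orP; right; apply/bigfcupP; exists e; first by rewrite eH.
by rewrite in_fset_set ?inE; [rewrite ee; right|exact: finite_edge].
Qed.

Lemma finite_explored omega H S : finite_set (explored omega H S).
Proof. exact: sub_finite_set (@explored_explorable omega H S) (finite_fset _). Qed.

Definition explored_fset omega H S := fset_set (explored omega H S).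

Lemma in_explored_fset omega H S x : x \in explored_fset omega H S <-> explored omega H S x.
Proof. by rewrite in_fset_set ?inE//; exact: finite_explored. Qed.

Definition num_explored omega H S := #|` explored_fset omega H S|.

(* The edges of [H] meeting the explored set are those whose state has to be revealed. *)
Definition num_queries omega H S :=
  #|` [fset e in H | `[< exists2 x, explored omega H S x & val e x >]]%fset|.

(** An edge touching a seed meets the explored set whatever its state, so revealing it costs exactly
    one query in both outcomes. *)
Lemma num_queries_step omega omega' H S S' e x : e \in H -> val e x -> x \in S ->
  explored omega H S = explored omega' (H `\ e)%fset S' ->
  num_queries omega H S = (num_queries omega' (H `\ e)%fset S').+1.
Proof.
move=> eH ex xS CC; rewrite /num_queries -CC.
rewrite [LHS](cardfsD1 e) !inE/= eH/=; case: asboolP => [_|]; last first.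
  by case; exists x => //; exact: sub_explored.
rewrite add1n; congr _.+1; congr #|` _|; apply/fsetP => e'.
by rewrite !inE/= andbA.
Qed.

Lemma num_queries_dead omega H S : (forall e x, e \in H -> x \in S -> ~ val e x) ->
  num_queries omega H S = 0%N.
Proof.
move=> dead; apply/eqP; rewrite cardfs_eq0; apply/eqP/fsetP => e; rewrite !inE/=.
apply/negbTE/negP => /andP[eH /asboolP[x]]; rewrite explored_dead// => xS.
exact: (dead e x).
Qed.

(** Every query has an endpoint in the explored set. This converts a penalty per query into a
    penalty per explored site. *)
Lemma num_queries_le omega H S (D : nat) : (forall x, #|` nb adj x| <= D)%N ->
  (num_queries omega H S <= D * num_explored omega H S)%N.
Proof.
move=> nbD; apply: (@leq_trans #|` edges_meeting adj (explored_fset omega H S)|).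
  apply: fsubset_leq_card; apply/fsubsetP => e; rewrite !inE/= => /andP[_ /asboolP[x Cx ex]].
  by apply/edges_meetingP => //; exists x => //; exact/in_explored_fset.
rewrite /edges_meeting /num_explored; elim/finSet_rect: (explored_fset _ _ _) => C IH.
have [->|[x xC]] := fset_0Vmem C; first by rewrite big_seq_fset0 cardfs0.
rewrite (big_fsetD1 x)//= (cardfsD1 x C) xC mulnDr muln1.
apply: (@leq_trans (#|` edges_at adj x| + #|` (\bigcup_(y <- (C `\ x)) edges_at adj y)%fset|)%N).
  by rewrite -cardfsUI leq_addr.
apply: leq_add; last by apply: IH; exact: fproperD1.
exact: leq_trans (card_edges_at _ _) (nbD x).
Qed.

End Exploration.


(** * The one-step exponential estimate of Hoeffding type *)

Section Hoeffding.
Variable R : realType.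

(** From exp u <= 1 / (1 - u) and (1 + u + 2 u^2) (1 - u) = 1 + u^2 (1 - 2 u), which is at least 1
    for u <= 1/2, with no lower bound on u. *)
Lemma expR_le_quadratic (u : R) : u <= 2^-1 -> expR u <= 1 + u + 2 * u ^+ 2.
Proof.
move=> u2; have u1 : 0 < 1 - u by lra.
have := expR_ge1Dx (- u); rewrite expRN => h.
have e0 := expR_gt0 u.
have h1 : expR u * (1 - u) <= 1.
  have : expR u * (1 - u) <= expR u * (expR u)^-1 by apply: ler_wpM2l => //; exact: ltW.
  by rewrite divff// gt_eqF.
rewrite -(ler_pM2r u1); apply: le_trans h1 _.
have : 0 <= u ^+ 2 * (1 - 2 * u) by apply: mulr_ge0; [exact: sqr_ge0|lra].
nra.
Qed.

(** Factoring out the exponential of the mean leaves the centred deviations (1 - p) d and - p d: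
    first-order terms cancel, and second-order terms add up to 2 p (1 - p) d^2. *)
Lemma hoeffding_two_point (p s chi a0 a1 : R) : 0 <= p <= 1 -> 0 <= s -> s * chi <= 2^-1 ->
  a0 <= a1 <= a0 + chi ->
  p * expR (s * a1) + (1 - p) * expR (s * a0) <=
  expR (s * (p * a1 + (1 - p) * a0) + 2 * (s * chi) ^+ 2).
Proof.
move=> /andP[p0 p1] s0 schi /andP[a01 a10].
pose m := p * a1 + (1 - p) * a0; pose d := s * (a1 - a0).
have d0 : 0 <= d by apply: mulr_ge0 => //; lra.
have dchi : d <= s * chi by apply: ler_wpM2l => //; lra.
have -> : s * a1 = s * m + (1 - p) * d by rewrite /m /d; ring.
have -> : s * a0 = s * m + (- p * d) by rewrite /m /d; ring.
rewrite -/m !expRD !mulrA ![_ * expR (s * m)]mulrC -!mulrA -mulrDr.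
apply: ler_wpM2l; first exact: expR_ge0.
have h1 : expR ((1 - p) * d) <= 1 + (1 - p) * d + 2 * ((1 - p) * d) ^+ 2.
  by apply: expR_le_quadratic; nra.
have h0 : expR (- p * d) <= 1 + (- p * d) + 2 * (- p * d) ^+ 2.
  by apply: expR_le_quadratic; nra.
apply: le_trans (lerD (ler_wpM2l p0 h1) (ler_wpM2l _ h0)) _; first lra.
apply: le_trans (expR_ge1Dx _).
have h2 : d ^+ 2 <= (s * chi) ^+ 2 by rewrite ler_sqr// nnegrE; lra.
have h3 : p * (1 - p) * d ^+ 2 <= d ^+ 2.
  rewrite -[leRHS]mul1r; apply: ler_wpM2r; first exact: sqr_ge0.
  nra.
nra.
Qed.

End Hoeffding.

Section ExponentialMoment.
Variables (R : realType) (V : choiceType) (adj : rel V).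
Hypotheses (adj_sym : symmetric adj) (bounded : bounded_degrees adj).
Variables (p : R) (P : probability (config adj) R).
Hypotheses (p01 : 0 <= p <= 1) (bernP : is_bernoulli_percolation p P).
Variables (chi : R) (D : nat).
Hypothesis nbD : forall x, (#|` nb adj x| <= D)%N.
Hypothesis le_chi : forall x, (\int[P]_omega counting (cluster omega x) <= chi%:E)%E.
Implicit Types (H : {fset edges adj}) (S : {fset V}).

Local Notation Nexp omega H S := ((num_explored omega H S)%:R : R).

Lemma measurable_explored d (T' : measurableType d) (f : set V -> nat -> T') H S :
  measurable_fun setT (fun omega : config adj => f (explored omega H S) (num_queries omega H S)).
Proof.
apply: (measurable_local (H := H)) => omega omega' oo.
by rewrite /num_queries (explored_agree S oo).
Qed.

Lemma measurable_num_explored H S :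
  measurable_fun setT (fun omega : config adj => (Nexp omega H S)%:E).
Proof. exact: (@measurable_explored _ _ (fun A _ => (#|` fset_set A|%:R)%:E)). Qed.

Lemma leq_num_explored omega H S H' S' : explored omega H S `<=` explored omega H' S' ->
  (num_explored omega H S <= num_explored omega H' S')%N.
Proof.
move=> sub; apply: fsubset_leq_card; apply/fsubsetP => x.
by move=> /in_explored_fset/sub/in_explored_fset.
Qed.

Lemma num_explored_fsetU1 omega H S y :
  (num_explored omega H (y |` S)%fset <= num_explored omega H [fset y]%fset + num_explored omega H S)%N.
Proof.
apply: (@leq_trans #|` explored_fset omega H [fset y]%fset `|` explored_fset omega H S|%fset).
  apply: fsubset_leq_card; apply/fsubsetP => x /in_explored_fset/explored_fsetU1.
  by rewrite inE => -[] /in_explored_fset -> //; rewrite orbT.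
by rewrite -cardfsUI leq_addr.
Qed.

Lemma num_explored_le_counting omega H x :
  ((Nexp omega H [fset x]%fset)%:E <= counting (cluster omega x))%E.
Proof.
rewrite /counting; case: ifPn => /asboolP fin; last by rewrite leey.
rewrite lee_fin ler_nat; apply: fsubset_leq_card; apply/fsubsetP => y.
by move=> /in_explored_fset/explored_cluster xy; rewrite in_fset_set// inE.
Qed.

Lemma integral_num_explored_fin H S :
  exists a : R, (\int[P]_omega (Nexp omega H S)%:E)%E = a%:E.
Proof.
suff : (\int[P]_omega (Nexp omega H S)%:E \is a fin_num)%E.
  by move=> /fineK <-; eexists.
rewrite ge0_fin_numE; last by apply: integral_ge0 => *; rewrite lee_fin.
apply: (@le_lt_trans _ _ (\int[P]_omega (cst (#|` explorable H S|%:R)%:E omega)))%E; last first.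
  by rewrite integral_cst//= probability_setT mule1 ltry.
apply: ge0_le_integral => //; [exact: measurable_num_explored|].
move=> omega _; rewrite lee_fin ler_nat; apply: fsubset_leq_card; apply/fsubsetP => x.
by move=> /in_explored_fset/explored_explorable.
Qed.

Definition explore_weight (s K : R) omega H S : R :=
  expR (s * Nexp omega H S - K * (num_queries omega H S)%:R).

Lemma measurable_explore_weight s K H S :
  measurable_fun setT (fun omega : config adj => (explore_weight s K omega H S)%:E).
Proof.
exact: (@measurable_explored _ _
  (fun A n => (expR (s * (#|` fset_set A|%:R) - K * n%:R))%:E)).
Qed.

(* Revealing the edges one at a time, the conditional expectation of the cluster size is a
   martingale with increments at most [chi]; the factor [exp (- K * num_queries)] absorbs the
   Hoeffding error of each step. *)
Lemma explore_weight_le (s : R) H S (m : R) : 0 <= s -> s * chi <= 2^-1 ->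
  (\int[P]_omega (Nexp omega H S)%:E)%E = m%:E ->
  (\int[P]_omega (explore_weight s (2 * (s * chi) ^+ 2) omega H S)%:E <= (expR (s * m))%:E)%E.
Proof.
move=> s0 schi; pose K := 2 * (s * chi) ^+ 2; rewrite -/K.
elim/finSet_rect: H S m => H IH S m mE.
(* Either some edge still to be revealed touches a seed, or the exploration is over and the weight
   is deterministic. *)
have [[e [x [eH xS ex]]]|dead] := pselect (exists e x, [/\ e \in H, x \in S & val e x]); last first.
  have dead' e x : e \in H -> x \in S -> ~ val e x by move=> eH xS ex; apply: dead; exists e, x.
  have NE omega : num_explored omega H S = #|` S|.
    by rewrite /num_explored /explored_fset explored_dead// set_fsetK.
  have mS : m = #|` S|%:R.
    move: mE; under eq_integral do rewrite NE.
    by rewrite integral_cst//= probability_setT mule1 => -[].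
  under eq_integral do rewrite /explore_weight NE num_queries_dead// mulr0 subr0.
  by rewrite integral_cst//= probability_setT mule1 mS.
have [y ee] : exists y, val e = [set x; y].
  have [u [v [_ euv]]] := edgeP e; move: ex; rewrite euv => -[/= ->|/= ->]; first by exists v.
  by exists u; rewrite setUC.
set H' := (H `\ e)%fset; set S1 := (y |` S)%fset.
have H'H : (H' `<` H)%fset by exact: fproperD1.
have C1 omega : explored (set_edge e true omega) H S = explored omega H' S1 by exact: explored_open ee xS.
have C0 omega : explored (set_edge e false omega) H S = explored omega H' S by exact: explored_closed.
have [a1 a1E] := integral_num_explored_fin H' S1.
have [a0 a0E] := integral_num_explored_fin H' S.
have mN := measurable_num_explored.
have N0 H0 S0 omega : (0 <= (Nexp omega H0 S0)%:E :> \bar R)%E by rewrite lee_fin.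
have ma : m = p * a1 + (1 - p) * a0.
  have E1 : (\int[P]_omega (Nexp (set_edge e true omega) H S)%:E)%E = a1%:E.
    by rewrite -a1E; apply: eq_integral => omega _; rewrite /num_explored /explored_fset C1.
  have E0 : (\int[P]_omega (Nexp (set_edge e false omega) H S)%:E)%E = a0%:E.
    by rewrite -a0E; apply: eq_integral => omega _; rewrite /num_explored /explored_fset C0.
  apply: EFin_inj; rewrite -mE (resample_edge p01 bernP e)//.
  by rewrite E1 E0.
have a01 : a0 <= a1.
  rewrite -lee_fin -a0E -a1E; apply: ge0_le_integral => // omega _.
  rewrite lee_fin ler_nat; apply: leq_num_explored; apply: explored_sub => //.
  exact: fsubsetU1.
(* Opening [e] adds at most the cluster of [y], whose mean is at most [chi]: this bounds the
   increment of the martingale. *)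
have a10 : a1 <= a0 + chi.
  rewrite -lee_fin EFinD -a0E -a1E.
  apply: (@le_trans _ _ (\int[P]_omega ((Nexp omega H' S)%:E + (Nexp omega H' [fset y]%fset)%:E)))%E.
    apply: ge0_le_integral => //; first exact: emeasurable_funD.
    by move=> omega _; rewrite -EFinD lee_fin -natrD ler_nat addnC; exact: num_explored_fsetU1.
  rewrite ge0_integralD//; apply: leeD => //; apply: le_trans (le_chi y).
  apply: ge0_le_integral => //; first exact: measurable_counting_cluster.
  by move=> omega _; exact: num_explored_le_counting.
have W1 omega : explore_weight s K (set_edge e true omega) H S =
    expR (- K) * explore_weight s K omega H' S1.
  rewrite /explore_weight (num_queries_step eH ex xS (C1 omega)) /num_explored /explored_fset C1.
  by rewrite -expRD; congr expR; rewrite -/H' [in RHS]/num_queries -[_.+1]addn1 natrD; ring.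
have W0 omega : explore_weight s K (set_edge e false omega) H S =
    expR (- K) * explore_weight s K omega H' S.
  rewrite /explore_weight (num_queries_step eH ex xS (C0 omega)) /num_explored /explored_fset C0.
  by rewrite -expRD; congr expR; rewrite -/H' [in RHS]/num_queries -[_.+1]addn1 natrD; ring.
have mW := measurable_explore_weight s K.
have W_ge0 H0 S0 omega : (0 <= (explore_weight s K omega H0 S0)%:E)%E by rewrite lee_fin expR_ge0.
rewrite (resample_edge p01 bernP e)//.
under eq_integral do rewrite W1 EFinM.
under [X in (_ + _ * X)%E]eq_integral do rewrite W0 EFinM.
rewrite !ge0_integralZl ?lee_fin ?expR_ge0//.
have [p0 p1] := andP p01.
apply: (@le_trans _ _ (p%:E * ((expR (- K))%:E * (expR (s * a1))%:E) +
    (1 - p)%:E * ((expR (- K))%:E * (expR (s * a0))%:E)))%E.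
  by apply: leeD; apply: lee_wpmul2l; rewrite ?lee_fin ?subr_ge0//; apply: lee_wpmul2l;
    rewrite ?lee_fin ?expR_ge0//; exact: IH.
rewrite -!EFinM -EFinD lee_fin.
have h := @hoeffding_two_point R p s chi a0 a1 p01 s0 schi.
rewrite a01 a10 in h; have {}h := h isT.
have -> : p * (expR (- K) * expR (s * a1)) + (1 - p) * (expR (- K) * expR (s * a0)) =
  expR (- K) * (p * expR (s * a1) + (1 - p) * expR (s * a0)) by ring.
(* The quadratic error in [h] is exactly K, and the factor exp (- K) paid for the query cancels
   it. *)
apply: le_trans (ler_wpM2l (expR_ge0 _) h) _.
by rewrite -expRD -/K ma addrCA addNr addr0.
Qed.

(** The ball of radius [r] reads only edges meeting the full ball, so closing all other edges does
    not change it. *)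
Lemma gball_num_explored omega x r :
  (#|` gball adj (open_adj omega) x r| <= num_explored omega (edges_meeting adj (gball adj adj x r)) [fset x]%fset)%N.
Proof.
apply: fsubset_leq_card; apply/fsubsetP => y.
set H := edges_meeting _ _ => yr; apply/in_explored_fset; exists x; first by rewrite inE.
apply: (@gball_reachable _ adj bounded _ _ r).
rewrite (@gball_agree _ _ adj_sym bounded _ omega)// => e eH.
by rewrite /restrict_edges eH andbT.
Qed.

Lemma exponential_moment : 1 <= chi -> (0 < D)%N -> exists2 t : R, 0 < t & exists M : R, forall x,
  (\int[P]_omega (expR (t * fine (counting (cluster omega x))))%:E <= M%:E)%E.
Proof.
move=> chi1 D0; have chi0 : 0 < chi by lra.
have D1 : 1 <= D%:R :> R by rewrite ler1n.
have DR : 0 < D%:R :> R by lra.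
(* With this [s], K D = 2 s^2 chi^2 D = s / 2: the penalty for the queries uses up half of the
   exponent and leaves s / 2 per site. Since chi and D are at least 1, s chi <= 1/4. *)
pose s : R := (4 * chi ^+ 2 * D%:R)^-1.
have s0 : 0 < s by rewrite invr_gt0 !mulr_gt0// exprn_gt0.
have sE : 4 * s * chi ^+ 2 * D%:R = 1 by rewrite /s; field; rewrite !gt_eqF.
have schi : s * chi <= 2^-1.
  have : s * chi <= s * chi * (chi * D%:R) by rewrite ler_peMr ?mulr_ge0 ?mulr_ege1// ltW.
  have : 4 * (s * chi * (chi * D%:R)) = 1 by rewrite -[RHS]sE; ring.
  lra.
exists (s / 2); first by rewrite divr_gt0.
exists (expR (s * chi)) => x.
have bound r : (\int[P]_omega (expR (s / 2 * #|` gball adj (open_adj omega) x r|%:R))%:E <=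
    (expR (s * chi))%:E)%E.
  pose H := edges_meeting adj (gball adj adj x r).
  have [m mE] := integral_num_explored_fin H [fset x]%fset.
  apply: (@le_trans _ _ (expR (s * m))%:E); last first.
    rewrite lee_fin ler_expR; apply: ler_wpM2l; first exact: ltW.
    rewrite -lee_fin -mE; apply: le_trans (le_chi x).
    apply: ge0_le_integral => //; first exact: measurable_num_explored.
      exact: measurable_counting_cluster.
    by move=> omega _; exact: num_explored_le_counting.
  apply: le_trans (explore_weight_le (ltW s0) schi mE).
  apply: ge0_le_integral => //.
  - apply: (measurable_local (H := H)) => omega omega' oo.
    by rewrite (gball_agree adj_sym bounded oo).
  - exact: measurable_explore_weight.
  move=> omega _; rewrite lee_fin ler_expR.
  have q : (num_queries omega H [fset x]%fset)%:R <= D%:R * (Nexp omega H [fset x]%fset).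
    by rewrite -natrM ler_nat; exact: num_queries_le.
  have g : (#|` gball adj (open_adj omega) x r|%:R : R) <= Nexp omega H [fset x]%fset.
    by rewrite ler_nat; exact: gball_num_explored.
  apply: (@le_trans _ _ (s / 2 * Nexp omega H [fset x]%fset)); first by apply: ler_wpM2l => //; lra.
  have h : 2 * (s * chi) ^+ 2 * (num_queries omega H [fset x]%fset)%:R <=
      2 * (s * chi) ^+ 2 * (D%:R * Nexp omega H [fset x]%fset).
    by apply: ler_wpM2l => //; apply: mulr_ge0 => //; exact: sqr_ge0.
  have : 2 * (s * chi) ^+ 2 * (D%:R * Nexp omega H [fset x]%fset) = s / 2 * Nexp omega H [fset x]%fset.
    transitivity (s * (4 * s * chi ^+ 2 * D%:R) / 2 * Nexp omega H [fset x]%fset); first by field.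
    by rewrite sE mulr1.
  lra.
pose g r (omega : config adj) : \bar R := (expR (s / 2 * #|` gball adj (open_adj omega) x r|%:R))%:E.
have nd omega : {homo (fun r => g r omega) : m n / (m <= n)%N >-> (m <= n)%E}.
  move=> m n mn; rewrite lee_fin ler_expR; apply: ler_wpM2l; first by lra.
  by rewrite ler_nat; apply: fsubset_leq_card; exact: gball_sub_leq.
have mg r : measurable_fun setT (g r).
  apply: (measurable_local (H := edges_meeting adj (gball adj adj x r))) => omega omega' oo.
  by rewrite /g (gball_agree adj_sym bounded oo).
have g0 r omega : (0 <= g r omega)%E by rewrite lee_fin expR_ge0.
have := @monotone_convergence _ _ _ P setT measurableT g mg (fun r omega _ => g0 r omega)
  (fun omega _ => nd omega).
move=> E; apply: (@le_trans _ _ (\int[P]_omega limn (g^~ omega))%E); last first.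
  rewrite E; apply: lime_le; last by near=> r; exact: bound.
  apply: ereal_nondecreasing_is_cvgn => m n mn.
  by apply: ge0_le_integral => // omega _; exact: nd.
apply: ge0_le_integral => //.
- apply/measurable_EFinP; apply: measurableT_comp => //; apply: measurable_funM => //.
  by apply: measurableT_comp => //; exact: measurable_counting_cluster.
- apply: (emeasurable_fun_cvg g) => // omega _.
  exact: ereal_nondecreasing_is_cvgn.
move=> omega _.
have := @counting_gball_cvg _ _ bounded R _ x (@open_adj_sub _ _ adj_sym omega).
rewrite -/(cluster omega x); have [fin|inf] := pselect (finite_set (cluster omega x)).
  have [r0 h] := finite_reachable_gball bounded (@open_adj_sub _ _ adj_sym omega) fin.
  move=> _; apply: lime_ge; first exact: ereal_nondecreasing_is_cvgn.
  near=> r; rewrite /counting asboolT// lee_fin ler_expR /cluster -(h r) ?set_fsetK//.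
  by near: r; exists r0.
(* [fine] sends +oo to 0, so on an infinite cluster the integrand is 1, which is below every
   [g r]. *)
rewrite /counting asboolF//= mulr0 => _.
apply: lime_ge; first exact: ereal_nondecreasing_is_cvgn.
near=> r; rewrite lee_fin ler_expR; apply: mulr_ge0 => //; lra.
Unshelve. all: by end_near.
Qed.

End ExponentialMoment.


(** * The simple random walk *)

Section Automorphisms.
Variables (V : choiceType) (adj : rel V).

Lemma automorphism_inv f : automorphism adj f ->
  exists g, [/\ automorphism adj g, cancel f g & cancel g f].
Proof.
move=> [[g fg gf] fadj]; exists g; split=> //; split; first by exists f.
by move=> x y; rewrite -fadj !gf.
Qed.

Lemma automorphism_comp f g : automorphism adj f -> automorphism adj g -> automorphism adj (f \o g).
Proof.
move=> [bf fadj] [bg gadj]; split; first exact: bij_comp.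
by move=> x y /=; rewrite fadj gadj.
Qed.

Hypothesis bounded : bounded_degrees adj.

Lemma nb_automorphism f x : automorphism adj f -> nb adj (f x) = (f @` nb adj x)%fset.
Proof.
move=> /[dup] fA /automorphism_inv[g [[_ gadj] fg gf]]; apply/fsetP => y; rewrite in_nb//.
apply/idP/imfsetP => [xy|[z /= + ->]]; last by rewrite in_nb//; case: fA => _ ->.
by exists (g y); rewrite ?gf//= in_nb// -(fg x) gadj.
Qed.

Lemma degree_automorphism f x : automorphism adj f -> degree adj (f x) = degree adj x.
Proof.
move=> fA; rewrite /degree -!/(nb adj _) nb_automorphism// card_imfset//.
by case: fA => [[g fg _] _]; exact: can_inj fg.
Qed.

Lemma countable_vertices (x0 : V) : connected_graph adj -> countable [set: V].
Proof.
move=> conn; have -> : [set: V] = \bigcup_r [set` gball adj adj x0 r].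
  apply/seteqP; split=> // x _; have [r xr] := reachable_gball bounded (fun _ _ => id) (conn x0 x).
  by exists r.
by apply: bigcup_countable => // r _; apply: finite_set_countable; exact: finite_fset.
Qed.

End Automorphisms.

Lemma countable_seqs (T : choiceType) : countable [set: T] -> countable [set: seq T].
Proof.
move=> /countable_injP[f finj]; apply/countable_injP.
exists (fun s => choice.pickle (map f s)) => s s' _ _ /(pcan_inj choice.pickleK).
by apply: inj_map => x y xy; apply: finj; rewrite ?inE.
Qed.

Section WalkSpace.
Variables (R : realType) (V : pointedType).
Hypothesis Vcount : countable [set: V].

Lemma measurable_walk_at n (v : V) : measurable [set w : walk_space V | w n = v].
Proof. by apply: sub_sigma_algebra; exists n, v. Qed.

Lemma measurable_walk d (T : measurableType d) (f : T -> walk_space V) :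
  (forall n v, measurable [set x | f x n = v]) -> measurable_fun setT f.
Proof.
move=> mf; apply: (@measurability _ _ T (walk_space V) setT f (@path_cylinders V)) => //.
by move=> _ [_ [n [v ->]] <-]; rewrite setTI; exact: mf.
Qed.

Definition walk_prefix n (x : nat -> V) : set (walk_space V) :=
  [set w | forall i, (i <= n)%N -> w i = x i].

Lemma measurable_walk_prefix n x : measurable (walk_prefix n x).
Proof.
have -> : walk_prefix n x = \bigcap_(i in `I_n.+1) [set w : walk_space V | w i = x i].
  by apply/seteqP; split=> w h i; exact: h.
by apply: fin_bigcap_measurable => [|i _]; [exact: finite_II|exact: measurable_walk_at].
Qed.

(** The intersection of two prefix events is the longer one or empty, so adding the empty set and
    the whole space gives a pi-system. Countability of the vertices lets a one-time cylinder be
    rebuilt from countably many prefixes. *)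
Lemma walk_measure_unique (m1 m2 : {measure set (walk_space V) -> \bar R}) :
  (m1 setT < +oo)%E -> m1 setT = m2 setT ->
  (forall n x, m1 (walk_prefix n x) = m2 (walk_prefix n x)) ->
  forall A, measurable A -> m1 A = m2 A.
Proof.
move=> m1oo mT m12.
pose G := [set A | [\/ A = setT, A = set0 | exists n x, A = walk_prefix n x]].
have GI n m x y : (n <= m)%N -> G (walk_prefix n x `&` walk_prefix m y).
  move=> nm; have [xy|xy] := pselect (forall i, (i <= n)%N -> x i = y i).
    constructor 3; exists m, y; apply/seteqP; split=> w; first by case.
    by move=> h; split=> // i ni; rewrite xy// h// (leq_trans ni).
  constructor 2; apply/seteqP; split=> // w [hx hy]; apply: xy => i ni.
  by rewrite -hx// -hy// (leq_trans ni).
apply: (@measure_unique _ _ _ G (fun=> setT)).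
- apply/seteqP; split.
    apply: smallest_sub; first exact: smallest_sigma_algebra.
    move=> A [n [v ->]].
    (* The union runs over all lists, read with default value [point] beyond their length; those
       whose entry [n] is [v] give subsets of the cylinder, and the first n + 1 positions of a walk
       provide one containing it. *)
    have -> : [set w : nat -> V | w n = v] =
        \bigcup_(s : seq V) (if nth point s n == v then walk_prefix n (nth point s) else set0).
      apply/seteqP; split=> w /=.
        move=> wn; exists (map w (iota 0 n.+1)) => //.
        have nthE i : (i <= n)%N -> nth point (map w (iota 0 n.+1)) i = w i.
          by move=> ni; rewrite (nth_map 0%N) ?size_iota// nth_iota.
        by rewrite nthE// wn eqxx => i ni; rewrite nthE.
      by move=> [s _]; case: eqP => // <- h; rewrite h.
    apply: (@countable_bigcupT_measurable _ (g_sigma_algebraType G)).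
      exact: countable_seqs.
    move=> s; case: ifP => _; last exact: measurable0.
    by apply: sub_sigma_algebra; constructor 3; exists n, (nth point s).
  apply: smallest_sub; first exact: sigma_algebra_measurable.
  by move=> A [->|->|[n [x ->]]]//; exact: measurable_walk_prefix.
- move=> A B [->|->|[n [x ->]]].
  + by rewrite setTI.
  + by rewrite set0I => _; constructor 2.
  + move=> [->|->|[m [y ->]]]; first by rewrite setIT; constructor 3; exists n, x.
      by rewrite setI0; constructor 2.
    by have [nm|/ltnW mn] := leqP n m; [exact: GI|rewrite setIC; exact: GI].
- by move=> _; constructor 1.
- by rewrite bigcup_const.
- by move=> A [->|->|[n [x ->]]]//; rewrite !measure0.
- by [].
Qed.

Definition shift_walk k (w : walk_space V) : walk_space V := fun n => w (k + n)%N.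

Lemma measurable_shift_walk k : measurable_fun setT (shift_walk k).
Proof. by apply: measurable_walk => n v; exact: measurable_walk_at. Qed.

Definition map_walk (f : V -> V) (w : walk_space V) : walk_space V := f \o w.

Definition cons_walk x (w : walk_space V) : walk_space V := fun n => if n is k.+1 then w k else x.

End WalkSpace.

(** * One-step decomposition, stationarity and the Markov property from the law at [o] *)

Section SimpleRandomWalk.
Variables (R : realType) (V : pointedType) (adj : rel V) (o : V).
Variables (Po : probability (walk_space V) R).
Hypotheses (adj_sym : symmetric adj) (bounded : bounded_degrees adj) (conn : connected_graph adj).
Hypotheses (trans : vertex_transitive adj) (deg_gt0 : (0 < degree adj o)%N).
Hypothesis srwP : is_srw_law adj o Po.

Let Vcount : countable [set: V] := countable_vertices bounded o conn.

Definition to_vertex x : V -> V := s2val (cid2 (trans o x)).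

Lemma to_vertex_aut x : automorphism adj (to_vertex x).
Proof. exact: (s2valP (cid2 (trans o x))). Qed.

Lemma to_vertexE x : to_vertex x o = x.
Proof. exact: (s2valP' (cid2 (trans o x))). Qed.

Lemma degreeE x : degree adj x = degree adj o.
Proof. by rewrite -{1}(to_vertexE x) degree_automorphism//; exact: to_vertex_aut. Qed.

(* The walk whose first step goes from [o] to [x] and which then follows the image of [w] under an
   automorphism sending [o] to [x]: only the law of the walk started at [o] is available. *)
Definition step_walk x (w : walk_space V) : walk_space V := cons_walk o (map_walk (to_vertex x) w).

Lemma measurable_step_walk x : measurable_fun setT (step_walk x).
Proof.
apply: measurable_walk => -[|n] v; rewrite /step_walk/=.
  by have [->|ov] := eqVneq o v; [rewrite (_ : mkset _ = setT)|rewrite (_ : mkset _ = set0)] => //;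
     apply/seteqP; split=> // w ov'; rewrite ov' eqxx in ov.
have [g [_ fg gf]] := automorphism_inv (to_vertex_aut x).
rewrite (_ : mkset _ = [set w : walk_space V | w n = g v]); first exact: measurable_walk_at.
by rewrite /map_walk; apply/seteqP; split=> w /= => [<-|->]; rewrite ?fg ?gf.
Qed.

Lemma srw_step_aut f x y : automorphism adj f -> srw_step R adj (f x) (f y) = srw_step R adj x y.
Proof. by move=> /[dup] fA [_ fadj]; rewrite /srw_step fadj degree_automorphism. Qed.

Local Open Scope ereal_scope.

Lemma sum_nb_cst (a : \bar R) : 0 <= a ->
  \sum_(x <- nb adj o) ((degree adj o)%:R^-1)%:E * a = a.
Proof.
move=> a0; rewrite -ge0_sume_distrl => [|x _]; last by rewrite lee_fin invr_ge0.
rewrite sumEFin big_const_seq count_predT iter_addr addr0.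
have -> : ((degree adj o)%:R^-1 *+ size (nb adj o) = 1 :> R)%R.
  by rewrite -(mulr_natr (degree adj o)%:R^-1) mulVf// pnatr_eq0 -lt0n.
by rewrite mul1e.
Qed.

(** The Markov property at time 1: the law of the walk is the average over the neighbours [x] of [o]
    of its images under [step_walk x]. By uniqueness it is enough to compare prefix events. *)
Lemma walk_one_step (F : walk_space V -> \bar R) :
  measurable_fun setT F -> (forall w, 0 <= F w) ->
  \int[Po]_w F w =
    \sum_(x <- nb adj o) ((degree adj o)%:R^-1)%:E * \int[Po]_w F (step_walk x w).
Proof.
move=> mF F0; pose s := nb adj o; pose q : R := ((degree adj o)%:R^-1)%R.
have q0 : (0 <= q)%R by rewrite invr_ge0.
pose nu : {measure set (walk_space V) -> \bar R} :=
  msum (fun i => mscale (NngNum q0) (image_measure Po (measurable_step_walk (nth o s i)))) (size s).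
have nuE A : nu A = \sum_(x <- s) q%:E * Po (step_walk x @^-1` A).
  by rewrite (big_nth o) big_mkord.
have PE A : measurable A -> Po A = nu A.
  apply: walk_measure_unique => //.
  - by rewrite (le_lt_trans (probability_le1 _ _))// ltry.
  - rewrite nuE; under eq_bigr do rewrite preimage_setT.
    by rewrite sum_nb_cst.
  move=> n y; rewrite nuE [LHS](srwP n y).
  have [oy|oy] := eqVneq (y 0%N) o; last first.
    rewrite mul0r; apply/esym/big1 => x _.
    rewrite (_ : _ @^-1` _ = set0) ?measure0 ?mule0//.
    by apply/seteqP; split=> // w /(_ 0%N isT)/= /esym; apply/eqP.
  rewrite mul1r; case: n => [|n].
    rewrite big_ord0 (eq_bigr (fun=> q%:E * 1)) ?sum_nb_cst// => x _.
    rewrite (_ : _ @^-1` _ = setT) ?probability_setT//.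
    by apply/seteqP; split=> // w _ [|i]//.
  rewrite big_ord_recl oy.
  set c := (\prod_(i < n) _)%R.
  rewrite (eq_bigr (fun x => q%:E * (((y 1%N == x)%:R * c)%:E))).
    under eq_bigr do rewrite -EFinM mulrA EFinM.
    rewrite -ge0_sume_distrl; last first.
      by move=> x _; rewrite lee_fin mulr_ge0.
    rewrite EFinM; congr (_ * _); rewrite /srw_step sumEFin; congr EFin.
    rewrite -in_nb//; case: ifPn => yo.
      rewrite (big_fsetD1 (y 1%N))//= eqxx mulr1 big1_fset ?addr0//.
      by move=> x; rewrite !inE eq_sym => /andP[/negbTE -> _] _; rewrite mulr0.
    rewrite big1_fset// => x xo _; case: eqP => [yx|]; last by rewrite mulr0.
    by rewrite yx xo in yo.
  move=> x _; congr (_ * _).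
  have [g [gA fg gf]] := automorphism_inv (to_vertex_aut x).
  (* Undoing the automorphism turns the tail of the prescribed path into a path starting from [o];
     step probabilities are preserved. *)
  have -> : step_walk x @^-1` [set w | forall i, (i <= n.+1)%N -> w i = y i] =
      [set w | forall i, (i <= n)%N -> w i = g (y i.+1)].
    apply/seteqP; split=> w /= h i.
      by move=> ni; rewrite -(fg (w i)); congr g; exact: (h i.+1).
    by case: i => [//|i] ni /=; rewrite /map_walk/= (h i ni) gf.
  rewrite [LHS](srwP n (fun i => g (y i.+1))); congr (_ * _)%:E.
    congr ((nat_of_bool _)%:R); rewrite -(inj_eq (can_inj fg)) gf to_vertexE.
    by [].
  by apply: eq_bigr => i _; rewrite srw_step_aut.
rewrite (eq_measure_integral nu); last by move=> A mA _; exact: PE.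
rewrite ge0_integral_measure_sum// (big_nth o) big_mkord; apply: eq_bigr => i _.
by rewrite ge0_integral_mscale// integral_image_measure.
Qed.

Definition walk_invariant (h : walk_space V -> \bar R) :=
  forall f w, automorphism adj f -> h (map_walk f w) = h w.

Lemma shift_step_walk k x w : shift_walk k.+1 (step_walk x w) = map_walk (to_vertex x) (shift_walk k w).
Proof. by []. Qed.

Lemma walk_stationary (h : walk_space V -> \bar R) :
  measurable_fun setT h -> (forall w, 0 <= h w) -> walk_invariant h ->
  \int[Po]_w h (shift_walk 1 w) = \int[Po]_w h w.
Proof.
move=> mh h0 hI; rewrite walk_one_step//; last exact: measurableT_comp (measurable_shift_walk _).
rewrite -[RHS]sum_nb_cst; last exact: integral_ge0.
apply: eq_bigr => x _; congr (_ * _); apply: eq_integral => w _.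
by rewrite shift_step_walk hI//; exact: to_vertex_aut.
Qed.

(** An invariant functional sees only the shape of the future, not its starting point, so it is
    independent of the first k steps. The induction peels off one step at a time. *)
Lemma walk_markov k (g h : walk_space V -> \bar R) :
  measurable_fun setT g -> (forall w, 0 <= g w) ->
  (forall w w', (forall i, (i <= k)%N -> w i = w' i) -> g w = g w') ->
  measurable_fun setT h -> (forall w, 0 <= h w) -> walk_invariant h ->
  \int[Po]_w (g w * h (shift_walk k w)) = \int[Po]_w g w * \int[Po]_w h w.
Proof.
move=> + + + mh h0 hI; have Ih : 0 <= \int[Po]_w h w by exact: integral_ge0.
elim: k g => [|k IH] g mg g0 gk.
  pose c := g (fun=> o).
  (* [g] depends only on the position at time 0, which is [o] for every [step_walk]. *)
  have gc x w : g (step_walk x w) = c by apply: gk => -[|i].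
  have mgh : measurable_fun setT (fun w => g w * h (shift_walk 0 w)).
    by apply: emeasurable_funM => //; apply: measurableT_comp => //; exact: measurable_shift_walk.
  rewrite walk_one_step// => [|w]; last exact: mule_ge0.
  rewrite [X in _ = X * _]walk_one_step// [X in _ = _ * X]walk_one_step//.
  under [X in _ = X * _]eq_bigr do under eq_integral do rewrite gc.
  under [X in _ = X * _]eq_bigr do rewrite integral_cst//= [X in _ * (_ * X)]probability_setT mule1.
  rewrite sum_nb_cst ?g0// ge0_sume_distrr => [|x _]; last first.
    by apply: mule_ge0; [rewrite lee_fin invr_ge0|exact: integral_ge0].
  apply: eq_bigr => x _; rewrite muleCA; congr (_ * _).
  under eq_integral do rewrite gc.
  rewrite ge0_integralZl//; first exact: measurableT_comp (measurable_step_walk x).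
  exact: g0.
have mgh : measurable_fun setT (fun w => g w * h (shift_walk k.+1 w)).
  by apply: emeasurable_funM => //; apply: measurableT_comp => //; exact: measurable_shift_walk.
rewrite walk_one_step// => [|w]; last exact: mule_ge0.
rewrite [X in _ = X * _]walk_one_step// ge0_sume_distrl => [|x _]; last first.
  by apply: mule_ge0; [rewrite lee_fin invr_ge0|exact: integral_ge0].
apply: eq_bigr => x _; rewrite -muleA; congr (_ * _).
under eq_integral do rewrite shift_step_walk (hI _ _ (to_vertex_aut x)).
apply: (IH (fun w => g (step_walk x w))) => [||w w' ww'] //.
  exact: measurableT_comp (measurable_step_walk x).
by apply: gk => -[|i] //= ik; rewrite /map_walk/= ww'.
Qed.

Fixpoint srw_prob k (x y : V) : R :=
  if k is k'.+1 then ((\sum_(z <- nb adj x) srw_prob k' z y) / (degree adj o)%:R)%R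
  else (x == y)%:R.

(** Stated for an arbitrary automorphism [f], since the induction composes [f] with the automorphism
    of the first step. The general starting point of [srw_prob] comes from [f o]. *)
Lemma prob_walk_at k f y : automorphism adj f ->
  Po [set w | f (w k) = y] = (srw_prob k (f o) y)%:E.
Proof.
have mf k' f' : automorphism adj f' -> measurable [set w : walk_space V | f' (w k') = y].
  move=> /automorphism_inv[g [_ fg gf]].
  rewrite (_ : mkset _ = [set w : walk_space V | w k' = g y]); first exact: measurable_walk_at.
  by apply/seteqP; split=> w /= => [<-|->]; rewrite ?fg ?gf.
have E k' f' : automorphism adj f' -> Po [set w | f' (w k') = y] =
    \int[Po]_w (\1_[set w : walk_space V | f' (w k') = y] w)%:E.
  by move=> f'A; rewrite integral_indic ?setIT//; exact: mf.
have mi k' f' : automorphism adj f' ->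
    measurable_fun setT (fun w => (\1_[set w : walk_space V | f' (w k') = y] w)%:E : \bar R).
  by move=> f'A; apply/measurable_EFinP; apply: measurable_indic; exact: mf.
elim: k f => [|k IH] f fA; rewrite E//.
  rewrite walk_one_step; [|exact: mi|by move=> w; rewrite lee_fin].
  under eq_bigr.
    move=> x _; under eq_integral.
      move=> w _; rewrite indicE (_ : (_ \in _) = (f o == y)); last first.
        by apply/idP/eqP; rewrite inE.
      over.
    rewrite integral_cst//= [X in _ * (_ * X)]probability_setT mule1.
    over.
  by rewrite sum_nb_cst.
rewrite walk_one_step; [|exact: mi|by move=> w; rewrite lee_fin].
under eq_bigr.
  move=> x _.
  have fxA := automorphism_comp fA (to_vertex_aut x).
  have -> : \int[Po]_w (\1_[set w : walk_space V | f (w k.+1) = y] (step_walk x w))%:E =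
      \int[Po]_w (\1_[set w : walk_space V | (f \o to_vertex x) (w k) = y] w)%:E by [].
  rewrite -E// IH//=.
  rewrite to_vertexE -EFinM.
  over.
rewrite sumEFin; congr EFin; rewrite /= nb_automorphism// big_imfset/=; last first.
  by move=> u v _ _; case: fA => [[g fg _] _] /(can_inj fg).
by rewrite mulrC mulr_sumr.
Qed.

End SimpleRandomWalk.


Lemma cvg_sum_seq (R : realType) (I : eqType) (s : seq I) (f : I -> nat -> R) (l : I -> R) :
  (forall i, i \in s -> f i n @[n --> \oo] --> l i) ->
  (\sum_(i <- s) f i n) @[n --> \oo] --> \sum_(i <- s) l i.
Proof.
elim: s => [|i s IH] fl.
  by under eq_fun do rewrite big_nil; rewrite big_nil; exact: cvg_cst.
under eq_fun do rewrite big_cons; rewrite big_cons.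
apply: cvgD; first by apply: fl; rewrite mem_head.
by apply: IH => j js; apply: fl; rewrite inE js orbT.
Qed.

(** * Decay of the heat kernel *)

Section HeatKernel.
Variables (R : realType) (V : pointedType) (adj : rel V) (o : V).
Hypotheses (adj_sym : symmetric adj) (bounded : bounded_degrees adj) (conn : connected_graph adj).
Hypotheses (Vinf : infinite_set [set: V]) (deg_gt0 : (0 < degree adj o)%N).
Hypothesis regular : forall x, degree adj x = degree adj o.
Variable y : V.
Local Notation d := ((degree adj o)%:R : R).
Local Notation u := (fun k x => srw_prob R adj o k x y).

Let d_gt0 : 0 < d.
Proof. by rewrite ltr0n. Qed.

Let srw_prob_ge0 k x : 0 <= u k x.
Proof. by elim: k x => [|k IH] x /=; [|apply: divr_ge0 => //; exact: sumr_ge0]. Qed.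

(** Double counting: by symmetry and regularity, each [z] is a neighbour of exactly [degree adj o]
    vertices. It is used for the transition probabilities and for their squares. *)
Lemma sum_nb_le (f : V -> R) (S F : {fset V}) : (forall x, 0 <= f x) ->
  (forall x, x \notin S -> f x = 0) ->
  \sum_(x <- F) \sum_(z <- nb adj x) f z <= d * \sum_(z <- S) f z.
Proof.
move=> f0 fS.
have E x : \sum_(z <- nb adj x) f z = \sum_(z <- S | z \in nb adj x) f z.
  rewrite [RHS]big_fset_condE; apply/esym/big_fset_incl.
    by apply/fsubsetP => z; rewrite !inE/= => /andP[].
  by move=> z zx; rewrite !inE/= zx andbT => /fS.
under eq_bigr do rewrite E.
rewrite (exchange_big_dep predT)//= mulr_sumr; apply: ler_sum => z _.
rewrite big_fset_condE big_const_seq count_predT iter_addr addr0 -(mulr_natl (f z)).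
apply: ler_wpM2r => //; rewrite ler_nat -(regular z).
by apply: fsubset_leq_card; apply/fsubsetP => x; rewrite !inE/= !in_nb// adj_sym => /andP[].
Qed.

Fixpoint support k : {fset V} :=
  if k is k'.+1 then (\bigcup_(z <- support k') nb adj z)%fset else [fset y]%fset.

Lemma supportP k x : x \notin support k -> u k x = 0.
Proof.
elim: k x => [|k IH] x /=; first by rewrite inE => /negbTE ->.
move=> xk; rewrite big1_fset ?mul0r// => z zx _; apply: IH; apply: contra xk => zk.
by apply/bigfcupP; exists z; rewrite ?zk// in_nb// adj_sym -in_nb.
Qed.

Lemma sum_srw_prob_le1 k (F : {fset V}) : \sum_(x <- F) u k x <= 1.
Proof.
elim: k F => [|k IH] F.
  have [yF|yF] := boolP (y \in F).
    rewrite (big_fsetD1 y)//= eqxx big1_fset ?addr0// => x.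
    by rewrite !inE => /andP[/negbTE ->].
  rewrite big1_fset// => x xF _ /=; case: eqP => // xy.
  by rewrite -xy xF in yF.
rewrite /= -mulr_suml ler_pdivrMr// mul1r.
apply: le_trans (@sum_nb_le (u k) (support k) F (srw_prob_ge0 k) (@supportP k)) _.
by rewrite ler_piMr// ltW.
Qed.

(** Jensen's inequality with its defect: the gap is the variance of [f] over [N], and the deviations
    at [z] and [z'] alone have squares adding up to at least half of (f z - f z')^2. *)
Lemma mean_square_le (N : {fset V}) (f : V -> R) z z' : (0 < #|` N|)%N -> z \in N -> z' \in N ->
  ((\sum_(x <- N) f x) / #|` N|%:R) ^+ 2 + (f z - f z') ^+ 2 / (2 * #|` N|%:R) <=
  (\sum_(x <- N) f x ^+ 2) / #|` N|%:R.
Proof.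
move=> N0 zN z'N; set n : R := #|` N|%:R; have n0 : 0 < n by rewrite ltr0n.
set m := (\sum_(x <- N) f x) / n.
have Sm : \sum_(x <- N) f x = n * m by rewrite /m; field; rewrite gt_eqF.
have var : \sum_(x <- N) (f x - m) ^+ 2 = \sum_(x <- N) f x ^+ 2 - n * m ^+ 2.
  under eq_bigr do rewrite sqrrB.
  rewrite big_split sumrB/= sumrMnl -mulr_suml Sm.
  by rewrite big_const_seq count_predT iter_addr addr0 -(mulr_natl (m ^+ 2)) -/n; ring.
have key : (f z - f z') ^+ 2 <= 2 * \sum_(x <- N) (f x - m) ^+ 2.
  have [->|zz'] := eqVneq z z'.
    by rewrite subrr expr0n/= mulr_ge0// sumr_ge0// => x _; exact: sqr_ge0.
  rewrite (big_fsetD1 z)//= (big_fsetD1 z')/=; last by rewrite !inE eq_sym zz'.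
  have rest : 0 <= \sum_(x <- ((N `\ z) `\ z')%fset) (f x - m) ^+ 2.
    by apply: sumr_ge0 => x _; exact: sqr_ge0.
  have := sqr_ge0 (f z + f z' - 2 * m); nra.
rewrite var in key; rewrite -(ler_pM2r n0) mulrDl divfK ?gt_eqF//.
have -> : (f z - f z') ^+ 2 / (2 * n) * n = (f z - f z') ^+ 2 / 2 by field; rewrite gt_eqF.
nra.
Qed.

Definition energy k := \sum_(x <- support k) u k x ^+ 2.

(** Averaging [u k ^+ 2] over neighbours and summing over vertices gives at most the energy at time
    k, while at every vertex this average is at least [u k.+1 ^+ 2]; at [x] the Jensen defect is
    kept. *)
Lemma energy_drop k x z z' : z \in nb adj x -> z' \in nb adj x ->
  (u k z - u k z') ^+ 2 / (2 * d) <= energy k - energy k.+1.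
Proof.
(* [x] has to appear as a summand even when it lies outside the support. *)
move=> zx z'x; pose F := (x |` support k.+1)%fset.
have -> : energy k.+1 = \sum_(x <- F) u k.+1 x ^+ 2.
  apply: big_fset_incl; first exact: fsubsetU1.
  by move=> v _ /supportP ->; rewrite expr0n.
pose q v := (\sum_(w <- nb adj v) u k w ^+ 2) / d.
have nbE v : #|` nb adj v| = degree adj o by rewrite -(regular v).
have vE v : u k.+1 v ^+ 2 <= q v.
  have [w wv] : exists w, w \in nb adj v.
    by apply/fset0Pn; rewrite -cardfs_gt0 nbE.
  have := @mean_square_le (nb adj v) (u k) w w; rewrite nbE => /(_ deg_gt0 wv wv).
  by rewrite subrr expr0n/= mul0r addr0.
have xE : u k.+1 x ^+ 2 + (u k z - u k z') ^+ 2 / (2 * d) <= q x.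
  by have := @mean_square_le (nb adj x) (u k) z z'; rewrite nbE => /(_ deg_gt0 zx z'x).
have total : \sum_(v <- F) q v <= energy k.
  rewrite -mulr_suml ler_pdivrMr// mulrC.
  apply: sum_nb_le => v; first exact: sqr_ge0.
  by move=> /supportP ->; rewrite expr0n.
have xF : x \in F by rewrite !inE eqxx.
have -> : \sum_(v <- F) u k.+1 v ^+ 2 = u k.+1 x ^+ 2 + \sum_(v <- (F `\ x)%fset) u k.+1 v ^+ 2.
  exact: big_fsetD1.
have {}total : q x + \sum_(v <- (F `\ x)%fset) q v <= energy k.
  by apply: le_trans total; rewrite (big_fsetD1 x xF).
have : \sum_(v <- (F `\ x)%fset) u k.+1 v ^+ 2 <= \sum_(v <- (F `\ x)%fset) q v.
  by apply: ler_sum => v _; exact: vE.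
by lra.
Qed.

Lemma cvg_energy_drop : (energy k - energy k.+1) @[k --> \oo] --> 0.
Proof.
have [z zo] : exists z, z \in nb adj o by apply/fset0Pn; rewrite -cardfs_gt0.
have dec : {homo energy : n m / (n <= m)%N >-> m <= n}.
  apply/nonincreasing_seqP => k; rewrite -subr_ge0.
  have := energy_drop k zo zo; by rewrite subrr expr0n/= mul0r.
have cv : cvgn energy.
  apply: nonincreasing_is_cvgn => //; exists 0 => _ [k _ <-].
  by apply: sumr_ge0 => x _; exact: sqr_ge0.
rewrite -(subrr (limn energy)); apply: cvgB => //.
by rewrite -(cvg_shiftS energy) in cv *.
Qed.

Lemma cvg_diff_common_nb x z z' : z \in nb adj x -> z' \in nb adj x ->
  (u k z - u k z') @[k --> \oo] --> 0.
Proof.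
move=> zx z'x; apply: norm_cvg0; apply/cvgrPdist_le => e e0.
have := cvg_energy_drop => /cvgrPdist_le/(_ (e ^+ 2 / (2 * d))).
rewrite divr_gt0 ?exprn_gt0 ?mulr_gt0// => /(_ isT) => h.
near=> k; have : `|0 - (energy k - energy k.+1)| <= e ^+ 2 / (2 * d) by near: k.
rewrite sub0r normrN sub0r normrN normr_id => /(le_trans (ler_norm _)).
move=> /(le_trans (energy_drop k zx z'x)).
rewrite ler_pM2r ?invr_gt0 ?mulr_gt0// -real_normK ?num_real//.
by rewrite ler_sqr ?nnegrE// ltW.
Unshelve. all: by end_near.
Qed.

Definition common_nb : rel V := fun z z' => `[< exists x, z \in nb adj x /\ z' \in nb adj x >].

(** Every vertex lies in the class of [x] or next to it: a neighbour [b] of a vertex [a] adjacent to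
    [c] in the class shares the neighbour [a] with [c]. With finite degrees, a finite class would
    make the graph finite. *)
Lemma infinite_common_nb x : infinite_set [set z | reachable common_nb x z].
Proof.
set K := [set z | _] => finK; apply: Vinf.
pose K' := fset_set K.
have K'E z : (z \in K') = (z \in K) by rewrite in_fset_set.
suff h : [set: V] `<=` [set` (K' `|` \bigcup_(z <- K') nb adj z)%fset].
  exact: sub_finite_set h (finite_fset _).
move=> z _ /=; apply: (reachable_ind (A := [set` _]) _ _ (conn x z)) => /=.
  by rewrite inE K'E mem_set//; exact: reachable_refl.
move=> a b; rewrite !inE => /orP[aK|/bigfcupP[c /andP[cK _] ca]] ab.
  by apply/orP; right; apply/bigfcupP; exists a; rewrite ?aK// in_nb.
apply/orP; left; rewrite K'E; apply: mem_set.
move: cK; rewrite K'E => /set_mem xc; apply: reachable_step xc _.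
by apply/asboolP; exists a; split; rewrite in_nb// adj_sym -in_nb.
Qed.

Lemma srw_prob_cvg0 x : u k x @[k --> \oo] --> 0.
Proof.
have diff z : reachable common_nb x z -> (u k x - u k z) @[k --> \oo] --> 0.
  apply: (reachable_ind (A := [set z | (u k x - u k z) @[k --> \oo] --> 0])) => /=.
    by under eq_fun do rewrite subrr; exact: cvg_cst.
  move=> a b xa /asboolP[c [ac bc]].
  have -> : (fun k => u k x - u k b) = (fun k => (u k x - u k a) + (u k a - u k b)).
    by apply/funext => k; ring.
  by rewrite -(addr0 0); apply: cvgD => //; exact: cvg_diff_common_nb bc.
apply/cvgrPdist_le => e e0.
(* On a set [B] of at least L points where the values are nearly equal, the total mass is at most 1
   and the accumulated difference at most 1, so L times the value at [x] is at most 2. *)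
pose L := (Num.truncn (2 / e)).+1.
have [B BK LB] := infinite_set_fset L (@infinite_common_nb x).
have cvB : (\sum_(z <- B) (u k x - u k z)) @[k --> \oo] --> \sum_(z <- B) (0 : R).
  by apply: cvg_sum_seq => z zB; apply: diff; exact: BK.
rewrite big1// in cvB.
move/cvgrPdist_le : cvB => /(_ 1 ltr01) hB.
near=> k; have : `|0 - \sum_(z <- B) (u k x - u k z)| <= 1 by near: k.
rewrite !sub0r !normrN => /(le_trans (ler_norm _)) + ; rewrite ger0_norm//.
rewrite sumrB big_const_seq count_predT iter_addr addr0 -mulr_natl => h.
have h1 := sum_srw_prob_le1 k B.
have : 2 / e <= L%:R by rewrite ltW// /L; exact: truncnS_gt.
rewrite ler_pdivrMr// => h2.
have h3 : (L%:R : R) <= #|` B|%:R by rewrite ler_nat.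
have h4 := srw_prob_ge0 k x.
rewrite leNgt; apply/negP => ex.
have h5 : L%:R * e < L%:R * u k x by rewrite ltr_pM2l// ltr0n.
have h6 : L%:R * u k x <= #|` B|%:R * u k x by exact: ler_wpM2r.
move: h h1 h2 h5 h6; rewrite /=; lra.
Unshelve. all: by end_near.
Qed.

End HeatKernel.


(** * Stationarity and the maximal inequality *)

Section Sums.
Variable R : realType.
Implicit Types (a c : nat -> R).

Lemma sum_ord_split (f : nat -> R) m n :
  \sum_(i < m + n) f i = \sum_(i < m) f i + \sum_(i < n) f (m + i)%N.
Proof. by rewrite big_split_ord. Qed.

Lemma sum_ord_le (f : nat -> R) m n : (forall i, 0 <= f i) -> (m <= n)%N ->
  \sum_(i < m) f i <= \sum_(i < n) f i.
Proof. by move=> f0 /subnKC <-; rewrite sum_ord_split lerDl sumr_ge0. Qed.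

Lemma sum_ord_le1 (f : nat -> R) n : (forall i, f i <= 1) -> \sum_(i < n) f i <= n%:R.
Proof.
move=> f1; apply: (@le_trans _ _ (\sum_(i < n) (1 : R))); first exact: ler_sum.
by rewrite sumr_const card_ord.
Qed.

Definition exceeds (lambda : R) M a i :=
  [exists n : 'I_M, lambda * n.+1%:R < \sum_(j < n.+1) a (i + j)%N].

(* Vitali-type covering: an index where the forward average exceeds [lambda] pays for the whole
   block that witnesses it. *)
Lemma exceeds_count (lambda : R) M a N : (forall i, 0 <= a i) -> 0 < lambda ->
  lambda * \sum_(i < N) (exceeds lambda M a i)%:R <= \sum_(i < N + M) a i.
Proof.
move=> + l0; elim/ltn_ind: N a => -[|N] IH a a0.
  by rewrite big_ord0 mulr0; exact: sumr_ge0.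
have b1 i : (exceeds lambda M a i)%:R <= 1 :> R by case: exceeds; rewrite ?lexx ?ler01.
have shiftE m i : exceeds lambda M a (m + i) = exceeds lambda M (fun j => a (m + j)%N) i.
  by rewrite /exceeds; apply: eq_existsb => n; under eq_bigr do rewrite -addnA.
have [e0|e0] := boolP (exceeds lambda M a 0); last first.
  have := IH N (ltnSn _) (fun j => a (1 + j)%N) (fun j => a0 _).
  rewrite -[N.+1]add1n (sum_ord_split (fun i => (exceeds lambda M a i)%:R)) big_ord1 (negbTE e0) add0r.
  under eq_bigr do rewrite -shiftE.
  move=> /le_trans; apply; rewrite -addnA (sum_ord_split a) big_ord1 lerDr; exact: a0.
case/existsP: (e0) => n; set m := n.+1 => mS.
(* Either the witnessing block covers all remaining indices and suffices alone, or it is cut off and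
   the induction hypothesis handles the rest. *)
have [Nm|mN] := leqP N.+1 m.
  apply: (@le_trans _ _ (lambda * m%:R)); last first.
    apply: le_trans (ltW mS) _; under eq_bigr do rewrite add0n.
    by apply: sum_ord_le => //; rewrite (leq_trans (ltn_ord n)) ?leq_addl.
  rewrite ler_pM2l//; apply: (@le_trans _ _ N.+1%:R); last by rewrite ler_nat.
  exact: (@sum_ord_le1 (fun i => (exceeds lambda M a i)%:R)).
have mNE : N.+1 = (m + (N.+1 - m))%N by rewrite subnKC// ltnW.
have := IH (N.+1 - m)%N _ (fun j => a (m + j)%N) (fun j => a0 _).
rewrite {1}ltn_subrL /= => /(_ isT) h.
rewrite [in leLHS]mNE (sum_ord_split (fun i => (exceeds lambda M a i)%:R)) mulrDr.
rewrite [in leRHS]mNE -addnA (sum_ord_split a); apply: lerD.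
  apply: (@le_trans _ _ (lambda * m%:R)).
    by rewrite ler_pM2l//; exact: (@sum_ord_le1 (fun i => (exceeds lambda M a i)%:R)).
  by apply: le_trans (ltW mS) _; under eq_bigr do rewrite add0n.
by under eq_bigr do rewrite shiftE.
Qed.

(** The argument of [c] is the distance |i - j|, by truncated subtraction. In each row a given
    distance occurs at most twice. *)
Lemma sum_dist_le c k : (forall m, 0 <= c m) ->
  \sum_(i < k) \sum_(j < k) c ((i - j) + (j - i))%N <= 2 * k%:R * \sum_(m < k) c m.
Proof.
move=> c0; rewrite (_ : 2 * _ * _ = \sum_(i < k) (2 * \sum_(m < k) c m)); last first.
  by rewrite sumr_const card_ord -mulr_natl; ring.
apply: ler_sum => i _; rewrite mulr_natl mulr2n.
have := sum_ord_split (fun j => c ((i - j) + (j - i))%N) i.+1 (k - i.+1).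
rewrite subnKC// => ->; apply: lerD.
  rewrite (reindex_inj rev_ord_inj)/=.
  apply: (@le_trans _ _ (\sum_(j < i.+1) c j)); last exact: sum_ord_le.
  apply: ler_sum => j _; rewrite subSS subKn; last by rewrite -ltnS.
  by rewrite (eqP (leq_subr _ _ : i - j - i == 0)%N) addn0.
apply: (@le_trans _ _ (\sum_(j < (k - i.+1).+1) c j)); last first.
  by apply: sum_ord_le => //; rewrite subnS prednK ?subn_gt0// leq_subr.
rewrite big_ord_recl; apply: (@le_trans _ _ (\sum_(j < k - i.+1) c (bump 0 j))).
  apply: ler_sum => j _; rewrite le_eqVlt; apply/orP; left; apply/eqP; congr c.
  rewrite /bump /= (_ : i - (i.+1 + j) = 0)%N; last by apply/eqP; rewrite subn_eq0; lia.
  by lia.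
by rewrite lerDr.
Qed.

Lemma cvg_mean (c : nat -> R) (l : R) : c n @[n --> \oo] --> l ->
  (n.+1%:R^-1 * \sum_(m < n.+1) c m) @[n --> \oo] --> l.
Proof.
move=> /cesaro; rewrite /arithmetic_mean => h.
by under eq_fun do rewrite -(big_mkord xpredT c) -/(series c _).
Qed.

End Sums.


Lemma measurable_fun_boolP d (T : measurableType d) (b : T -> bool) :
  measurable_fun setT b <-> measurable [set x | b x].
Proof.
have E : b @^-1` [set true] = [set x | b x] by apply/seteqP; split.
split=> [mb|mb]; first by rewrite -E -[X in measurable X]setTI; exact: mb.
by apply: (@measurable_fun_bool _ _ _ _ true); rewrite setTI E.
Qed.

(** * The walk and the configuration jointly: stationarity and the maximal inequality *)

Section Joint.
Variables (R : realType) (V : pointedType) (adj : rel V) (o : V).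
Variables (p : R) (Po : probability (walk_space V) R) (Pp : probability (config adj) R).
Hypotheses (adj_sym : symmetric adj) (bounded : bounded_degrees adj) (conn : connected_graph adj).
Hypotheses (trans : vertex_transitive adj) (deg_gt0 : (0 < degree adj o)%N).
Hypotheses (srwP : is_srw_law adj o Po) (bernP : is_bernoulli_percolation p Pp).
Local Notation T := (walk_space V * config adj)%type.
Local Notation mu := (Po \x Pp)%E.

Let Vcount : countable [set: V] := countable_vertices bounded o conn.

(** Invariance under the diagonal action, with the configuration moved to the other side as a
    pull-back so that no inverse automorphism appears. *)
Definition joint_invariant (X : Type) (F : T -> X) :=
  forall f (fA : automorphism adj f) w omega, F (map_walk f w, omega) = F (w, act adj_sym fA omega).

Definition joint_shift k (z : T) : T := (shift_walk k z.1, z.2).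

Lemma joint_shiftD i j z : joint_shift i (joint_shift j z) = joint_shift (j + i) z.
Proof. by rewrite /joint_shift /shift_walk /=; congr pair; apply/funext => n; rewrite addnA. Qed.

Lemma joint_invariant_shift (X : Type) (F : T -> X) k :
  joint_invariant F -> joint_invariant (F \o joint_shift k).
Proof. by move=> FI f fA w omega; exact: FI. Qed.

Lemma measurable_joint_shift k : measurable_fun setT (joint_shift k).
Proof.
apply: measurable_fun_pair; last exact: measurable_snd.
exact: measurableT_comp (measurable_shift_walk k) measurable_fst.
Qed.

(** The percolation law is invariant under automorphisms, so averaging over the configuration leaves
    an invariant functional of the walk alone, to which stationarity and the Markov property
    apply. *)
Lemma walk_invariant_integral (F : T -> \bar R) :
  measurable_fun setT F -> (forall z, 0 <= F z)%E -> joint_invariant F ->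
  walk_invariant adj (fun w => \int[Pp]_omega F (w, omega))%E.
Proof.
move=> mF F0 FI f w fA.
under eq_integral do rewrite (FI f fA).
rewrite /act (integral_reindex_edges (f := fun omega => F (w, omega)) bernP)//.
  exact: edge_image_inj.
exact: measurableT_comp (pair1_measurable w).
Qed.

Lemma joint_stationary k (F : T -> \bar R) :
  measurable_fun setT F -> (forall z, 0 <= F z)%E -> joint_invariant F ->
  (\int[mu]_z F (joint_shift k z) = \int[mu]_z F z)%E.
Proof.
move=> mF F0 FI; elim: k => [|k IH]; first by apply: eq_integral => -[w omega] _.
rewrite -IH; pose G z := F (joint_shift k z).
have mG : measurable_fun setT G by exact: measurableT_comp (measurable_joint_shift k).
have mG1 : measurable_fun setT (G \o joint_shift 1).
  exact: measurableT_comp (measurable_joint_shift 1).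
have E1 := @fubini_tonelli1 _ _ _ _ R Po Pp _ mG1 (fun z => F0 _).
have E2 := @fubini_tonelli1 _ _ _ _ R Po Pp _ mG (fun z => F0 _).
transitivity (\int[mu]_z (G \o joint_shift 1) z)%E.
  by apply: eq_integral => z _; rewrite /G /= joint_shiftD.
rewrite E1 E2.
have h := @walk_stationary R V adj o Po bounded conn trans deg_gt0 srwP
  (fun w => \int[Pp]_omega G (w, omega))%E.
apply: h => //.
- exact: (@measurable_fun_fubini_tonelli_F _ _ _ _ R Pp G mG (fun z => F0 _)).
- by move=> w; apply: integral_ge0 => omega _; exact: F0.
- apply: walk_invariant_integral => //; [by move=> z; exact: F0|exact: (joint_invariant_shift k FI)].
Qed.

(** The weak-type (1,1) maximal inequality. The covering bound is integrated over N shifts with a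
    window M; letting N grow removes the boundary term, and then M grows. *)
Lemma walk_maximal_inequality (F : T -> R) (lambda : R) :
  measurable_fun setT F -> (forall z, 0 <= F z) -> joint_invariant F -> 0 < lambda ->
  let E := [set z | exists n, lambda * n.+1%:R < \sum_(j < n.+1) F (joint_shift j z)] in
  measurable E /\ (lambda%:E * mu E <= \int[mu]_z (F z)%:E)%E.
Proof.
move=> mF F0 FI l0 E.
pose e M z := exceeds lambda M (fun j => F (joint_shift j z)) 0.
pose EM M := [set z | e M z].
have eS M i z : e M (joint_shift i z) = exceeds lambda M (fun j => F (joint_shift j z)) i.
  rewrite /e /exceeds; apply: eq_existsb => n.
  by under eq_bigr do rewrite joint_shiftD add0n.
have mFk k : measurable_fun setT (fun z => F (joint_shift k z)).
  exact: measurableT_comp (measurable_joint_shift k).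
have mEM M : measurable (EM M).
  have -> : EM M = \bigcup_(n in `I_M)
      [set z | lambda * n.+1%:R < \sum_(j < n.+1) F (joint_shift j z)].
    apply/seteqP; split=> z /=.
      move=> /existsP[n]; under eq_bigr do rewrite add0n.
      by exists n => //=; exact: ltn_ord.
    move=> [n /= nM h]; apply/existsP; exists (Ordinal nM).
    by under eq_bigr do rewrite add0n.
  apply: bigcup_measurable => n _.
  have ms : measurable_fun setT (fun z => \sum_(j < n.+1) F (joint_shift j z)).
    by apply: measurable_sum => j; exact: mFk.
  by apply/measurable_fun_boolP; apply: measurable_fun_ltr => //; exact: measurable_cst.
have EE : E = \bigcup_M EM M.
  apply/seteqP; split=> z /=.
    move=> [n h]; exists n.+1 => //; apply/existsP; exists ord_max.
    by under eq_bigr do rewrite add0n.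
  move=> [M _ /existsP[n]]; under eq_bigr do rewrite add0n.
  by move=> h; exists n.
split; first by rewrite EE; exact: bigcupT_measurable.
have I0 : (0 <= \int[mu]_z (F z)%:E)%E by apply: integral_ge0 => z _; rewrite lee_fin.
have [Ioo|] := ltP (\int[mu]_z (F z)%:E)%E +oo%E; last by rewrite leye_eq => /eqP ->; rewrite leey.
have Ifin : (\int[mu]_z (F z)%:E \is a fin_num)%E by rewrite ge0_fin_numE.
pose I := fine (\int[mu]_z (F z)%:E)%E; have IE : (\int[mu]_z (F z)%:E = I%:E)%E by rewrite fineK.
have mEMM M : (mu (EM M) = (fine (mu (EM M)))%:E)%E.
  by rewrite fineK// ge0_fin_numE// (le_lt_trans (probability_le1 (Po \x Pp)%E (mEM M)))// ltry.
have key M : lambda * fine (mu (EM M)) <= I.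
  pose q := fine (mu (EM M)); rewrite -/q.
  have meM : measurable_fun setT (fun z => (e M z)%:R%:E : \bar R).
    by apply/measurable_EFinP; apply: measurableT_comp => //; apply/measurable_fun_boolP; exact: mEM.
  have eI : joint_invariant (fun z => (e M z)%:R%:E : \bar R).
    move=> f fA w omega; congr (_%:R)%:E; congr nat_of_bool; apply: eq_existsb => n.
    by under eq_bigr do rewrite -[joint_shift _ _]/(map_walk f (shift_walk _ w), omega) FI.
  have Ie i : (\int[mu]_z (e M (joint_shift i z))%:R%:E = q%:E)%E.
    rewrite (@joint_stationary i (fun z => (e M z)%:R%:E))//.
    rewrite /q -mEMM (eq_integral (fun z => (\1_(EM M) z)%:E)) ?integral_indic ?setIT// => z _.
    by rewrite indicE; congr (_%:R)%:E; congr nat_of_bool; apply/idP/idP; rewrite inE.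
  have IF i : (\int[mu]_z (F (joint_shift i z))%:E = I%:E)%E.
    rewrite -IE; apply: (@joint_stationary i (EFin \o F)) => //; first exact/measurable_EFinP.
    by move=> f fA w omega /=; rewrite FI.
  have mes i : measurable_fun setT (fun z => (e M (joint_shift i z))%:R%:E : \bar R).
    exact: (measurableT_comp meM (measurable_joint_shift i)).
  (* [exceeds_count] integrated term by term: stationarity makes each term on the left equal to q
     and each term on the right equal to I. *)
  have N_bound N : lambda * (N%:R * q) <= (N + M)%:R * I.
    have : (\int[mu]_z (lambda%:E * \sum_(i < N) (e M (joint_shift i z))%:R%:E)
        <= \int[mu]_z (\sum_(i < N + M) (F (joint_shift i z))%:E))%E.
      apply: ge0_le_integral => //.
      - by move=> z _; apply: mule_ge0; [rewrite lee_fin ltW|apply: sume_ge0 => i _; rewrite lee_fin].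
      - by apply: emeasurable_funM => //; apply: emeasurable_sum => i.
      - by apply: emeasurable_sum => i; apply/measurable_EFinP; exact: mFk.
      move=> z _; rewrite !sumEFin -EFinM lee_fin.
      under eq_bigr do rewrite eS.
      exact: (@exceeds_count R lambda M (fun j => F (joint_shift j z))).
    rewrite ge0_integralZl//; last 3 first.
    - by apply: emeasurable_sum => i.
    - by move=> z _; apply: sume_ge0 => i _; rewrite lee_fin.
    - by rewrite lee_fin ltW.
    rewrite (@ge0_integral_sum _ _ R mu setT measurableT 'I_N (fun i z => (e M (joint_shift i z))%:R%:E))//.
    rewrite (@ge0_integral_sum _ _ R mu setT measurableT 'I_(N + M) (fun i z => (F (joint_shift i z))%:E))//; last 2 first.
    - by move=> i; apply/measurable_EFinP; exact: mFk.
    - by move=> i z _; rewrite lee_fin.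
    under eq_bigr do rewrite Ie.
    under [X in (_ <= X)%E]eq_bigr do rewrite IF.
    rewrite !sumEFin !sumr_const !card_ord -EFinM lee_fin.
    by rewrite !mulr_natl.
  rewrite leNgt; apply/negP => Iq.
  (* If lambda q > I, this N makes N (lambda q - I) exceed the boundary term M I. *)
  pose N := (Num.truncn (M%:R * I / (lambda * q - I))).+1.
  have : M%:R * I / (lambda * q - I) < N%:R by exact: truncnS_gt.
  rewrite ltr_pdivrMr ?subr_gt0//.
  have := N_bound N; rewrite natrD; lra.
have nd : nondecreasing_seq EM.
  move=> m n mn; apply/subsetPset => z /existsP[k h]; apply/existsP.
  by exists (widen_ord mn k).
have cv := @nondecreasing_cvg_mu _ _ R mu EM mEM (bigcupT_measurable _ mEM) nd.
have muE M : (mu (EM M) <= (I / lambda)%:E)%E.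
  by rewrite mEMM lee_fin ler_pdivlMr// mulrC.
have : (mu E <= (I / lambda)%:E)%E.
  rewrite EE -(cvg_lim (@ereal_hausdorff R) cv); apply: lime_le; first exact: (cvgP _ cv).
  by near=> M; exact: muE.
move=> h; rewrite IE.
apply: le_trans (lee_wpmul2l _ h) _; first by rewrite lee_fin ltW.
by rewrite -EFinM lee_fin mulrCA divff ?mulr1// gt_eqF.
Unshelve. all: by end_near.
Qed.

End Joint.


Lemma measurable_select d1 d2 (T1 : measurableType d1) (T2 : measurableType d2) (V : pointedType)
    (X : T1 -> V) (F : V -> T1 -> T2) :
  countable [set: V] -> (forall v, measurable [set t | X t = v]) ->
  (forall v, measurable_fun setT (F v)) -> measurable_fun setT (fun t => F (X t) t).
Proof.
move=> Vc mX mF _ B mB; rewrite setTI.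
have -> : (fun t => F (X t) t) @^-1` B = \bigcup_v ([set t | X t = v] `&` F v @^-1` B).
  by apply/seteqP; split=> t /=; [exists (X t)|move=> [v _ [<-]]].
apply: countable_bigcupT_measurable => // v; apply: measurableI => //.
by rewrite -[X in measurable X]setTI; exact: mF.
Qed.

Lemma gball_sym (V : choiceType) (adj : rel V) : symmetric adj -> bounded_degrees adj ->
  forall r x y, y \in gball adj adj x r -> x \in gball adj adj y r.
Proof.
move=> adj_sym bounded.
(* [gball] grows at its far end; symmetry requires growth at the near end. *)
have front r x y z : adj x z -> y \in gball adj adj z r -> y \in gball adj adj x r.+1.
  elim: r y => [|r IH] y xz.
    rewrite inE => /eqP ->; apply/mem_gballS => //; right; exists x; rewrite ?xz//.
    exact: gball_refl.
  move=> /mem_gballS[//|yz|[u uz uy]]; apply/mem_gballS => //; first by left; exact: IH.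
  by right; exists u => //; exact: IH.
elim=> [|r IH] x y; first by rewrite !inE eq_sym.
move=> /mem_gballS[//|yx|[z zx /andP[zy _]]].
  by apply/mem_gballS => //; left; exact: IH.
by apply: (front _ _ _ z); [rewrite adj_sym|exact: IH].
Qed.

Lemma counting_ge0 (R : realType) (V : choiceType) (A : set V) : (0 <= counting A :> \bar R)%E.
Proof. by rewrite /counting; case: ifP => _; rewrite ?lee_fin ?leey. Qed.

(** * The functionals counted along the walk *)

Section Functionals.
Variables (R : realType) (V : pointedType) (adj : rel V) (o : V).
Variables (p : R) (Po : probability (walk_space V) R) (Pp : probability (config adj) R).
Hypotheses (adj_sym : symmetric adj) (bounded : bounded_degrees adj) (conn : connected_graph adj).
Variable chi : R.
Hypothesis le_chi : forall x, (\int[Pp]_omega counting (cluster omega x) <= chi%:E)%E.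
Local Notation T := (walk_space V * config adj)%type.
Local Notation mu := (Po \x Pp)%E.
Implicit Types (J : pred nat) (z : T).

Let Vcount : countable [set: V] := countable_vertices bounded o conn.

Lemma measurable_position i v : measurable [set z : T | z.1 i = v].
Proof.
by have := @measurable_fst _ _ (walk_space V) (config adj) measurableT _ (measurable_walk_at i v);
   rewrite setTI.
Qed.

(* [J] is the set of times at which a return to the cluster of the starting point is forbidden. *)
Definition no_return J z : bool := `[< forall j, J j -> ~ cluster z.2 (z.1 0%N) (z.1 j) >].

(** The contribution of time 0 when each cluster is counted at its last visit. *)
Definition new_sites J z : \bar R := (counting (cluster z.2 (z.1 0%N)) * (no_return J z)%:R%:E)%E.

(* On infinite clusters [fine] returns 0; this happens with probability 0, outside [good]. *)
Definition new_sites_real J z : R := fine (new_sites J z).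

(** The cluster and the time horizon are cut at the same [r], so one parameter bounds both the edges
    and the steps that are read. *)
Definition no_return_local J r z : bool :=
  `[< forall j, (j <= r)%N -> J j -> z.1 j \notin gball adj (open_adj z.2) (z.1 0%N) r >].

Definition new_sites_local J r z : R :=
  #|` gball adj (open_adj z.2) (z.1 0%N) r|%:R * (no_return_local J r z)%:R.

Lemma measurable_in_cluster i j : measurable [set z : T | cluster z.2 (z.1 i) (z.1 j)].
Proof.
have h : measurable_fun setT (fun z : T => `[< cluster z.2 (z.1 i) (z.1 j) >]).
  apply: (@measurable_select _ _ _ _ _ (fun z : T => z.1 i)
    (fun v z => `[< cluster z.2 v (z.1 j) >]) Vcount (measurable_position i)) => v.
  apply: (@measurable_select _ _ _ _ _ (fun z : T => z.1 j)
    (fun u z => `[< cluster z.2 v u >]) Vcount (measurable_position j)) => u.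
  apply/measurable_fun_boolP.
  have := @measurable_snd _ _ (walk_space V) (config adj) measurableT _
    (measurable_cluster adj_sym bounded v u).
  by rewrite setTI; congr measurable; apply/seteqP; split=> z /= /asboolP.
move/measurable_fun_boolP : h; congr measurable.
by apply/seteqP; split=> z /= /asboolP.
Qed.

Lemma measurable_no_return J : measurable [set z | no_return J z].
Proof.
have -> : [set z | no_return J z] = \bigcap_(j in [set j | J j]) ~` [set z | cluster z.2 (z.1 0%N) (z.1 j)].
  by apply/seteqP; split=> z /=; [move=> /asboolP h j; exact: h|move=> h; apply/asboolP].
by apply: bigcap_measurableType => j _; apply: measurableC; exact: measurable_in_cluster.
Qed.

Lemma measurable_counting_cluster_at i :
  measurable_fun setT (fun z : T => counting (cluster z.2 (z.1 i)) : \bar R).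
Proof.
apply: (@measurable_select _ _ _ _ _ (fun z : T => z.1 i)
  (fun v z => counting (cluster z.2 v) : \bar R) Vcount (measurable_position i)) => v.
exact: measurableT_comp (measurable_counting_cluster adj_sym bounded v) measurable_snd.
Qed.

Lemma measurable_new_sites J : measurable_fun setT (new_sites J).
Proof.
apply: emeasurable_funM; first exact: measurable_counting_cluster_at.
apply/measurable_EFinP; apply: measurableT_comp => //.
by apply/measurable_fun_boolP; exact: measurable_no_return.
Qed.

Lemma new_sites_ge0 J z : (0 <= new_sites J z)%E.
Proof. by apply: mule_ge0; [exact: counting_ge0|rewrite lee_fin]. Qed.

Lemma new_sites_real_ge0 J z : 0 <= new_sites_real J z.
Proof. by rewrite fine_ge0// new_sites_ge0. Qed.

Lemma measurable_new_sites_real J : measurable_fun setT (new_sites_real J).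
Proof. exact: measurableT_comp (measurable_new_sites J). Qed.

Lemma no_return_anti J J' z : (forall j, J j -> J' j) -> no_return J' z -> no_return J z.
Proof. by move=> JJ /asboolP h; apply/asboolP => j /JJ; exact: h. Qed.

Lemma new_sites_anti J J' z : (forall j, J j -> J' j) -> (new_sites J' z <= new_sites J z)%E.
Proof.
move=> JJ; apply: lee_wpmul2l; first exact: counting_ge0.
rewrite lee_fin ler_nat; case h : (no_return J' z) => //.
by rewrite (no_return_anti JJ h).
Qed.

Lemma new_sites_pred0 z : new_sites pred0 z = counting (cluster z.2 (z.1 0%N)).
Proof.
rewrite /new_sites (_ : no_return _ _ = true) ?mule1//.
by apply/asboolP.
Qed.

Lemma joint_invariant_new_sites J : joint_invariant adj_sym (new_sites J).
Proof.
move=> f fA w omega; rewrite /new_sites /= counting_cluster_act//; congr (_ * _%:R%:E)%E.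
rewrite /no_return/=; congr (nat_of_bool `[< _ >]); apply/propext.
by split=> h j /h; rewrite cluster_act.
Qed.

Lemma joint_invariant_new_sites_real J : joint_invariant adj_sym (new_sites_real J).
Proof. by move=> f fA w omega; rewrite /new_sites_real joint_invariant_new_sites. Qed.

Lemma mem_gball_act f (fA : automorphism adj f) omega x y r :
  (y \in gball adj (open_adj (act adj_sym fA omega)) x r) = (f y \in gball adj (open_adj omega) (f x) r).
Proof. by apply: gball_automorphism => // u v; rewrite open_adj_act. Qed.

Lemma joint_invariant_new_sites_local J r : joint_invariant adj_sym (new_sites_local J r).
Proof.
move=> f fA w omega; rewrite /new_sites_local /= card_gball_act//; congr (_ * _%:R).
rewrite /no_return_local/=; congr (nat_of_bool `[< _ >]); apply/propext.
by split=> h j jr /(h _ jr); rewrite mem_gball_act.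
Qed.

Lemma new_sites_local_ge0 J r z : 0 <= new_sites_local J r z.
Proof. by apply: mulr_ge0. Qed.

Lemma measurable_new_sites_local J r : measurable_fun setT (new_sites_local J r).
Proof.
have mg x y : measurable_fun setT (fun omega : config adj => y \in gball adj (open_adj omega) x r).
  apply: (measurable_local (H := edges_meeting adj (gball adj adj x r))) => omega omega' oo.
  by rewrite (gball_agree adj_sym bounded oo).
apply: measurable_funM.
  apply: (@measurable_select _ _ _ _ _ (fun z : T => z.1 0%N)
    (fun v z => #|` gball adj (open_adj z.2) v r|%:R : R) Vcount (measurable_position 0)) => v.
  apply: (@measurableT_comp _ _ _ _ _ _ (fun omega : config adj => #|` gball adj (open_adj omega) v r|%:R : R)) => //.
  apply: (measurable_local (H := edges_meeting adj (gball adj adj v r))) => omega omega' oo.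
  by rewrite (gball_agree adj_sym bounded oo).
apply: measurableT_comp => //; apply/measurable_fun_boolP.
have -> : [set z | no_return_local J r z] = \bigcap_(j in [set j | (j <= r)%N && J j])
    ~` [set z : T | z.1 j \in gball adj (open_adj z.2) (z.1 0%N) r].
  apply/seteqP; split=> z /=.
    by move=> /asboolP h j /= /andP[jr Jj]; apply/negP; exact: h.
  by move=> h; apply/asboolP => j jr Jj; apply/negP; apply: h; rewrite /= jr.
apply: bigcap_measurableType => j _; apply: measurableC; apply/measurable_fun_boolP.
apply: (@measurable_select _ _ _ _ _ (fun z : T => z.1 0%N)
  (fun v z => z.1 j \in gball adj (open_adj z.2) v r) Vcount (measurable_position 0)) => v.
apply: (@measurable_select _ _ _ _ _ (fun z : T => z.1 j)
  (fun u z => u \in gball adj (open_adj z.2) v r) Vcount (measurable_position j)) => u.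
exact: (measurableT_comp (mg v u) measurable_snd).
Qed.

Definition good z := forall x, finite_set (cluster z.2 x).

Lemma new_sites_fine J z : good z -> new_sites J z = (new_sites_real J z)%:E.
Proof.
move=> gz; rewrite /new_sites_real fineK// /new_sites fin_numM//.
by rewrite /counting asboolT.
Qed.

Lemma ae_good : {ae mu, forall z, good z}.
Proof.
have [e einj] := countable_injP _ Vcount.
(* Vertices are enumerated through the injection [e]; an index that is not attained falls back on
   [o]. *)
have : {ae mu, forall z n, counting (cluster z.2 (xget o [set x | e x = n])) \is a @fin_num R}.
  apply: ae_foralln => n; set x := xget _ _.
  have mc : measurable_fun setT (fun z : T => counting (cluster z.2 x) : \bar R).
    exact: measurableT_comp (measurable_counting_cluster adj_sym bounded x) measurable_snd.
  have : mu.-integrable setT (fun z : T => counting (cluster z.2 x)).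
    apply/integrableP; split=> //.
    under eq_integral do rewrite gee0_abs ?counting_ge0//.
    rewrite fubini_tonelli1//; last by move=> z; exact: counting_ge0.
    rewrite /fubini_F/= integral_cst//= [X in (_ * X)%E]probability_setT mule1.
    exact: le_lt_trans (le_chi x) (ltry _).
  move=> /(integrable_ae measurableT); apply: filterS => z; exact.
apply: filterS => z h x; have := h (e x).
case: xgetP => [y _ /= yx|/(_ x) h0]; last by exfalso; exact: h0.
have -> : y = x by apply: einj; rewrite ?inE.
by rewrite /counting; case: ifPn => // /asboolP.
Qed.

Lemma integral_new_sites_le J : (\int[mu]_z new_sites J z <= chi%:E)%E.
Proof.
apply: (@le_trans _ _ (\int[mu]_z counting (cluster z.2 (z.1 0%N)))%E).
  apply: ge0_le_integral => //.
  - by move=> z _; exact: new_sites_ge0.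
  - exact: measurable_new_sites.
  - exact: measurable_counting_cluster_at.
  - by move=> z _; rewrite -new_sites_pred0; exact: new_sites_anti.
rewrite fubini_tonelli1//; last 2 first.
- exact: measurable_counting_cluster_at.
- by move=> z; exact: counting_ge0.
apply: (@le_trans _ _ (\int[Po]_w cst chi%:E w)%E); last first.
  by rewrite integral_cst//= probability_setT mule1.
apply: ge0_le_integral => //.
- by move=> w _; apply: integral_ge0 => omega _; exact: counting_ge0.
- apply: (@measurable_fun_fubini_tonelli_F _ _ _ _ R Pp (fun z : T => counting (cluster z.2 (z.1 0%N)))).
    exact: measurable_counting_cluster_at.
  by move=> z; exact: counting_ge0.
- by move=> w _; exact: le_chi.
Qed.

Lemma integral_new_sites_real J : (\int[mu]_z (new_sites_real J z)%:E = \int[mu]_z new_sites J z)%E.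
Proof.
apply: ge0_ae_eq_integral => //.
- by apply/measurable_EFinP; exact: measurable_new_sites_real.
- exact: measurable_new_sites.
- by move=> z _; rewrite lee_fin new_sites_real_ge0.
- by move=> z _; exact: new_sites_ge0.
by apply: filterS ae_good => z /new_sites_fine ->.
Qed.

(** A finite cluster is exhausted at some radius, and a forbidden return, if there is one, is seen
    once [r] exceeds its time. *)
Lemma new_sites_local_cvg J z : good z ->
  exists r0, forall r, (r0 <= r)%N -> new_sites_local J r z = new_sites_real J z.
Proof.
move=> gz; set x := z.1 0%N.
have [r0 h] := finite_reachable_gball bounded (@open_adj_sub _ _ adj_sym z.2) (gz x).
have mem r y : (r0 <= r)%N -> y \in gball adj (open_adj z.2) x r <-> cluster z.2 x y.
  by move=> /h E; rewrite -[cluster z.2 x]E.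
have size r : (r0 <= r)%N -> #|` gball adj (open_adj z.2) x r|%:R = fine (counting (cluster z.2 x)) :> R.
  by move=> /h E; rewrite /counting asboolT//= -[cluster z.2 x]E set_fsetK.
have YE : new_sites_real J z = fine (counting (cluster z.2 x)) * (no_return J z)%:R.
  by rewrite /new_sites_real /new_sites fineM// /counting asboolT.
suff [r1 h1] : exists r1, forall r, (r1 <= r)%N -> no_return_local J r z = no_return J z.
  exists (maxn r0 r1) => r; rewrite geq_max => /andP[r0r r1r].
  by rewrite /new_sites_local size// h1.
have [nr|nr] := boolP (no_return J z).
  exists r0 => r rr; apply/asboolP => j jr Jj; apply/negP => /mem h2.
  by move/asboolP : nr => /(_ j Jj); apply; exact: h2.
have [j Jj xj] : exists2 j, J j & cluster z.2 x (z.1 j).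
  apply: contrapT => h2; move/asboolP : nr; apply => j Jj xj; apply: h2; by exists j.
exists (maxn r0 j) => r; rewrite geq_max => /andP[r0r jr].
by apply/negbTE/asboolP => /(_ j jr Jj) /negP; apply; apply/mem.
Qed.

Lemma new_sites_local_le J r z : good z -> new_sites_local J r z <= new_sites_real pred0 z.
Proof.
move=> gz; apply: (@le_trans _ _ #|` gball adj (open_adj z.2) (z.1 0%N) r|%:R).
  by rewrite ler_piMr// lern1 leq_b1.
rewrite -lee_fin -new_sites_fine// new_sites_pred0.
by apply: card_gball_le_counting => //; exact: open_adj_sub.
Qed.

Lemma new_sites_real_le J J' z : good z -> (forall j, J j -> J' j) ->
  new_sites_real J' z <= new_sites_real J z.
Proof. by move=> gz JJ; rewrite -lee_fin -!new_sites_fine//; exact: new_sites_anti. Qed.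

Lemma integrable_new_sites_real J : mu.-integrable setT (fun z => (new_sites_real J z)%:E).
Proof.
apply/integrableP; split; first by apply/measurable_EFinP; exact: measurable_new_sites_real.
under eq_integral do rewrite gee0_abs ?lee_fin ?new_sites_real_ge0//.
by rewrite integral_new_sites_real (le_lt_trans (integral_new_sites_le _))// ltry.
Qed.

Lemma new_sites_local_approx J :
  ((\int[mu]_z `|new_sites_local J r z - new_sites_real J z|%:E)%E @[r --> \oo] --> 0%E) /\
  ((\int[mu]_z (new_sites_local J r z)%:E)%E @[r --> \oo] --> (\int[mu]_z (new_sites_real J z)%:E)%E).
Proof.
have [] := @dominated_convergence _ _ R mu setT measurableT
  (fun r z => (new_sites_local J r z)%:E) (fun z => (new_sites_real J z)%:E)
  (fun z => (new_sites_real pred0 z)%:E).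
- by move=> r; apply/measurable_EFinP; exact: measurable_new_sites_local.
- by apply/measurable_EFinP; exact: measurable_new_sites_real.
- apply: filterS ae_good => z gz _; have [r0 h] := new_sites_local_cvg J gz.
  by apply: cvg_near_cst; exists r0 => // r /= /h ->.
- exact: integrable_new_sites_real.
- apply: filterS ae_good => z gz r _; rewrite abse_EFin lee_fin ger0_norm ?new_sites_local_ge0//.
  exact: new_sites_local_le.
by move=> _ h1 h2; split.
Qed.

Lemma new_sites_real_cvg (J : nat -> pred nat) J' : 
  (forall z, good z -> new_sites_real (J m) z @[m --> \oo] --> new_sites_real J' z) ->
  (\int[mu]_z (new_sites_real (J m) z)%:E)%E @[m --> \oo] --> (\int[mu]_z (new_sites_real J' z)%:E)%E.
Proof.
move=> cv; have [] := @dominated_convergence _ _ R mu setT measurableT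
  (fun m z => (new_sites_real (J m) z)%:E) (fun z => (new_sites_real J' z)%:E)
  (fun z => (new_sites_real pred0 z)%:E).
- by move=> m; apply/measurable_EFinP; exact: measurable_new_sites_real.
- by apply/measurable_EFinP; exact: measurable_new_sites_real.
- by apply: filterS ae_good => z gz _; apply/cvg_EFin; [near=> m|exact: cv].
- exact: integrable_new_sites_real.
- apply: filterS ae_good => z gz m _; rewrite abse_EFin lee_fin ger0_norm ?new_sites_real_ge0//.
  by apply: new_sites_real_le => // j.
by move=> _ _ h2.
Unshelve. all: by end_near.
Qed.

End Functionals.


Lemma measure_bigcup_seq_le d (T : measurableType d) (R : realType) (m : {measure set T -> \bar R})
    (I : eqType) (s : seq I) (A : I -> set T) : (forall i, measurable (A i)) ->
  measurable (\bigcup_(i in [set i | i \in s]) A i) /\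
  (m (\bigcup_(i in [set i | i \in s]) A i) <= \sum_(i <- s) m (A i))%E.
Proof.
move=> mA; elim: s => [|i s [ms IH]].
  rewrite (_ : [set i | i \in [::]] = set0) ?bigcup_set0 ?measure0 ?big_nil//.
  by apply/seteqP; split.
have -> : \bigcup_(j in [set j | j \in i :: s]) A j = A i `|` \bigcup_(j in [set j | j \in s]) A j.
  apply/seteqP; split=> x /=.
    by move=> [j]; rewrite /= inE => /orP[/eqP ->|js]; [left|right; exists j].
  by move=> [ix|[j js jx]]; [exists i|exists j] => //=; rewrite inE ?eqxx// js orbT.
split; first exact: measurableU.
rewrite big_cons; apply: le_trans (measureU2 m (mA i) ms) _.
exact: leeD.
Qed.

(** * Decorrelation and the ergodic theorem *)

Section Decorrelation.
Variables (R : realType) (V : pointedType) (adj : rel V) (o : V).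
Variables (p : R) (Po : probability (walk_space V) R) (Pp : probability (config adj) R).
Hypotheses (adj_sym : symmetric adj) (bounded : bounded_degrees adj) (conn : connected_graph adj).
Hypotheses (Vinf : infinite_set [set: V]).
Hypotheses (trans : vertex_transitive adj) (deg_gt0 : (0 < degree adj o)%N).
Hypotheses (srwP : is_srw_law adj o Po) (p01 : 0 <= p <= 1) (bernP : is_bernoulli_percolation p Pp).
Local Notation T := (walk_space V * config adj)%type.
Local Notation mu := (Po \x Pp)%E.
Variables (J : pred nat) (r : nat).
Local Notation Y := (@new_sites_local R V adj J r).

Let Vcount : countable [set: V] := countable_vertices bounded o conn.

Definition ball_size : R := #|` gball adj adj o r|%:R.

Lemma new_sites_local_le_ball_size z : Y z <= ball_size.
Proof.
apply: (@le_trans _ _ #|` gball adj (open_adj z.2) (z.1 0%N) r|%:R).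
  by rewrite ler_piMr// lern1 leq_b1.
rewrite ler_nat -{1}(to_vertexE o trans (z.1 0%N)).
have tA := to_vertex_aut o trans (z.1 0%N).
rewrite /ball_size (card_gball_automorphism bounded o r (q' := adj) tA); last first.
  by move=> u v; case: tA => _ ->.
by apply: fsubset_leq_card; exact: gball_sub_ball.
Qed.

Definition balls_meet k (w : walk_space V) : bool :=
  ~~ [disjoint gball adj adj (w 0%N) r & gball adj adj (w k) r]%fset.

Lemma measurable_balls_meet k : measurable [set w | balls_meet k w].
Proof.
apply/measurable_fun_boolP.
apply: (@measurable_select _ _ _ _ _ (fun w : walk_space V => w 0%N)
  (fun v w => ~~ [disjoint gball adj adj v r & gball adj adj (w k) r]%fset) Vcount
  (measurable_walk_at 0)) => v.
apply: (@measurable_select _ _ _ _ _ (fun w : walk_space V => w k)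
  (fun u w => ~~ [disjoint gball adj adj v r & gball adj adj u r]%fset) Vcount
  (measurable_walk_at k)) => u.
exact: measurable_cst.
Qed.

Definition meeting_zone : {fset V} := (\bigcup_(v <- gball adj adj o r) gball adj adj v r)%fset.

(** For k < r the two pieces of walk overlap and the bound is trivial. For k >= r it is the
    probability that the walk is in [meeting_zone], that is within distance 2r of [o]. *)
Definition meeting_bound k : R :=
  if (k < r)%N then 1 else \sum_(x <- meeting_zone) srw_prob R adj o k o x.

Lemma prob_at k x : Po [set w | w k = x] = (srw_prob R adj o k o x)%:E.
Proof.
have idA : automorphism adj id by split=> //; exists id.
exact: (prob_walk_at bounded conn trans deg_gt0 srwP k x idA).
Qed.

Lemma walk_starts : Po [set w | w 0%N <> o] = 0%E.
Proof.
have -> : [set w : walk_space V | w 0%N <> o] = ~` [set w : walk_space V | w 0%N = o] by [].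
by rewrite probability_setC ?prob_at/= ?eqxx ?subee//; exact: measurable_walk_at.
Qed.

Lemma prob_balls_meet_le k : (r <= k)%N -> (Po [set w | balls_meet k w] <= (meeting_bound k)%:E)%E.
Proof.
move=> rk; rewrite /meeting_bound ltnNge rk /=.
have [mU leU] := measure_bigcup_seq_le Po meeting_zone (measurable_walk_at k).
have m0 : measurable [set w : walk_space V | w 0%N <> o].
  by apply: measurableC; exact: measurable_walk_at.
apply: (@le_trans _ _ (Po ([set w : walk_space V | w 0%N <> o] `|`
    \bigcup_(x in [set x | x \in enum_fset meeting_zone]) [set w | w k = x])%E)).
  apply: le_measure; rewrite ?inE; [exact: measurable_balls_meet|exact: measurableU|].
  move=> w /= /fdisjointP h; have [wo|] := pselect (w 0%N = o); last by left.
  right; exists (w k) => //=; apply: contrapT => wk; apply: h => v; rewrite wo => vo.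
  apply/negP => /(gball_sym adj_sym bounded) vk; apply: wk.
  by apply/bigfcupP; exists v; rewrite ?vo.
apply: le_trans (measureU2 _ m0 mU) _.
rewrite [X in (X + _)%E]walk_starts add0e; apply: le_trans leU _.
rewrite (eq_bigr (fun x => (srw_prob R adj o k o x)%:E)) ?sumEFin// => x _.
exact: prob_at.
Qed.

Lemma meeting_bound_ge0 k : 0 <= meeting_bound k.
Proof.
rewrite /meeting_bound; case: ifP => // _; apply: sumr_ge0 => x _.
by rewrite -lee_fin -prob_at.
Qed.

Lemma meeting_bound_cvg0 : meeting_bound k @[k --> \oo] --> 0.
Proof.
have cv : (\sum_(x <- meeting_zone) srw_prob R adj o k o x) @[k --> \oo] --> \sum_(x <- meeting_zone) (0 : R).
  apply: cvg_sum_seq => x _; apply: srw_prob_cvg0 => //.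
  exact: degreeE.
rewrite big1// in cv; apply: cvg_trans cv; apply: near_eq_cvg.
by exists r => // k /= rk; rewrite /meeting_bound ltnNge rk.
Qed.

Lemma correlation_le k a : (\int[mu]_z (Y z)%:E = a%:E)%E ->
  (\int[mu]_z (Y z * Y (joint_shift k z))%:E <= (a ^+ 2 + ball_size ^+ 2 * meeting_bound k)%:E)%E.
Proof.
move=> aE; have b0 : 0 <= ball_size by [].
have mY : measurable_fun setT Y by exact: measurable_new_sites_local.
have mYk : measurable_fun setT (fun z => Y (joint_shift k z)).
  exact: (measurableT_comp mY (measurable_joint_shift k)).
have YY_le z : Y z * Y (joint_shift k z) <= ball_size ^+ 2.
  by rewrite expr2; apply: ler_pM; rewrite ?new_sites_local_ge0 ?new_sites_local_le_ball_size.
have YY_ge0 z : 0 <= Y z * Y (joint_shift k z) by rewrite mulr_ge0 ?new_sites_local_ge0.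
have mYY : measurable_fun setT (fun z => (Y z * Y (joint_shift k z))%:E : \bar R).
  by apply/measurable_EFinP; exact: measurable_funM.
have [rk|kr] := leqP r k; last first.
  rewrite /meeting_bound kr mulr1.
  apply: (@le_trans _ _ (\int[mu]_z cst (ball_size ^+ 2)%:E z)%E).
    by apply: ge0_le_integral => // z _; rewrite lee_fin.
  by rewrite integral_cst//= probability_setT mule1 lee_fin lerDr sqr_ge0.
pose h w := (\int[Pp]_omega (Y (w, omega))%:E)%E.
have h0 w : (0 <= h w)%E by apply: integral_ge0 => omega _; rewrite lee_fin new_sites_local_ge0.
have mYE : measurable_fun setT (fun z => (Y z)%:E : \bar R) by exact/measurable_EFinP.
have YE0 z : (0 <= (Y z)%:E)%E by rewrite lee_fin new_sites_local_ge0.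
have mh : measurable_fun setT h.
  exact: (@measurable_fun_fubini_tonelli_F _ _ _ _ R Pp (fun z => (Y z)%:E) mYE YE0).
have mhk : measurable_fun setT (fun w => h (shift_walk k w)).
  exact: (measurableT_comp mh (measurable_shift_walk k)).
have hI : walk_invariant adj h.
  apply: (walk_invariant_integral (F := fun z => (Y z)%:E) bernP) => //.
  by move=> f fA w omega; rewrite joint_invariant_new_sites_local.
have Ih : (\int[Po]_w h w = a%:E)%E.
  by rewrite -aE (fubini_tonelli1 _ mYE YE0).
have hloc w w' : (forall i, (i <= k)%N -> w i = w' i) -> h w = h w'.
  move=> ww'; apply: eq_integral => omega _; congr EFin.
  rewrite /new_sites_local /no_return_local /= ww'//; congr (_ * (nat_of_bool `[< _ >])%:R).
  by apply/propext; split=> hh j jr Jj; have := hh j jr Jj; rewrite ww'// (leq_trans jr).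
have mm := measurable_balls_meet k.
(* For a fixed walk, disjoint balls make the two values depend on disjoint sets of edges, so the
   mean factorises; otherwise the product is at most the square of the ball size. *)
have inner w : (\int[Pp]_omega (Y (w, omega) * Y (joint_shift k (w, omega)))%:E <=
    h w * h (shift_walk k w) + (ball_size ^+ 2)%:E * (\1_[set w | balls_meet k w] w)%:E)%E.
  rewrite indicE; have [|dis] := boolP (w \in _); last first.
    rewrite mule0 adde0 /h.
    under eq_integral do rewrite EFinM.
    have {dis} : [disjoint gball adj adj (w 0%N) r & gball adj adj (w k) r]%fset.
      by apply: contraNT dis => dis; rewrite inE.
    rewrite fdisjoint_sym => dis.
    have E := @integral_indep R V adj p Pp p01 bernP (edges_meeting adj (gball adj adj (w 0%N) r))
      (fun omega => (Y (w, omega))%:E) (fun omega => (Y (joint_shift k (w, omega)))%:E)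
      (measurableT_comp mYE (pair1_measurable w)) (fun omega => YE0 _)
      (measurableT_comp mYE (pair1_measurable (shift_walk k w))) (fun omega => YE0 _).
    rewrite E => [//|omega omega' oo|omega omega' oo]; congr EFin.
      rewrite /new_sites_local /no_return_local /=.
      by rewrite (gball_agree adj_sym bounded oo).
    rewrite /new_sites_local /no_return_local /= /shift_walk /= addn0.
    by rewrite (gball_agreeC adj_sym bounded dis oo).
  move=> _; rewrite mule1.
  apply: (@le_trans _ _ (ball_size ^+ 2)%:E); last by rewrite leeDr// mule_ge0.
  apply: (@le_trans _ _ (\int[Pp]_omega cst (ball_size ^+ 2)%:E omega)%E).
    apply: ge0_le_integral => //.
    + by move=> omega _; rewrite lee_fin.
    + exact: (measurableT_comp mYY (pair1_measurable w)).
    + by move=> omega _; rewrite lee_fin.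
  by rewrite integral_cst//= probability_setT mule1.
rewrite (fubini_tonelli1 _ mYY)//.
have mi : measurable_fun setT (fun w : walk_space V => (ball_size ^+ 2)%:E * (\1_[set w | balls_meet k w] w)%:E)%E.
  by apply: emeasurable_funM => //; apply/measurable_EFinP; exact: measurable_indic.
apply: (@le_trans _ _ (\int[Po]_w (h w * h (shift_walk k w) +
    (ball_size ^+ 2)%:E * (\1_[set w | balls_meet k w] w)%:E))%E).
  apply: ge0_le_integral => //.
  - by move=> w _; apply: integral_ge0 => omega _; rewrite lee_fin.
  - by apply: (@measurable_fun_fubini_tonelli_F _ _ _ _ R Pp _ mYY) => z; rewrite lee_fin.
  - by apply: emeasurable_funD => //; exact: emeasurable_funM.
  - by move=> w _; exact: inner.
rewrite ge0_integralD//; last 3 first.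
- by move=> w _; exact: mule_ge0.
- exact: emeasurable_funM.
- by move=> w _; rewrite mule_ge0// lee_fin ?sqr_ge0.
(* [h w] depends on the walk only up to time r <= k, so the Markov property at time k applies. *)
rewrite (walk_markov bounded conn trans deg_gt0 srwP)// Ih.
have mind : measurable_fun setT (fun w : walk_space V => (\1_[set w | balls_meet k w] w)%:E : \bar R).
  by apply/measurable_EFinP; exact: measurable_indic.
rewrite (ge0_integralZl Po measurableT mind); [|by move=> w _; rewrite lee_fin|by rewrite lee_fin sqr_ge0].
rewrite integral_indic// setIT.
have -> : (a ^+ 2 + ball_size ^+ 2 * meeting_bound k)%:E =
    (a%:E * a%:E + (ball_size ^+ 2)%:E * (meeting_bound k)%:E)%E.
  by rewrite -!EFinM -EFinD expr2.
rewrite leeD2l//.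
by apply: lee_wpmul2l; [rewrite lee_fin sqr_ge0|exact: prob_balls_meet_le].
Qed.

End Decorrelation.


Lemma sum_delay_le (R : realType) (b : nat -> R) (B : R) n i : (forall j, 0 <= b j <= B) ->
  `|\sum_(j < n) b (i + j)%N - \sum_(j < n) b j| <= B * i%:R.
Proof.
move=> bB; have b0 j : 0 <= b j by case/andP: (bB j).
have bnd (c : nat -> R) : (forall j, 0 <= c j <= B) -> 0 <= \sum_(j < i) c j <= B * i%:R.
  move=> cB; apply/andP; split; first by apply: sumr_ge0 => j _; case/andP: (cB j).
  apply: (@le_trans _ _ (\sum_(j < i) B)); first by apply: ler_sum => j _; case/andP: (cB j).
  by rewrite sumr_const card_ord mulr_natr.
have := bnd b bB; have := bnd (fun j => b (n + j)%N) (fun j => bB _).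
have := sum_ord_split b i n; rewrite addnC sum_ord_split => e h1 h2.
rewrite ler_norml; apply/andP; split; lra.
Qed.

(** Delaying a bounded sequence by i changes a partial sum by at most i terms at each end. Replacing
    it by its running means therefore costs a bound independent of n. *)
Lemma mean_delay_le (R : realType) (b : nat -> R) (B : R) n k : (forall j, 0 <= b j <= B) ->
  `|\sum_(j < n) b j - \sum_(j < n) (k.+1%:R^-1 * \sum_(i < k.+1) b (j + i)%N)| <= B * k.+1%:R.
Proof.
move=> bB; have B0 : 0 <= B by case/andP: (bB 0) => h1 h2; exact: le_trans h2.
have k0 : 0 < k.+1%:R :> R by rewrite ltr0n.
have -> : \sum_(j < n) b j - \sum_(j < n) (k.+1%:R^-1 * \sum_(i < k.+1) b (j + i)%N) =
    k.+1%:R^-1 * \sum_(i < k.+1) (\sum_(j < n) b j - \sum_(j < n) b (i + j)%N).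
  rewrite sumrB sumr_const card_ord mulrBr -mulr_sumr exchange_big/=.
  congr (_ - _ * _); first by rewrite -(mulr_natl (\sum_(j < n) b j)) mulrA mulVf ?mul1r// gt_eqF.
  by apply: eq_bigr => i _; apply: eq_bigr => j _; rewrite addnC.
rewrite normrM ger0_norm ?invr_ge0// mulrC ler_pdivrMr//.
apply: le_trans (ler_norm_sum _ _ _) _.
apply: (@le_trans _ _ (\sum_(i < k.+1) B * k.+1%:R)); last first.
  by rewrite sumr_const card_ord -(mulr_natr (B * k.+1%:R)).
apply: ler_sum => i _; rewrite distrC; apply: le_trans (sum_delay_le _ _ bB) _.
by apply: ler_wpM2l => //; rewrite ler_nat ltnW.
Qed.

(** For a fixed lambda = 1 / (i + 1) the exceptional sets for eps = 1 / (j + 1) have a null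
    intersection over j; countably many i then suffice. *)
Lemma ae_cvg_small_sets d (T : measurableType d) (R : realType) (m : {measure set T -> \bar R})
    (X : nat -> T -> R) (c : R) :
  (forall lambda eps : R, 0 < lambda -> 0 < eps -> exists E, [/\ measurable E, (m E <= eps%:E)%E &
    forall z, ~ E z -> \forall n \near \oo, `|X n z - c| <= lambda]) ->
  {ae m, forall z, X n z @[n --> \oo] --> c}.
Proof.
move=> h; have inv0 i : 0 < i.+1%:R^-1 :> R by rewrite invr_gt0 ltr0n.
have {}h i j : {E | [/\ measurable E, (m E <= (j.+1%:R^-1)%:E)%E &
    forall z, ~ E z -> \forall n \near \oo, `|X n z - c| <= i.+1%:R^-1]}.
  by apply: cid; exact: h.
pose E i j := sval (h i j).
have mE i j : measurable (E i j) by rewrite /E; case: (h i j) => ? [].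
have : {ae m, forall z i, exists j, ~ E i j z}.
  apply: ae_foralln => i; exists (\bigcap_j E i j); split.
  - exact: bigcapT_measurable.
  - apply/eqP; rewrite eq_le measure_ge0 andbT; apply/lee_addgt0Pr => e e0.
    rewrite add0e; pose j := Num.truncn e^-1.
    apply: le_trans (_ : m (E i j) <= _)%E.
      by apply: le_measure; rewrite ?inE//; [exact: bigcapT_measurable|exact: bigcap_inf].
    have -> : E i j = sval (h i j) by [].
    case: (h i j) => /= ? [_ + _]; move/le_trans; apply; rewrite lee_fin.
    by rewrite invf_ple ?posrE ?ltr0n// ltW// truncnS_gt.
  by move=> z /= /forallNP hz j _; apply: contrapT => /hz.
apply: filterS => z hz; apply/cvgrPdist_le => e e0.
pose i := Num.truncn e^-1; have [j nE] := hz i.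
have : \forall n \near \oo, `|X n z - c| <= i.+1%:R^-1.
  by move: nE; rewrite /E; case: (h i j) => /= ? [_ _]; apply.
apply: filterS => n hn; rewrite distrC; apply: le_trans hn _.
by rewrite invf_ple ?posrE ?ltr0n// ltW// truncnS_gt.
Qed.

Section Ergodic.
Variables (R : realType) (V : pointedType) (adj : rel V) (o : V).
Variables (p : R) (Po : probability (walk_space V) R) (Pp : probability (config adj) R).
Hypotheses (adj_sym : symmetric adj) (bounded : bounded_degrees adj) (conn : connected_graph adj).
Hypotheses (Vinf : infinite_set [set: V]).
Hypotheses (trans : vertex_transitive adj) (deg_gt0 : (0 < degree adj o)%N).
Hypotheses (srwP : is_srw_law adj o Po) (p01 : 0 <= p <= 1) (bernP : is_bernoulli_percolation p Pp).
Variable chi : R.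
Hypothesis le_chi : forall x, (\int[Pp]_omega counting (cluster omega x) <= chi%:E)%E.
Local Notation T := (walk_space V * config adj)%type.
Local Notation mu := (Po \x Pp)%E.
Variable (J : pred nat).

Definition walk_mean (F : T -> R) n z : R := n.+1%:R^-1 * \sum_(i < n.+1) F (joint_shift i z).

Lemma measurable_walk_mean F n : measurable_fun setT F -> measurable_fun setT (walk_mean F n).
Proof.
move=> mF; apply: measurable_funM => //; apply: measurable_sum => i.
exact: (measurableT_comp mF (measurable_joint_shift i)).
Qed.

Lemma joint_invariant_walk_mean F n : joint_invariant adj_sym F -> joint_invariant adj_sym (walk_mean F n).
Proof.
move=> FI f fA w omega; congr (_ * _); apply: eq_bigr => i _.
by rewrite -[joint_shift _ _]/(map_walk f (shift_walk _ w), omega) FI.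
Qed.

Section Local.
Variable r : nat.
Local Notation Y := (@new_sites_local R V adj J r).
Local Notation b := (ball_size R adj o r).
Local Notation c := (meeting_bound R adj o r).

Let mY : measurable_fun setT Y := measurable_new_sites_local o adj_sym bounded conn J r.
Let Y_ge0 z : 0 <= Y z := @new_sites_local_ge0 R V adj J r z.
Let mYi i : measurable_fun setT (fun z => Y (joint_shift i z)).
Proof. exact: (measurableT_comp mY (measurable_joint_shift i)). Qed.
Let mYE i : measurable_fun setT (fun z => (Y (joint_shift i z))%:E : \bar R).
Proof. exact/measurable_EFinP. Qed.

Lemma correlation_shift_le (a : R) i j : (\int[mu]_z (Y z)%:E = a%:E)%E ->
  (\int[mu]_z (Y (joint_shift i z) * Y (joint_shift j z))%:E <=
    (a ^+ 2 + b ^+ 2 * c ((i - j) + (j - i))%N)%:E)%E.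
Proof.
move=> aE.
have main i' j' : (i' <= j')%N -> (\int[mu]_z (Y (joint_shift i' z) * Y (joint_shift j' z))%:E <=
    (a ^+ 2 + b ^+ 2 * c (j' - i')%N)%:E)%E.
  move=> ij; pose G z := (Y z * Y (joint_shift (j' - i') z))%:E : \bar R.
  have -> : (\int[mu]_z (Y (joint_shift i' z) * Y (joint_shift j' z))%:E = \int[mu]_z G (joint_shift i' z))%E.
    by apply: eq_integral => z _; rewrite /G joint_shiftD subnKC.
  rewrite (joint_stationary bounded conn trans deg_gt0 srwP (adj_sym := adj_sym) bernP).
  - exact: (correlation_le adj_sym bounded conn trans deg_gt0 srwP p01 bernP).
  - by apply/measurable_EFinP; apply: measurable_funM.
  - by move=> z; rewrite lee_fin mulr_ge0.
  - move=> f fA w omega; rewrite /G joint_invariant_new_sites_local//.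
    by rewrite -[joint_shift _ (map_walk f w, _)]/(map_walk f (shift_walk _ w), omega) joint_invariant_new_sites_local.
have [ij|/ltnW ji] := leqP i j.
  have -> : (i - j + (j - i) = j - i)%N by rewrite (eqP ij).
  exact: main.
have -> : (i - j + (j - i) = i - j)%N by rewrite (eqP ji) addn0.
under eq_integral do rewrite mulrC.
exact: main.
Qed.

Lemma mean_second_moment_le (a : R) n : (\int[mu]_z (Y z)%:E = a%:E)%E ->
  (\int[mu]_z (walk_mean Y n z ^+ 2)%:E <=
    (a ^+ 2 + 2 * b ^+ 2 * (n.+1%:R^-1 * \sum_(m < n.+1) c m))%:E)%E.
Proof.
move=> aE; set N : R := n.+1%:R; have N0 : 0 < N by rewrite ltr0n.
have -> : (\int[mu]_z (walk_mean Y n z ^+ 2)%:E = \int[mu]_z ((N ^- 2)%:E *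
    \sum_(i < n.+1) \sum_(j < n.+1) (Y (joint_shift i z) * Y (joint_shift j z))%:E))%E.
  apply: eq_integral => z _; under eq_bigr do rewrite sumEFin.
  rewrite sumEFin -EFinM /walk_mean exprMn exprVn; congr (_ * _)%:E.
  by rewrite expr2 mulr_suml; apply: eq_bigr => i _; rewrite mulr_sumr.
have mYY i j : measurable_fun setT (fun z => (Y (joint_shift i z) * Y (joint_shift j z))%:E : \bar R).
  by apply/measurable_EFinP; exact: measurable_funM.
have YY0 i j z : (0 <= (Y (joint_shift i z) * Y (joint_shift j z))%:E :> \bar R)%E.
  by rewrite lee_fin mulr_ge0.
have mS i : measurable_fun setT (fun z => \sum_(j < n.+1) (Y (joint_shift i z) * Y (joint_shift j z))%:E : \bar R)%E.
  by apply: emeasurable_sum => j.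
have S0 i z : (0 <= \sum_(j < n.+1) (Y (joint_shift i z) * Y (joint_shift j z))%:E :> \bar R)%E.
  exact: sume_ge0.
have mSS : measurable_fun setT (fun z => \sum_(i < n.+1) \sum_(j < n.+1) (Y (joint_shift i z) * Y (joint_shift j z))%:E : \bar R)%E.
  by apply: emeasurable_sum => i.
have N20 : (0 <= (N ^- 2)%:E :> \bar R)%E by rewrite lee_fin invr_ge0 exprn_ge0// ltW.
rewrite (ge0_integralZl mu measurableT mSS _ N20); last by move=> z _; exact: sume_ge0.
rewrite (ge0_integral_sum mu measurableT (f := fun (i : 'I_n.+1) z =>
  (\sum_(j < n.+1) (Y (joint_shift i z) * Y (joint_shift j z))%:E)%E)) => [|//|//].
apply: (@le_trans _ _ ((N ^- 2)%:E * (\sum_(i < n.+1) \sum_(j < n.+1)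
    (a ^+ 2 + b ^+ 2 * c ((i - j) + (j - i))%N)%:E))%E).
  apply: lee_wpmul2l => //; apply: lee_sum => i _.
  rewrite (ge0_integral_sum mu measurableT (f := fun (j : 'I_n.+1) z =>
    (Y (joint_shift i z) * Y (joint_shift j z))%:E)) => [|//|//].
  by apply: lee_sum => j _; exact: correlation_shift_le.
under eq_bigr do rewrite sumEFin.
rewrite sumEFin -EFinM lee_fin.
under eq_bigr do rewrite big_split/= sumr_const card_ord -mulr_sumr.
rewrite big_split/= sumr_const card_ord -mulr_sumr.
have := sum_dist_le n.+1 (meeting_bound_ge0 bounded conn trans deg_gt0 srwP r).
set S2 := (\sum_(i < n.+1) _); set S1 := (\sum_(m < n.+1) _) => h.
rewrite -!(mulr_natl (_ *+ _)) -/N -(mulr_natl (a ^+ 2)) -/N mulrDr.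
apply: lerD; first by rewrite le_eqVlt; apply/orP; left; apply/eqP; field; rewrite gt_eqF.
have -> : 2 * b ^+ 2 * (N^-1 * S1) = N ^- 2 * (b ^+ 2 * (2 * N * S1)) by field; rewrite gt_eqF.
apply: ler_wpM2l; first by rewrite invr_ge0 exprn_ge0// ltW.
by apply: ler_wpM2l => //; exact: sqr_ge0.
Qed.

Lemma integral_walk_mean (a : R) n : (\int[mu]_z (Y z)%:E = a%:E)%E ->
  (\int[mu]_z (walk_mean Y n z)%:E = a%:E)%E.
Proof.
move=> aE; have N0 : 0 < n.+1%:R :> R by rewrite ltr0n.
have -> : (\int[mu]_z (walk_mean Y n z)%:E =
    \int[mu]_z ((n.+1%:R^-1)%:E * \sum_(i < n.+1) (Y (joint_shift i z))%:E))%E.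
  by apply: eq_integral => z _; rewrite sumEFin -EFinM.
have mS : measurable_fun setT (fun z => \sum_(i < n.+1) (Y (joint_shift i z))%:E : \bar R)%E.
  by apply: emeasurable_sum => i.
rewrite (ge0_integralZl mu measurableT mS); last 2 first.
- by move=> z _; apply: sume_ge0 => i _; rewrite lee_fin.
- by rewrite lee_fin invr_ge0 ltW.
rewrite (ge0_integral_sum mu measurableT (f := fun (i : 'I_n.+1) z => (Y (joint_shift i z))%:E)) => [|//|]; last first.
  by move=> i z _; rewrite lee_fin.
rewrite (eq_bigr (fun=> a%:E)) => [|i _]; last first.
  rewrite -aE (@joint_stationary _ _ _ _ _ _ _ adj_sym bounded conn trans deg_gt0 srwP bernP i (fun z => (Y z)%:E))//.
  - exact/measurable_EFinP.
  - by move=> f fA w omega; rewrite joint_invariant_new_sites_local.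
by rewrite sumEFin sumr_const card_ord -EFinM -(mulr_natl a) mulrA mulVf ?mul1r// gt_eqF.
Qed.

Lemma mean_variance_le (a : R) n : (\int[mu]_z (Y z)%:E = a%:E)%E ->
  (\int[mu]_z ((walk_mean Y n z - a) ^+ 2)%:E <=
    (2 * b ^+ 2 * (n.+1%:R^-1 * \sum_(m < n.+1) c m))%:E)%E.
Proof.
move=> aE; set v := 2 * b ^+ 2 * _.
have a0 : 0 <= a by rewrite -lee_fin -aE; apply: integral_ge0 => z _; rewrite lee_fin.
have mM := measurable_walk_mean n mY.
have M0 z : 0 <= walk_mean Y n z by apply: mulr_ge0; rewrite ?invr_ge0// sumr_ge0.
have m1 : measurable_fun setT (fun z => ((walk_mean Y n z - a) ^+ 2)%:E : \bar R).
  by apply/measurable_EFinP; apply: measurable_funX; apply: measurable_funB.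
have m2 : measurable_fun setT (fun z => (2 * a * walk_mean Y n z)%:E : \bar R).
  by apply/measurable_EFinP; apply: measurable_funM.
have m3 : measurable_fun setT (fun z => (walk_mean Y n z ^+ 2)%:E : \bar R).
  by apply/measurable_EFinP; apply: measurable_funX.
(* The expanded square is rearranged so that all integrands are nonnegative. *)
have E1 : (\int[mu]_z (((walk_mean Y n z - a) ^+ 2)%:E + (2 * a * walk_mean Y n z)%:E) =
  \int[mu]_z ((walk_mean Y n z ^+ 2)%:E + (a ^+ 2)%:E))%E.
  by apply: eq_integral => z _; rewrite -!EFinD; congr EFin; ring.
have s1 z : (0 <= ((walk_mean Y n z - a) ^+ 2)%:E :> \bar R)%E by rewrite lee_fin sqr_ge0.
have s2 z : (0 <= (2 * a * walk_mean Y n z)%:E :> \bar R)%E by rewrite lee_fin; apply: mulr_ge0 => //; exact: mulr_ge0.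
have s3 z : (0 <= (walk_mean Y n z ^+ 2)%:E :> \bar R)%E by rewrite lee_fin sqr_ge0.
have m4 : measurable_fun setT (fun _ : T => (a ^+ 2)%:E : \bar R) by exact: measurable_cst.
have s4 : (0 <= (a ^+ 2)%:E :> \bar R)%E by rewrite lee_fin sqr_ge0.
rewrite (ge0_integralD mu measurableT (fun z _ => s1 z) m1 (fun z _ => s2 z) m2) in E1.
rewrite (ge0_integralD mu measurableT (fun z _ => s3 z) m3 (fun z _ => s4) m4) in E1.
have E2 : (\int[mu]_z (2 * a * walk_mean Y n z)%:E = (2 * a * a)%:E)%E.
  under eq_integral do rewrite EFinM.
  have mME : measurable_fun setT (fun z => (walk_mean Y n z)%:E : \bar R) by exact/measurable_EFinP.
  rewrite (ge0_integralZl mu measurableT mME); last 2 first.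
  - by move=> z _; rewrite lee_fin.
  - by rewrite lee_fin mulr_ge0.
  by rewrite (integral_walk_mean n aE) -EFinM.
have E3 : (\int[mu]_z (a ^+ 2)%:E = (a ^+ 2)%:E)%E.
  by rewrite -[LHS]/(\int[mu]_z cst (a ^+ 2)%:E z)%E integral_cst//= probability_setT mule1.
rewrite E2 E3 in E1.
rewrite -(@leeD2rE _ (2 * a * a)%:E)// E1.
have -> : (v%:E + (2 * a * a)%:E = (a ^+ 2 + v)%:E + (a ^+ 2)%:E)%E.
  by rewrite -!EFinD; congr EFin; ring.
by apply: leeD => //; exact: mean_second_moment_le.
Qed.

Lemma mean_L1_small (a eps : R) : 0 < eps -> (\int[mu]_z (Y z)%:E = a%:E)%E ->
  exists n, (\int[mu]_z `|walk_mean Y n z - a|%:E <= eps%:E)%E.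
Proof.
move=> e0 aE; pose v n := 2 * b ^+ 2 * (n.+1%:R^-1 * \sum_(m < n.+1) c m).
have cv : v n @[n --> \oo] --> 0.
  rewrite -(mulr0 (2 * b ^+ 2)); apply: cvgM; first exact: cvg_cst.
  apply: cvg_mean; exact: (meeting_bound_cvg0 adj_sym bounded conn Vinf trans deg_gt0).
move/cvgrPdist_le : cv => /(_ (eps ^+ 2 / 4)); rewrite divr_gt0 ?exprn_gt0// => /(_ isT)[n _ /(_ n (leqnn n))].
rewrite /= sub0r normrN => /(le_trans (ler_norm _)) vn; exists n.
have mM := measurable_walk_mean n mY.
have m1 : measurable_fun setT (fun z => ((walk_mean Y n z - a) ^+ 2)%:E : \bar R).
  by apply/measurable_EFinP; apply: measurable_funX; apply: measurable_funB.
have m2 : measurable_fun setT (fun z => (2 / eps)%:E * ((walk_mean Y n z - a) ^+ 2)%:E : \bar R)%E.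
  exact: emeasurable_funM.
(* Pointwise |y| <= eps / 2 + (2 / eps) y^2, and a variance at most eps^2 / 4 makes the last term at
   most eps / 2 in mean. *)
apply: (@le_trans _ _ (\int[mu]_z ((eps / 2)%:E + (2 / eps)%:E * ((walk_mean Y n z - a) ^+ 2)%:E))%E).
  apply: ge0_le_integral => //.
  - by apply/measurable_EFinP; apply: measurableT_comp => //; apply: measurable_funB.
  - exact: emeasurable_funD.
  move=> z _; rewrite -EFinM -EFinD lee_fin.
  move: (walk_mean Y n z - a) => y; rewrite -(real_normK (num_real y)).
  have x0 := normr_ge0 y; move: `|y| x0 => x x0.
  have : 0 <= (x - eps / 2) ^+ 2 by exact: sqr_ge0.
  have -> : (x - eps / 2) ^+ 2 = x ^+ 2 - eps * x + eps ^+ 2 / 4 by field.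
  move=> h; rewrite -(ler_pM2l e0) mulrDr.
  have -> : eps * (2 / eps * x ^+ 2) = 2 * x ^+ 2 by field; rewrite gt_eqF.
  have := sqr_ge0 x; have -> : eps * (eps / 2) = eps ^+ 2 / 2 by field.
  have := sqr_ge0 eps; lra.
have e2 : (0 <= (2 / eps)%:E :> \bar R)%E by rewrite lee_fin divr_ge0// ltW.
have e3 : (0 <= (eps / 2)%:E :> \bar R)%E by rewrite lee_fin divr_ge0// ltW.
have sq0 z : (0 <= ((walk_mean Y n z - a) ^+ 2)%:E :> \bar R)%E by rewrite lee_fin sqr_ge0.
rewrite ge0_integralD//; last by move=> z _; exact: mule_ge0.
rewrite (ge0_integralZl mu measurableT m1 _ e2)//.
rewrite -[X in (X + _)%E]/(\int[mu]_z cst (eps / 2)%:E z)%E integral_cst//= probability_setT mule1.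
apply: (@le_trans _ _ ((eps / 2)%:E + (2 / eps)%:E * (eps ^+ 2 / 4)%:E)%E).
  apply: leeD => //; apply: lee_wpmul2l => //.
  by apply: le_trans (mean_variance_le n aE) _; rewrite lee_fin.
rewrite -EFinM -EFinD lee_fin le_eqVlt; apply/orP; left; apply/eqP.
by field; rewrite gt_eqF.
Qed.

End Local.

(* The maximal inequality is applied to [D], whose mean is small: it bounds both the error of the
   local approximation and the distance from a long average of it to its expectation. *)
Lemma ergodic_new_sites (a : R) : (\int[mu]_z (new_sites_real R J z)%:E = a%:E)%E ->
  {ae mu, forall z, walk_mean (new_sites_real R J) n z @[n --> \oo] --> a}.
Proof.
move=> aE; apply: ae_cvg_small_sets => lambda eps l0 e0.
pose Y := @new_sites_real R V adj J; pose Yr r := @new_sites_local R V adj J r.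
have mY : measurable_fun setT Y by exact: (measurable_new_sites_real o adj_sym bounded conn).
have mYr r : measurable_fun setT (Yr r) by exact: (measurable_new_sites_local o adj_sym bounded conn).
(* The first bound controls the distance between the means [ar] and [a]; the second gives 2 eta <=
   (lambda / 4) eps, so the maximal inequality at level lambda / 4 yields a set of measure at most
   eps. *)
pose eta := Num.min (lambda / 4) (lambda * eps / 8).
have eta0 : 0 < eta by rewrite lt_min !divr_gt0 ?mulr_gt0.
have eta1 : eta <= lambda / 4 by rewrite ge_min lexx.
have eta2 : eta <= lambda * eps / 8 by rewrite ge_min lexx orbT.
have [r [ar [arE YYr ara]]] : exists r ar, [/\ (\int[mu]_z (Yr r z)%:E = ar%:E)%E,
    (\int[mu]_z `|Yr r z - Y z|%:E <= eta%:E)%E & `|ar - a| <= eta].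
  have [/fine_cvgP[fin1 cv1]] := new_sites_local_approx o Po adj_sym bounded conn le_chi J.
  rewrite aE => /fine_cvgP[fin2 cv2].
  move/cvgrPdist_le : cv1 => /(_ _ eta0) cv1; move/cvgrPdist_le : cv2 => /(_ _ eta0) cv2.
  near \oo => r; exists r, (fine (\int[mu]_z (Yr r z)%:E)%E); split.
  - by rewrite fineK//; near: r.
  - have f1 : (\int[mu]_z `|Yr r z - Y z|%:E \is a fin_num)%E by near: r.
    rewrite -(fineK f1) lee_fin; apply: le_trans (ler_norm _) _.
    by rewrite -normrN -[- _]sub0r; near: r.
  - by rewrite distrC; near: r.
have [k kE] := mean_L1_small eta0 arE.
pose D z := `|Yr r z - Y z| + `|walk_mean (Yr r) k z - ar|.
have mM : measurable_fun setT (walk_mean (Yr r) k) by exact: measurable_walk_mean.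
have mD1 : measurable_fun setT (fun z => `|Yr r z - Y z|).
  by apply: measurableT_comp => //; exact: measurable_funB.
have mD2 : measurable_fun setT (fun z => `|walk_mean (Yr r) k z - ar|).
  by apply: measurableT_comp => //; exact: measurable_funB.
have mD : measurable_fun setT D by exact: measurable_funD.
have D0 z : 0 <= D z by exact: addr_ge0.
have DI : joint_invariant adj_sym D.
  move=> f fA w omega; rewrite /D joint_invariant_walk_mean; last exact: joint_invariant_new_sites_local.
  by rewrite /Yr /Y joint_invariant_new_sites_local// joint_invariant_new_sites_real.
have DE : (\int[mu]_z (D z)%:E <= (eta + eta)%:E)%E.
  rewrite EFinD; under eq_integral do rewrite EFinD.
  have mD1E : measurable_fun setT (fun z => `|Yr r z - Y z|%:E : \bar R) by exact/measurable_EFinP.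
  have mD2E : measurable_fun setT (fun z => `|walk_mean (Yr r) k z - ar|%:E : \bar R) by exact/measurable_EFinP.
  rewrite (ge0_integralD mu measurableT _ mD1E _ mD2E); [exact: leeD| |] => z _; by rewrite lee_fin.
have l4 : 0 < lambda / 4 by rewrite divr_gt0.
have [mE Ele] := @walk_maximal_inequality R V adj o p Po Pp adj_sym bounded conn trans deg_gt0 srwP bernP
  D (lambda / 4) mD D0 DI l4.
set E := [set z | _] in mE Ele; exists E; split => //.
  have {}Ele : (( lambda / 4)%:E * mu E <= (lambda / 4 * eps)%:E)%E.
    apply: le_trans Ele _; apply: le_trans DE _; rewrite lee_fin.
    by have := eta2; lra.
  by move: Ele; rewrite [X in (_ <= X)%E -> _](EFinM (lambda / 4) eps); rewrite lee_pmul2l// lte_fin.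
move=> z nE; set B := ball_size R adj o r.
have bB j : 0 <= Yr r (joint_shift j z) <= B.
  by rewrite new_sites_local_ge0 /B /Yr new_sites_local_le_ball_size.
have sumD n : \sum_(j < n.+1) D (joint_shift j z) <= lambda / 4 * n.+1%:R.
  by rewrite leNgt; apply/negP => h; apply: nE; exists n.
exists (Num.truncn (4 * B * k.+1%:R / lambda)).+1 => // n /= nbig.
have n0 : 0 < n.+1%:R :> R by rewrite ltr0n.
have nB : B * k.+1%:R <= lambda / 4 * n.+1%:R.
  have : 4 * B * k.+1%:R / lambda <= n.+1%:R.
    apply: ltW; apply: lt_le_trans (truncnS_gt _) _; rewrite ler_nat.
    exact: leq_trans nbig (leqnSn _).
  by rewrite ler_pdivrMr//; lra.
have dl := mean_delay_le n.+1 k bB.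
rewrite -(ler_pM2r n0) -{1}(ger0_norm (ltW n0)) -normrM.
(* Four errors: local approximation, passage to running means, distance of these means to [ar], and
   [ar] against [a]. Outside [E] the first and third together cost lambda / 4 per term; the second
   and the fourth cost at most lambda / 4 each. *)
have -> : (walk_mean (new_sites_real R J) n z - a) * n.+1%:R =
    - \sum_(j < n.+1) (Yr r (joint_shift j z) - Y (joint_shift j z)) +
    (\sum_(j < n.+1) Yr r (joint_shift j z) -
     \sum_(j < n.+1) (k.+1%:R^-1 * \sum_(i < k.+1) Yr r (joint_shift (j + i) z))) +
    \sum_(j < n.+1) (walk_mean (Yr r) k (joint_shift j z) - ar) + n.+1%:R * (ar - a).
  rewrite !sumrB sumr_const card_ord -(mulr_natl ar) /walk_mean.
  have -> : \sum_(j < n.+1) (k.+1%:R^-1 * \sum_(i < k.+1) Yr r (joint_shift i (joint_shift j z))) =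
    \sum_(j < n.+1) (k.+1%:R^-1 * \sum_(i < k.+1) Yr r (joint_shift (j + i) z)).
    by apply: eq_bigr => j _; congr (_ * _); apply: eq_bigr => i _; rewrite joint_shiftD.
  rewrite mulrBl mulrAC mulVf ?mul1r ?gt_eqF// -/Y; ring.
have h1 : `|\sum_(j < n.+1) (Yr r (joint_shift j z) - Y (joint_shift j z))| +
    `|\sum_(j < n.+1) (walk_mean (Yr r) k (joint_shift j z) - ar)| <= lambda / 4 * n.+1%:R.
  apply: le_trans (sumD n); rewrite /D [leRHS]big_split/=.
  by apply: lerD; exact: ler_norm_sum.
have h2 : `|n.+1%:R * (ar - a)| <= lambda / 4 * n.+1%:R.
  rewrite normrM (ger0_norm (ltW n0)) mulrC; apply: ler_wpM2r; first exact: ltW.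
  exact: le_trans ara eta1.
apply: le_trans (ler_normD _ _) _; apply: le_trans (lerD (ler_normD _ _) h2) _.
have h3 := lerD (ler_normD (- \sum_(j < n.+1) (Yr r (joint_shift j z) - Y (joint_shift j z)))
  (\sum_(j < n.+1) Yr r (joint_shift j z) -
     \sum_(j < n.+1) (k.+1%:R^-1 * \sum_(i < k.+1) Yr r (joint_shift (j + i) z)))) (lexx
  `|\sum_(j < n.+1) (walk_mean (Yr r) k (joint_shift j z) - ar)|).
rewrite normrN in h3.
have h4 : 0 <= lambda * n.+1%:R by rewrite mulr_ge0 ?ltW.
lra.
Unshelve. all: by end_near.
Qed.

End Ergodic.


Lemma counting_setU (R : realType) (V : choiceType) (A B : set V) : A `&` B = set0 ->
  counting (A `|` B) = (counting A + counting B)%E :> \bar R.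
Proof.
move=> AB.
have cinf (C : set V) : ~ finite_set C -> counting C = +oo%E :> \bar R.
  by move=> infC; rewrite /counting asboolF.
have [finA|infA] := pselect (finite_set A); last first.
  rewrite (cinf A)// (cinf (A `|` B)); last by rewrite finite_setU => -[].
  by rewrite addye// gt_eqF// (lt_le_trans _ (counting_ge0 R B))// ltNy0.
have [finB|infB] := pselect (finite_set B); last first.
  rewrite (cinf B)// (cinf (A `|` B)); last by rewrite finite_setU => -[].
  by rewrite addey// gt_eqF// (lt_le_trans _ (counting_ge0 R A))// ltNy0.
have finAB : finite_set (A `|` B) by rewrite finite_setU.
rewrite /counting !asboolT// -EFinD -natrD fset_setU// cardfsU.
suff -> : (fset_set A `&` fset_set B)%fset = fset0 by rewrite cardfs0 subn0.
apply/fsetP => y; rewrite in_fsetI !in_fset_set// inE; apply/negbTE/negP => /andP[/set_mem yA /set_mem yB].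
by have : (A `&` B) y by []; rewrite AB.
Qed.

(** * The number of visited sites *)

Section Range.
Variables (R : realType) (V : pointedType) (adj : rel V) (o : V).
Hypotheses (adj_sym : symmetric adj) (bounded : bounded_degrees adj) (conn : connected_graph adj).
Local Notation T := (walk_space V * config adj)%type.
Implicit Types z : T.
Local Notation Y := (@new_sites_real R V adj).

Definition upto m : pred nat := fun j => (0 < j <= m)%N.
Definition ever : pred nat := fun j => (0 < j)%N.

Lemma cluster_sym (omega : config adj) x y : cluster omega x y -> cluster omega y x.
Proof. by apply: reachable_sym; exact: open_adj_sym. Qed.

(** The starting point is removed: its cluster is new exactly when the walk does not return to it by
    time n + 1. Iterating this counts each cluster at its last visit. *)
Lemma U_succ n z : U R n.+1 z = (U R n (joint_shift 1 z) + new_sites R (upto n.+1) z)%E.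
Proof.
set A := cluster z.2 (z.1 0%N).
set B := \bigcup_(x in (joint_shift 1 z).1 @` `I_n.+1) cluster z.2 x.
have -> : U R n.+1 z = counting (A `|` B).
  rewrite /U; congr counting; apply/seteqP; split=> y /=.
    move=> [_ [i /= ni <-] yi]; case: i ni yi => [|i] ni yi; [by left|right].
    by exists (z.1 i.+1) => //; exists i.
  move=> [yA|[_ [i /= ni <-] yi]]; first by exists (z.1 0%N) => //; exists 0%N.
  by exists (z.1 i.+1) => //; exists i.+1.
rewrite -[U R n (joint_shift 1 z)]/(counting B) /new_sites -/A.
have [nr|nr] := boolP (no_return (upto n.+1) z).
  rewrite mule1 counting_setU 1?addeC//; apply/seteqP; split=> // y [yA [_ [i /= ni <-] yi]].
  move/asboolP : nr => /(_ i.+1 ni); apply.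
  by apply: reachable_trans yA _; exact: cluster_sym.
rewrite mule0 adde0; congr counting; apply/setUidPr => y yA.
have [j Jj xj] : exists2 j, upto n.+1 j & A (z.1 j).
  apply: contrapT => h; move/asboolP : nr; apply => j Jj xj; apply: h; by exists j.
exists (z.1 j); last by apply: reachable_trans yA; exact: cluster_sym.
by case: j Jj {xj} => // j Jj; exists j.
Qed.

Lemma U0 z : U R 0 z = new_sites R pred0 z.
Proof.
rewrite new_sites_pred0 /U; congr counting; apply/seteqP; split=> y /=.
  by move=> [_ [i /= + <-]]; case: i.
by move=> yA; exists (z.1 0%N) => //; exists 0%N.
Qed.

Lemma measurable_U n : measurable_fun setT (U R n : T -> \bar R).
Proof.
elim: n => [|n IH].
  have -> : (U R 0 : T -> \bar R) = new_sites R pred0 by apply/funext => z; rewrite U0.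
  exact: (measurable_new_sites o adj_sym bounded conn).
have -> : (U R n.+1 : T -> \bar R) = (fun z => U R n (joint_shift 1 z) + new_sites R (upto n.+1) z)%E.
  by apply/funext => z; rewrite U_succ.
apply: emeasurable_funD; first exact: (measurableT_comp IH (measurable_joint_shift 1)).
exact: (measurable_new_sites o adj_sym bounded conn).
Qed.

Fixpoint U_real n z : R :=
  if n is n'.+1 then U_real n' (joint_shift 1 z) + Y (upto n) z else Y pred0 z.

Lemma U_realE n z : good z -> U R n z = (U_real n z)%:E.
Proof.
elim: n z => [|n IH] z gz; first by rewrite U0 new_sites_fine.
by rewrite U_succ IH// new_sites_fine.
Qed.

Lemma sum_shiftS (F : T -> R) n z :
  \sum_(i < n.+1) F (joint_shift i z) = F z + \sum_(i < n) F (joint_shift i (joint_shift 1 z)).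
Proof.
rewrite big_ord_recl; congr (F _ + _); first by case: z.
Qed.

Lemma le_U_real n z : good z -> \sum_(i < n.+1) Y ever (joint_shift i z) <= U_real n z.
Proof.
elim: n z => [|n IH] z gz.
  rewrite sum_shiftS big_ord0 addr0; exact: new_sites_real_le.
rewrite sum_shiftS addrC /=; apply: lerD; first exact: IH.
by apply: new_sites_real_le => // j /andP[].
Qed.

(** A time with at least m steps left forbids returns during m steps; each of the last m times is
    bounded by its whole cluster. These boundary terms are written as a difference of two sums so
    that both become means along the walk. If m > n, truncated subtraction makes the subtracted sum
    empty. *)
Lemma U_real_le m n z : good z -> U_real n z <=
  \sum_(i < n.+1) Y (upto m) (joint_shift i z) + \sum_(i < n.+1) Y pred0 (joint_shift i z)
  - \sum_(i < n.+1 - m) Y pred0 (joint_shift i z).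
Proof.
have Y_ge0 J (z' : T) : 0 <= Y J z' by exact: new_sites_real_ge0.
elim: n z => [|n IH] z gz.
  rewrite !sum_shiftS !big_ord0 !addr0; case: m => [|m] /=.
    rewrite sum_shiftS big_ord0 addr0 addrK; apply: new_sites_real_le => // j.
    by rewrite /upto; case: j.
  by rewrite big_ord0 subr0 lerDr.
have := IH (joint_shift 1 z) gz; rewrite !(sum_shiftS _ n.+1 z) /=.
have [mn|nm] := leqP m n.+1.
  have -> : (n.+2 - m = (n.+1 - m).+1)%N by rewrite subSn.
  rewrite (sum_shiftS (Y pred0) (n.+1 - m) z).
  have : Y (upto n.+1) z <= Y (upto m) z.
    by apply: new_sites_real_le => // j /andP[j0 jm]; rewrite /upto j0 (leq_trans jm).
  lra.
have -> : (n.+2 - m = 0)%N by apply/eqP; rewrite subn_eq0.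
have -> : (n.+1 - m = 0)%N by apply/eqP; rewrite subn_eq0 ltnW.
rewrite !big_ord0.
have : Y (upto n.+1) z <= Y pred0 z by exact: new_sites_real_le.
have := Y_ge0 (upto m) z; lra.
Qed.

Lemma U_real_cvg (c : R) (cm : nat -> R) z : good z ->
  walk_mean (Y ever) n z @[n --> \oo] --> c ->
  (forall m, walk_mean (Y (upto m)) n z @[n --> \oo] --> cm m) ->
  cm m @[m --> \oo] --> c ->
  (U_real n z * n%:R^-1) @[n --> \oo] --> c.
Proof.
move=> gz cve cvm cmc.
have inv0 : ((n.+1%:R : R)^-1) @[n --> \oo] --> 0 by exact: cvg_harmonic.
have invm0 m : (((n + m).+1%:R : R)^-1) @[n --> \oo] --> 0.
  by rewrite -(cvg_shiftn m) in inv0.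
have Y0E : Y pred0 = Y (upto 0).
  apply/funext => z'; rewrite /new_sites_real /new_sites /no_return; congr (fine (_ * (nat_of_bool `[< _ >])%:R%:E)%E).
  by apply/propext; split=> h j; [case: j|].
have cv0 : walk_mean (Y pred0) n z @[n --> \oo] --> cm 0%N by rewrite Y0E; exact: cvm.
have mean : (n.+1%:R^-1 * U_real n z) @[n --> \oo] --> c.
  apply/cvgrPdist_le => e e0.
  have e2 : 0 < e / 2 by rewrite divr_gt0.
  move/cvgrPdist_le : cmc => /(_ _ e2)[m _ /(_ m (leqnn m))/= mE].
  (* This is [U_real_le] at time n + m divided by n + m + 1, the subtracted sum being (1 - m / (n +
     m + 1)) times the mean at n. The two means of [Y pred0] have the same limit and cancel. *)
  pose up n := walk_mean (Y (upto m)) (n + m)%N z + (walk_mean (Y pred0) (n + m)%N z -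
    walk_mean (Y pred0) n z + m%:R * (n + m).+1%:R^-1 * walk_mean (Y pred0) n z).
  have cvup : up n @[n --> \oo] --> cm m + (cm 0%N - cm 0%N + m%:R * 0 * cm 0%N).
    apply: cvgD; first by have := cvm m; rewrite -(cvg_shiftn m).
    apply: cvgD; first by apply: cvgB => //; move: cv0; rewrite -(cvg_shiftn m).
    by apply: cvgM => //; apply: cvgM; [exact: cvg_cst|exact: invm0].
  rewrite subrr mulr0 mul0r !addr0 in cvup.
  have upE n : (n + m).+1%:R^-1 * U_real (n + m) z <= up n.
    have N0 : 0 < (n + m).+1%:R :> R by rewrite ltr0n.
    have n0 : 0 < n.+1%:R :> R by rewrite ltr0n.
    rewrite ler_pdivrMl//; apply: le_trans (U_real_le m (n + m) gz) _.
    have -> : ((n + m).+1 - m = n.+1)%N by rewrite -addSn addnK.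
    rewrite /up /walk_mean le_eqVlt; apply/orP; left; apply/eqP.
    set S1 := \sum_(i < _) _; set S2 := \sum_(i < _) _; set S3 := \sum_(i < _) _.
    have -> : (m%:R : R) = (n + m).+1%:R - n.+1%:R by rewrite -addSn natrD addrAC subrr add0r.
    by field; rewrite !gt_eqF.
  move/cvgrPdist_le : cvup => /(_ _ e2)[n1 _ h1]; move/cvgrPdist_le : cve => /(_ _ e0)[n2 _ h2].
  exists (maxn (n1 + m) n2) => // n; rewrite /= geq_max => /andP[n1n n2n].
  rewrite ler_norml; apply/andP; split.
    have nm : (m <= n)%N by apply: leq_trans n1n; exact: leq_addl.
    have := upE (n - m)%N; rewrite subnK// => h.
    have : `|cm m - up (n - m)%N| <= e / 2 by apply: h1 => /=; lia.
    rewrite ler_norml => /andP[h3 h4]; move: mE; rewrite ler_norml => /andP[h5 h6].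
    move: (_ * U_real n z) (up _) h h3 => a u h h3; lra.
  have := h2 n n2n; rewrite ler_norml => /andP[h3 h4].
  have : walk_mean (Y ever) n z <= n.+1%:R^-1 * U_real n z.
    by apply: ler_wpM2l; [rewrite invr_ge0|exact: le_U_real].
  move: (_ * U_real n z) (walk_mean _ n z) h3 h4 => a u h3 h4 ua; lra.
have cvn : (n%:R^-1 : R) @[n --> \oo] --> 0 by rewrite -cvg_shiftS.
(* The normalisation is by n: for n >= 1, 1 / n = (1 / (n + 1)) (1 + 1 / n). *)
have : ((n.+1%:R^-1 * U_real n z) * (1 + n%:R^-1)) @[n --> \oo] --> c * (1 + 0).
  by apply: cvgM => //; apply: cvgD => //; exact: cvg_cst.
rewrite addr0 mulr1; apply: cvg_trans; apply: near_eq_cvg.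
exists 1%N => // n /= n1.
have h1 : (n%:R : R) != 0 by rewrite pnatr_eq0 -lt0n.
have h2 : (n%:R + 1 : R) != 0 by rewrite natr1 pnatr_eq0.
by rewrite -natr1; field; rewrite h1 h2.
Qed.

End Range.


Section RealBounds.
Variable R : realType.

(** Jensen's inequality, by the tangent line of the exponential at the mean. *)
Lemma expR_mean_le (a : nat -> R) (t : R) n :
  expR (t * (n.+1%:R^-1 * \sum_(i < n.+1) a i)) <= n.+1%:R^-1 * \sum_(i < n.+1) expR (t * a i).
Proof.
set m := _ * \sum_(i < n.+1) a i; have n0 : 0 < n.+1%:R :> R by rewrite ltr0n.
rewrite -ler_pdivrMl ?invr_gt0// invrK.
have mE : \sum_(i < n.+1) a i = n.+1%:R * m by rewrite /m mulrA divff ?mul1r// gt_eqF.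
apply: (@le_trans _ _ (\sum_(i < n.+1) expR (t * m) * (1 + (t * a i - t * m)))).
  rewrite -mulr_sumr big_split sumrB/= -mulr_sumr mE !sumr_const card_ord.
  rewrite -(mulr_natl (t * m)) [X in _ <= _ * (_ + X)](_ : _ = 0); last by ring.
  by rewrite addr0 mulrC.
apply: ler_sum => i _; rewrite [X in _ <= expR X](_ : _ = t * m + (t * a i - t * m)); last by ring.
by rewrite expRD ler_wpM2l ?expR_ge0// expR_ge1Dx.
Qed.

(** From v <= exp v at v = s u / kappa with u = |x - c|, raised to the power kappa; then u <= x +
    |c|. *)
Lemma powR_dist_le_expR (s c kappa : R) : 0 < s -> 0 < kappa ->
  exists2 K, 0 <= K & forall x, 0 <= x -> `|x - c| `^ kappa <= K * expR (s * x).
Proof.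
move=> s0 k0; exists ((kappa / s) `^ kappa * expR (s * `|c|)).
  by rewrite mulr_ge0 ?powR_ge0 ?expR_ge0.
move=> x x0; set u := `|x - c|; have u0 : 0 <= u by exact: normr_ge0.
have ux : u <= x + `|c| by rewrite -[x in leRHS]ger0_norm// ler_normB.
have h : u <= kappa / s * expR (s * u / kappa).
  have := expR_ge1Dx (s * u / kappa); move=> h1.
  have : s * u / kappa <= expR (s * u / kappa) by lra.
  move=> h2; have : kappa / s * (s * u / kappa) <= kappa / s * expR (s * u / kappa).
    by apply: ler_wpM2l => //; rewrite divr_ge0// ltW.
  by rewrite (_ : kappa / s * (s * u / kappa) = u)//; field; rewrite !gt_eqF.
apply: (@le_trans _ _ ((kappa / s * expR (s * u / kappa)) `^ kappa)).
  apply: ge0_ler_powR; rewrite ?nnegrE//; first exact: ltW.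
  by apply: mulr_ge0; [rewrite divr_ge0 ?ltW|exact: expR_ge0].
rewrite powRM ?expR_ge0 ?(divr_ge0 (ltW k0) (ltW s0))// -expRM divfK ?gt_eqF// -mulrA -expRD.
apply: ler_wpM2l; first exact: powR_ge0.
by rewrite ler_expR -mulrDr; apply: ler_wpM2l; [exact: ltW|rewrite addrC].
Qed.

End RealBounds.

(** * Almost sure convergence and identification of the limit *)

Section Convergence.
Variables (R : realType) (V : pointedType) (adj : rel V) (o : V).
Variables (p : R) (Po : probability (walk_space V) R) (Pp : probability (config adj) R).
Hypotheses (adj_sym : symmetric adj) (bounded : bounded_degrees adj) (conn : connected_graph adj).
Hypotheses (Vinf : infinite_set [set: V]).
Hypotheses (trans : vertex_transitive adj) (deg_gt0 : (0 < degree adj o)%N).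
Hypotheses (srwP : is_srw_law adj o Po) (p01 : 0 <= p <= 1) (bernP : is_bernoulli_percolation p Pp).
Variable chi : R.
Hypothesis le_chi : forall x, (\int[Pp]_omega counting (cluster omega x) <= chi%:E)%E.
Local Notation T := (walk_space V * config adj)%type.
Local Notation mu := (Po \x Pp)%E.
Local Notation Y := (@new_sites_real R V adj).

Definition speed : R := fine (\int[mu]_z (Y ever z)%:E).

Lemma integral_new_sites_realE J :
  (\int[mu]_z (Y J z)%:E = (fine (\int[mu]_z (Y J z)%:E))%:E)%E.
Proof.
rewrite fineK// ge0_fin_numE; last by apply: integral_ge0 => z _; rewrite lee_fin new_sites_real_ge0.
rewrite (integral_new_sites_real o Po adj_sym bounded conn le_chi).
exact: le_lt_trans (integral_new_sites_le o Po adj_sym bounded conn le_chi J) (ltry _).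
Qed.

Lemma new_sites_upto_cvg z : good z -> Y (upto m) z @[m --> \oo] --> Y ever z.
Proof.
move=> gz; apply: cvg_near_cst.
suff [m0 h] : exists m0, forall m, (m0 <= m)%N -> no_return (upto m) z = no_return ever z.
  by exists m0 => // m /= /h; rewrite /new_sites_real /new_sites => ->.
have [nr|nr] := boolP (no_return ever z).
  by exists 0%N => m _; apply: (no_return_anti _ nr) => j /andP[].
have [j Jj xj] : exists2 j, ever j & cluster z.2 (z.1 0%N) (z.1 j).
  apply: contrapT => h2; move/asboolP : nr; apply => j Jj xj; apply: h2; by exists j.
exists j => m jm; apply/negbTE/asboolP => /(_ j); apply => //.
by rewrite /upto jm andbT.
Qed.

Lemma speed_upto_cvg : fine (\int[mu]_z (Y (upto m) z)%:E) @[m --> \oo] --> speed.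
Proof.
have := new_sites_real_cvg (Po := Po) o adj_sym bounded conn le_chi new_sites_upto_cvg.
rewrite [X in _ --> X]integral_new_sites_realE => h.
by have /fine_cvgP[] := h.
Qed.

Lemma ae_U_real_cvg : {ae mu, forall z, (U_real R n z * n%:R^-1) @[n --> \oo] --> speed}.
Proof.
have gd := ae_good o Po adj_sym bounded conn le_chi.
have erg J := ergodic_new_sites adj_sym bounded conn Vinf trans deg_gt0 srwP p01 bernP le_chi
  (integral_new_sites_realE J).
have := ae_foralln (fun m => erg (upto m)).
move: (erg ever) gd; apply: filterS3 => z cve gz cvm.
exact: U_real_cvg gz cve cvm speed_upto_cvg.
Qed.

Lemma ae_U_cvg : {ae mu, forall z, (U R n z * (n%:R^-1)%:E)%E @[n --> \oo] --> speed%:E}.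
Proof.
apply: filterS2 (ae_good o Po adj_sym bounded conn le_chi) ae_U_real_cvg => z gz h.
under eq_fun do rewrite U_realE// -EFinM.
by apply/cvg_EFin; [exact: nearW|exact: h].
Qed.

(** Fubini with the walk integrated first, for a fixed configuration. Almost surely the walk starts
    at [o], and an infinite hitting time means no return at any positive time. *)
Lemma c_pE : c_p o Po Pp = speed%:E.
Proof.
have m1 := measurable_new_sites o adj_sym bounded conn (R := R) ever.
have g0 (z : T) : (0 <= new_sites R ever z)%E by exact: new_sites_ge0.
rewrite -integral_new_sites_realE (integral_new_sites_real o Po adj_sym bounded conn le_chi).
rewrite (fubini_tonelli2 _ m1 g0) /c_p; apply: eq_integral => omega _; rewrite /fubini_G.
pose A := cluster omega o; pose H := [set w : walk_space V | forall j, ever j -> ~ A (w j)].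
have HE : [set w | hitting_time R A w = +oo%E] = H.
  apply/seteqP; split=> w /=; rewrite /hitting_time.
    move=> /ereal_inf_pinfty h j j0 wj.
    by have : (j%:R%:E = +oo :> \bar R)%E by apply: h; exists j.
  move=> h; apply/ereal_inf_pinfty => _ [j [j1 wj] <-]; exfalso; exact: (h j j1 wj).
have mH : measurable H.
  have -> : H = \bigcap_(j in [set j | ever j]) ~` [set w : walk_space V | A (w j)].
    by apply/seteqP; split=> w h j; exact: h.
  apply: bigcap_measurableType => j _; apply: measurableC.
  have -> : [set w : walk_space V | A (w j)] = \bigcup_(v in A) [set w | w j = v].
    by apply/seteqP; split=> w /=; [exists (w j)|move=> [v ? ->]].
  rewrite bigcup_mkcond; apply: countable_bigcupT_measurable => [|v].
    exact: countable_vertices bounded o conn.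
  by case: ifP => _ //; exact: measurable_walk_at.
rewrite -/A HE; have mi : measurable_fun setT (fun w : walk_space V => (\1_H w)%:E : \bar R).
  by apply/measurable_EFinP; exact: measurable_indic.
transitivity (\int[Po]_w (counting A * (\1_H w)%:E))%E.
  rewrite ge0_integralZl//; last exact: counting_ge0.
  by rewrite integral_indic// setIT.
apply: ge0_ae_eq_integral => //.
- by apply: emeasurable_funM => //; exact: measurable_cst.
- exact: (measurableT_comp m1 (pair2_measurable omega)).
- by move=> w _; rewrite mule_ge0// ?counting_ge0// lee_fin.
have ae0 : {ae Po, forall w : walk_space V, w 0%N = o}.
  exists [set w : walk_space V | w 0%N <> o]; split => //.
    by apply: measurableC; exact: measurable_walk_at.
  exact: (walk_starts bounded conn trans deg_gt0 srwP).
apply: filterS ae0 => w w0 _; rewrite /new_sites /= w0 -/A indicE.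
congr (_ * (nat_of_bool _)%:R%:E)%E; apply/idP/asboolP; rewrite inE /H/= => h j /h;
  by rewrite w0.
Qed.

End Convergence.


(** * Convergence in L^q *)

Section ExponentialMoments.
Context d (T : measurableType d) (R : realType) (P : probability T R).
Variables (x : nat -> T -> R) (s M : R).
Hypotheses (s_gt0 : 0 < s) (x_ge0 : forall n z, 0 <= x n z).
Hypotheses (mx : forall n, measurable_fun setT (x n)).
Hypothesis expM : forall n, (\int[P]_z (expR (s * x n z))%:E <= M%:E)%E.

Lemma measurable_powR_dist (kappa c : R) n : measurable_fun setT (fun z => `|x n z - c| `^ kappa).
Proof.
apply: (@measurableT_comp _ _ _ _ _ _ (fun u : R => u `^ kappa)) => //.
by apply: measurableT_comp => //; exact: measurable_funB.
Qed.

Lemma uniform_moment (kappa c : R) : 0 < kappa -> exists2 B, 0 <= B &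
  forall n, (\int[P]_z (`|x n z - c| `^ kappa)%:E <= B%:E)%E.
Proof.
move=> k0; have [K K0 h] := powR_dist_le_expR c s_gt0 k0.
have M0 : 0 <= M.
  rewrite -lee_fin; apply: le_trans (expM 0); apply: integral_ge0 => z _.
  by rewrite lee_fin expR_ge0.
exists (K * M); first exact: mulr_ge0.
move=> n; have me : measurable_fun setT (fun z => (expR (s * x n z))%:E : \bar R).
  by apply/measurable_EFinP; apply: measurableT_comp => //; exact: measurable_funM.
have mKe : measurable_fun setT (fun z => K%:E * (expR (s * x n z))%:E : \bar R)%E.
  exact: emeasurable_funM.
have e0 z : (0 <= (expR (s * x n z))%:E :> \bar R)%E by rewrite lee_fin expR_ge0.
apply: (@le_trans _ _ (\int[P]_z (K%:E * (expR (s * x n z))%:E))%E).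
  apply: ge0_le_integral => //.
  - by apply/measurable_EFinP; exact: measurable_powR_dist.
  - by move=> z _; rewrite -EFinM lee_fin; exact: h.
rewrite (ge0_integralZl P measurableT me (fun z _ => e0 z)) ?lee_fin//.
by rewrite EFinM; apply: lee_wpmul2l => //; rewrite lee_fin.
Qed.

(** Split y = |x_n - c|^q by y <= min y L + y^2 / L: dominated convergence handles the first term,
    and the bounded moment of order 2q the second. *)
Lemma vitali_exponential (c q eps : R) : {ae P, forall z, x n z @[n --> \oo] --> c} ->
  0 < q -> 0 < eps ->
  \forall n \near \oo, (\int[P]_z (`|x n z - c| `^ q)%:E <= eps%:E)%E.
Proof.
move=> xc q0 e0.
have [B B0 hB] := uniform_moment c (mulr_gt0 q0 (ltr0n R 2)).
pose y n z := `|x n z - c| `^ q.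
have my n : measurable_fun setT (y n) by exact: measurable_powR_dist.
have y0 n z : 0 <= y n z by exact: powR_ge0.
have y2 n z : y n z ^+ 2 = `|x n z - c| `^ (q * 2) by rewrite powRrM -powR_mulrn.
(* This makes B / L at most eps / 2; B + 1 keeps L positive when B = 0. *)
pose L := 2 * (B + 1) / eps; have L0 : 0 < L by rewrite divr_gt0// mulr_gt0// ltr_wpDl.
have mmin n : measurable_fun setT (fun z => (Num.min (y n z) L)%:E : \bar R).
  by apply/measurable_EFinP; exact: measurable_minr.
have min0 n z : 0 <= Num.min (y n z) L by rewrite le_min y0 ltW.
have [] := @dominated_convergence _ _ R P setT measurableT
  (fun n z => (Num.min (y n z) L)%:E) (cst 0%E) (cst L%:E) mmin (measurable_cst _).
- apply: filterS xc => z zc _; apply/cvg_EFin; first exact: nearW.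
  apply/cvgrPdist_le => e ee.
  move/cvgrPdist_le : zc => /(_ (e `^ q^-1)); rewrite powR_gt0// => /(_ isT).
  apply: filterS => n h; rewrite /= sub0r normrN ger0_norm// ge_min; apply/orP; left.
  rewrite /y distrC -(powRr1 (ltW ee)) -(mulVf (lt0r_neq0 q0)) powRrM.
  by apply: ge0_ler_powR; rewrite ?nnegrE ?powR_ge0// ltW.
- by apply: finite_measure_integrable_cst.
- by apply: aeW => z n _; rewrite abse_EFin lee_fin ger0_norm// ge_min lexx orbT.
move=> _ + _; rewrite /= => /fine_cvgP[finI].
have e2 : 0 < eps / 2 by rewrite divr_gt0.
move/cvgrPdist_le => /(_ _ e2); apply: filterS2 finI => n fn; rewrite sub0r normrN => hn.
have y2E z : (0 <= (y n z ^+ 2)%:E :> \bar R)%E by rewrite lee_fin sqr_ge0.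
have my2 : measurable_fun setT (fun z => (y n z ^+ 2)%:E : \bar R).
  by apply/measurable_EFinP; exact: measurable_funX.
have mLy2 : measurable_fun setT (fun z => (L^-1)%:E * (y n z ^+ 2)%:E : \bar R)%E.
  exact: emeasurable_funM.
have L1 : (0 <= (L^-1)%:E :> \bar R)%E by rewrite lee_fin invr_ge0 ltW.
have mabs : measurable_fun setT (fun z => `|(Num.min (y n z) L)%:E - 0|%E).
  by under eq_fun do rewrite sube0 gee0_abs ?lee_fin//; exact: mmin.
apply: (@le_trans _ _ (\int[P]_z (`|(Num.min (y n z) L)%:E - 0| + (L^-1)%:E * (y n z ^+ 2)%:E))%E).
  apply: ge0_le_integral => //.
  - by apply/measurable_EFinP; exact: my.
  - exact: emeasurable_funD.
  move=> z _; rewrite sube0 gee0_abs; last by rewrite lee_fin.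
  rewrite -EFinM -EFinD lee_fin -/(y n z).
  have [yL|Ly] := leP (y n z) L; first by rewrite lerDl mulr_ge0 ?invr_ge0 ?sqr_ge0 ?(ltW L0).
  apply: (@le_trans _ _ (L^-1 * y n z ^+ 2)); last by rewrite lerDr ltW.
  by rewrite ler_pdivlMl// expr2 ler_wpM2r ?(ltW Ly).
rewrite (ge0_integralD P measurableT _ mabs _ mLy2); [|by []|by move=> z _; exact: mule_ge0].
rewrite (ge0_integralZl P measurableT my2 (fun z _ => y2E z) L1).
have hB' : (\int[P]_z (y n z ^+ 2)%:E <= B%:E)%E.
  by under eq_integral do rewrite y2; exact: hB.
apply: (@le_trans _ _ ((eps / 2)%:E + (L^-1)%:E * B%:E)%E).
  apply: leeD; last exact: lee_wpmul2l.
  by rewrite -(fineK fn) lee_fin; apply: le_trans (ler_norm _) hn.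
rewrite -EFinM -EFinD lee_fin /L.
have : (2 * (B + 1) / eps)^-1 * B <= eps / 2; last by lra.
have B1 : 0 < B + 1 by rewrite ltr_wpDl.
rewrite (_ : (2 * (B + 1) / eps)^-1 * B = (eps / 2) * (B / (B + 1))); last by field; rewrite !gt_eqF.
by rewrite ler_piMr ?(ltW e2)// ler_pdivrMr// mul1r lerDl.
Qed.

End ExponentialMoments.

Section LqConvergence.
Variables (R : realType) (V : pointedType) (adj : rel V) (o : V).
Variables (p : R) (Po : probability (walk_space V) R) (Pp : probability (config adj) R).
Hypotheses (adj_sym : symmetric adj) (bounded : bounded_degrees adj) (conn : connected_graph adj).
Hypotheses (Vinf : infinite_set [set: V]).
Hypotheses (trans : vertex_transitive adj) (deg_gt0 : (0 < degree adj o)%N).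
Hypotheses (srwP : is_srw_law adj o Po) (p01 : 0 <= p <= 1) (bernP : is_bernoulli_percolation p Pp).
Variable chi : R.
Hypothesis le_chi : forall x, (\int[Pp]_omega counting (cluster omega x) <= chi%:E)%E.
Variables (t M : R).
Hypothesis t_gt0 : 0 < t.
Hypothesis exp_cluster : forall x,
  (\int[Pp]_omega (expR (t * fine (counting (cluster omega x))))%:E <= M%:E)%E.
Local Notation T := (walk_space V * config adj)%type.
Local Notation mu := (Po \x Pp)%E.
Local Notation Y := (@new_sites_real R V adj).

Definition range_mean n (z : T) : R := U_real R n z * n%:R^-1.

Lemma measurable_range_mean n : measurable_fun setT (range_mean n).
Proof.
apply: measurable_funM => //; elim: n => [|n IH].
  exact: (measurable_new_sites_real o adj_sym bounded conn).
apply: measurable_funD; first exact: (measurableT_comp IH (measurable_joint_shift 1)).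
exact: (measurable_new_sites_real o adj_sym bounded conn).
Qed.

Lemma range_mean_ge0 n z : 0 <= range_mean n z.
Proof.
apply: mulr_ge0; last by rewrite invr_ge0.
by elim: n z => [|n IH] z; [|apply: addr_ge0 => //]; exact: new_sites_real_ge0.
Qed.

(** The factor 2 bounds (n + 1) / n for n >= 1; at n = 0 the left side is 0 because the inverse of 0
    is 0. *)
Lemma range_mean_le n z : good z -> range_mean n z <= 2 * walk_mean (Y pred0) n z.
Proof.
move=> gz; have Y0 J (z' : T) : 0 <= Y J z' by exact: new_sites_real_ge0.
have m0 : 0 <= walk_mean (Y pred0) n z by rewrite mulr_ge0 ?invr_ge0// sumr_ge0.
have [n0|n0] := eqVneq n 0%N.
  have -> : range_mean n z = 0 by rewrite /range_mean n0 invr0 mulr0.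
  exact: mulr_ge0.
have np : 0 < n%:R :> R by rewrite ltr0n lt0n.
have h : U_real R n z <= \sum_(i < n.+1) Y pred0 (joint_shift i z).
  apply: le_trans (U_real_le R 0 n gz) _; rewrite subn0 addrK; apply: ler_sum => i _.
  exact: new_sites_real_le.
rewrite /range_mean ler_pdivrMr//; apply: le_trans h _.
have -> : \sum_(i < n.+1) Y pred0 (joint_shift i z) = n.+1%:R * walk_mean (Y pred0) n z.
  by rewrite /walk_mean mulrA divff ?mul1r// pnatr_eq0.
rewrite mulrAC; apply: ler_wpM2r => //.
by rewrite -natrM ler_nat mul2n -addnn -addn1 leq_add2l lt0n.
Qed.

(** Convexity bounds the exponential of a mean along the walk by a mean of exponentials, all with
    the same integral by stationarity. The exponent is halved to absorb the factor 2 of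
    [range_mean_le]. *)
Lemma range_exponential_moment n : (\int[mu]_z (expR (t / 2 * range_mean n z))%:E <= M%:E)%E.
Proof.
pose F z := (expR (t * Y pred0 z))%:E : \bar R.
have mY := measurable_new_sites_real (R := R) o adj_sym bounded conn pred0.
have mF : measurable_fun setT F.
  by apply/measurable_EFinP; apply: measurableT_comp => //; exact: measurable_funM.
have F0 z : (0 <= F z)%E by rewrite lee_fin expR_ge0.
have FI : joint_invariant adj_sym F.
  by move=> f fA w omega; rewrite /F joint_invariant_new_sites_real.
have FM : (\int[mu]_z F z <= M%:E)%E.
  rewrite (fubini_tonelli1 _ mF F0).
  apply: (@le_trans _ _ (\int[Po]_w cst M%:E w)%E); last by rewrite integral_cst//= probability_setT mule1.
  have M0 : (0 <= M%:E)%E.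
    by apply: le_trans (exp_cluster o); apply: integral_ge0 => omega _; rewrite lee_fin expR_ge0.
  apply: ge0_le_integral => //.
  - by move=> w _; apply: integral_ge0.
  - exact: (@measurable_fun_fubini_tonelli_F _ _ _ _ R Pp F mF F0).
  move=> w _; rewrite /fubini_F /F /new_sites_real; apply: le_trans (exp_cluster (w 0%N)).
  by under eq_integral do rewrite new_sites_pred0.
have mFi i : measurable_fun setT (fun z => F (joint_shift i z)).
  exact: (measurableT_comp mF (measurable_joint_shift i)).
have mS : measurable_fun setT (fun z => \sum_(i < n.+1) F (joint_shift i z))%E.
  by apply: emeasurable_sum => i.
have S0 z : (0 <= \sum_(i < n.+1) F (joint_shift i z))%E by exact: sume_ge0.
have i0 : (0 <= (n.+1%:R^-1)%:E :> \bar R)%E by rewrite lee_fin invr_ge0.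
apply: (@le_trans _ _ (\int[mu]_z ((n.+1%:R^-1)%:E * \sum_(i < n.+1) F (joint_shift i z)))%E).
  apply: ae_ge0_le_integral => //.
  - apply/measurable_EFinP; apply: measurableT_comp => //; apply: measurable_funM => //.
    exact: measurable_range_mean.
  - by move=> z _; exact: mule_ge0.
  - exact: emeasurable_funM.
  apply: filterS (ae_good o Po adj_sym bounded conn le_chi) => z gz _.
  rewrite /F sumEFin -EFinM lee_fin.
  apply: le_trans (expR_mean_le (fun i => Y pred0 (joint_shift i z)) t n).
  rewrite ler_expR mulrAC ler_pdivrMr// -mulrA; apply: ler_wpM2l; first exact: ltW.
  by rewrite [leRHS]mulrC; exact: range_mean_le.
rewrite (ge0_integralZl mu measurableT mS (fun z _ => S0 z) i0).
rewrite (ge0_integral_sum mu measurableT (f := fun (i : 'I_n.+1) z => F (joint_shift i z))) => [|//|//].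
rewrite (eq_bigr (fun=> \int[mu]_z F z))%E => [|i _]; last first.
  exact: (joint_stationary bounded conn trans deg_gt0 srwP bernP i mF F0 FI).
apply: (@le_trans _ _ ((n.+1%:R^-1)%:E * \sum_(i < n.+1) M%:E)%E).
  by apply: lee_wpmul2l => //; apply: lee_sum.
by rewrite sumEFin sumr_const card_ord -EFinM -(mulr_natl M) mulrA mulVf ?mul1r// pnatr_eq0.
Qed.

Lemma Lnorm_range n (q c : R) : 0 < q ->
  Lnorm mu q%:E (fun z : T => U R n z * (n%:R^-1)%:E - c%:E)%E =
    ((\int[mu]_z (`|range_mean n z - c| `^ q)%:E) `^ q^-1)%E.
Proof.
move=> q0; rewrite unlock; congr (_ `^ _)%E.
have mU := measurable_U (R := R) o adj_sym bounded conn n.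
apply: ge0_ae_eq_integral => //.
- apply: (measurableT_comp (measurable_poweR q)); apply: measurableT_comp => //.
  by apply: emeasurable_funB => //; apply: emeasurable_funM.
- apply/measurable_EFinP; apply: measurable_powR_dist => k; exact: measurable_range_mean.
- by move=> z _; exact: poweR_ge0.
apply: filterS (ae_good o Po adj_sym bounded conn le_chi) => z gz _.
by rewrite U_realE// -EFinM -EFinB abse_EFin poweR_EFin.
Qed.

Lemma range_cvg_in_L (q : R) : 1 <= q ->
  cvg_in_L mu q (fun n z => U R n z * (n%:R^-1)%:E)%E (cst (speed Po Pp)%:E).
Proof.
move=> q1; have q0 : 0 < q by exact: lt_le_trans q1.
have t2 : 0 < t / 2 by rewrite divr_gt0.
have um := uniform_moment t2 range_mean_ge0 measurable_range_mean range_exponential_moment.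
have qi : 0 <= q^-1 by rewrite invr_ge0 ltW.
have in0 (a : \bar R) : (0 <= a)%E -> a \in `[0%E, +oo%E] by move=> a0; rewrite in_itv/= a0 leey.
split.
- move=> n; split.
    by apply: emeasurable_funM => //; exact: (measurable_U o adj_sym bounded conn).
  have [B B0 hB] := um q 0 q0.
  have := Lnorm_range n 0 q0; under [X in Lnorm _ _ X]eq_fun do rewrite sube0.
  move=> ->; apply: poweR_lty; exact: le_lt_trans (hB n) (ltry _).
- split; first exact: measurable_cst.
  rewrite unlock; apply: poweR_lty.
  rewrite (_ : (fun _ => _) = cst (`|speed Po Pp| `^ q)%:E); last exact/funext.
  by rewrite integral_cst//= probability_setT mule1 ltry.
have E n : Lnorm mu q%:E ((fun z => U R n z * (n%:R^-1)%:E) \- cst (speed Po Pp)%:E)%E =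
    ((\int[mu]_z (`|range_mean n z - speed Po Pp| `^ q)%:E) `^ q^-1)%E := Lnorm_range n (speed Po Pp) q0.
under eq_fun do rewrite E.
have small (eps : R) : 0 < eps -> \forall n \near \oo,
    ((\int[mu]_z (`|range_mean n z - speed Po Pp| `^ q)%:E) `^ q^-1 <= eps%:E)%E.
  move=> e0; have eq0 : 0 < eps `^ q by rewrite powR_gt0.
  have := vitali_exponential t2 range_mean_ge0 measurable_range_mean range_exponential_moment
    (ae_U_real_cvg adj_sym bounded conn Vinf trans deg_gt0 srwP p01 bernP le_chi) q0 eq0.
  apply: filterS => n hn.
  have -> : (eps%:E = ((eps `^ q)%:E `^ q^-1))%E.
    by rewrite poweR_EFin -powRrM divff ?gt_eqF// powRr1// ltW.
  apply: gt0_ler_poweR => //; apply: in0.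
    by apply: integral_ge0 => z _; rewrite lee_fin powR_ge0.
  by rewrite lee_fin powR_ge0.
apply/fine_cvgP; split.
  apply: filterS (small 1 ltr01) => n hn; rewrite ge0_fin_numE ?poweR_ge0//.
  exact: le_lt_trans hn (ltry _).
apply/cvgrPdist_le => eps e0; apply: filterS (small eps e0) => n hn /=.
rewrite sub0r normrN ger0_norm ?fine_ge0 ?poweR_ge0// -lee_fin fineK//.
by rewrite ge0_fin_numE ?poweR_ge0// (le_lt_trans hn (ltry _)).
Qed.

End LqConvergence.

(** * Derivation of the standing assumptions from p < p_T, and conclusion *)

Theorem theorem1p3 (R : realType) (V : pointedType) (adj : rel V) (o : V)
    (p : R) (Po : probability (walk_space V) R)
    (Pp : probability (config adj) R) :
  simple_graph adj -> infinite_set [set: V] -> connected_graph adj ->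
  vertex_transitive adj -> bounded_degrees adj ->
  0 <= p -> p < p_T R adj o ->
  is_srw_law adj o Po -> is_bernoulli_percolation p Pp ->
  {ae (Po \x Pp)%E, forall z,
    (U R n z * (n%:R^-1)%:E)%E @[n --> \oo] --> c_p o Po Pp} /\
  forall q : R, 1 <= q ->
    cvg_in_L (Po \x Pp)%E q (fun n z => U R n z * (n%:R^-1)%:E)%E
      (cst (c_p o Po Pp)).
Proof.
move=> [adj_sym _] Vinf conn trans bounded p0 ppT srwP bernP.
pose S := [set r : R | 0 <= r <= 1 /\ exists2 P : probability (config adj) R,
  is_bernoulli_percolation r P & (\int[P]_omega counting (cluster omega o))%E = +oo%E].
have lbS : has_lbound S by exists 0 => r [/andP[]].
(* If [S] has a member, the infimum is at most that member, hence at most 1. If [S] is empty, [inf]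
   is 0 by convention and p < 0 contradicts p >= 0. *)
have p1 : p <= 1.
  have [[r Sr]|S0] := pselect (exists r, S r).
    have := ge_inf lbS Sr; case: Sr => /andP[_ r1] _; move: ppT; rewrite /p_T -/S; lra.
  move: ppT; rewrite /p_T -/S (_ : S = set0) ?inf0; first by lra.
  by apply/seteqP; split=> // r Sr; apply: S0; exists r.
have p01 : 0 <= p <= 1 by rewrite p0.
have deg_gt0 : (0 < degree adj o)%N.
  have [y yo] : exists y, y <> o.
    apply: contrapT => /forallNP h; apply: Vinf.
    apply: (@sub_finite_set _ _ [set o]); last exact: finite_set1.
    by move=> y _ /=; apply: contrapT; exact: h.
  have [[|z s] /= sp sl] := conn o y; first by case: yo.
  by case/andP: sp => oz _; rewrite cardfs_gt0; apply/fset0Pn; exists z; rewrite in_nb.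
(* An infinite mean would put p itself in the set defining p_T, with [Pp] as witness. *)
have Io_fin : (\int[Pp]_omega counting (cluster omega o) < +oo)%E.
  rewrite ltey; apply/eqP => Ioo.
  have : p_T R adj o <= p by apply: ge_inf => //; split=> //; exists Pp.
  by rewrite leNgt ppT.
have Io0 : (0 <= \int[Pp]_omega counting (cluster omega o))%E.
  by apply: integral_ge0 => omega _; exact: counting_ge0.
(* The maximum with 1 provides the lower bound on [chi] under which the exponent of
   [exponential_moment] is chosen. *)
pose chi := Num.max 1 (fine (\int[Pp]_omega counting (cluster omega o)))%E.
have le_chi x : (\int[Pp]_omega counting (cluster omega x) <= chi%:E)%E.
  have [f fA fo] := trans o x.
  have -> : (\int[Pp]_omega counting (cluster omega x) = \int[Pp]_omega counting (cluster omega o))%E.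
    rewrite -fo -[RHS](integral_reindex_edges bernP (@edge_image_inj _ _ adj_sym _ fA)).
    - by apply: eq_integral => omega _; rewrite -(counting_cluster_act adj_sym bounded fA).
    - exact: measurable_counting_cluster.
    - by move=> omega; exact: counting_ge0.
  by rewrite -[leLHS]fineK ?ge0_fin_numE// lee_fin /chi le_max lexx orbT.
have nbD x : (#|` nb adj x| <= degree adj o)%N by rewrite -(degreeE o bounded trans x).
have chi1 : 1 <= chi by rewrite /chi le_max lexx.
have [t t0 [M exp_cluster]] := exponential_moment adj_sym bounded p01 bernP nbD le_chi chi1 deg_gt0.
rewrite (c_pE adj_sym bounded conn trans deg_gt0 srwP le_chi); split.
  exact: (ae_U_cvg adj_sym bounded conn Vinf trans deg_gt0 srwP p01 bernP le_chi).
move=> q q1.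
exact: (range_cvg_in_L adj_sym bounded conn Vinf trans deg_gt0 srwP p01 bernP le_chi t0 exp_cluster q1).
Qed.
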